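(* Assume that either (i) $\omega_b\subset\omega$ and $\omega_b$ satisfies the Geometric Control Condition (GCC), or (ii) $0\le b(x)\le b_+$ for all $x\in\Omega$ with $b_+\in(0,b^*]$, there is $b_->0$ with $b>b_-$ a.e. in $\omega_b$, and both $\omega_b$ and $\omega$ satisfy the Piecewise Multipliers Geometric Condition (PMGC). Assume moreover that $f_1,f_2$ satisfy Hypothesis (N) of the context (with Lipschitz function $L$), and that $$\|a_2^-\|_{L^\infty(\Omega)}<\frac{\tilde\alpha}{\tilde M},$$ where $\tilde M,\tilde\alpha>0$ are constants with $\|\tilde S(t)\|_{\mathcal L(\mathcal H)}\le\tilde Me^{-\tilde\alpha t}$ for all $t\ge0$. Then for every sufficiently small constant $\rho>0$ there is a constant $C_\rho>0$ with $$L(C_\rho)<\frac{\tilde\alpha-\tilde M\|a_2^-\|_{L^\infty(\Omega)}}{\tilde M}$$ such that for every $U_0\in\mathcal H$ with $\|U_0\|_{\mathcal H}<\rho$ the Cauchy problem $$\dot U(t)=\tilde{\mathcal A}U(t)+a_2^-PU(t)+\mathcal F(U(t)),\ t>0,\qquad U(0)=U_0,$$ admits a unique global solution $U\in C([0,\infty);\mathcal H)$, and $$\|U(t)\|_{\mathcal H}\le\tilde M\|U_0\|_{\mathcal H}\,e^{-\left(\tilde\alpha-\tilde M\|a_2^-\|_{L^\infty(\Omega)}-\tilde ML(C_\rho)\right)t},\qquad\forall t\ge0.$$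
   Context: **Setting.** $\Omega\subset\mathbb R^n$ is a bounded open domain with boundary of class $C^2$; $a_1,b\in C^0(\overline\Omega,\mathbb R)$, $a_2\in L^\infty(\Omega)$ (real valued, possibly sign changing), $a_2^+=\max\{a_2,0\}$, $a_2^-=-\min\{a_2,0\}$; $a_1\ge 0$ a.e. in $\Omega$ and $a_1>a_0>0$ a.e. in a given open subset $\omega\subset\Omega$, for some constant $a_0$; $\omega_b$ is a non-empty open set with $\overline{\omega_b}\subset\{x\in\Omega: b(x)\ne 0\}$. The system considered is $$u_{tt}-\Delta u+b\,y_t+a_1u_t=f_1(u),\qquad y_{tt}-\Delta y-b\,u_t+a_2\,y_t=f_2(y)\quad\text{in }\Omega\times(0,\infty),$$ with $u=y=0$ on $\partial\Omega\times(0,\infty)$, $u(0)=u_0$, $u_t(0)=u_1$, $y(0)=y_0$, $y_t(0)=y_1$. **Abstract form.** $\mathcal H=(H_0^1(\Omega)\times L^2(\Omega))^2$ with norm $\|(u_1,u_2,y_1,y_2)\|_{\mathcal H}^2=\|\nabla u_1\|_{L^2}^2+\|u_2\|_{L^2}^2+\|\nabla y_1\|_{L^2}^2+\|y_2\|_{L^2}^2$. With $U=(u,u_t,y,y_t)$, $U_0=(u_0,u_1,y_0,y_1)\in\mathcal H$: $\tilde{\mathcal A}(u_1,u_2,y_1,y_2)=(u_2,\ \Delta u_1-by_2-a_1u_2,\ y_2,\ \Delta y_1+bu_2-a_2^+y_2)$ with domain $D(\tilde{\mathcal A})=((H^2(\Omega)\cap H_0^1(\Omega))\times H_0^1(\Omega))^2$;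 $P(u_1,u_2,y_1,y_2)=(0,0,0,y_2)$; $\mathcal F(u_1,u_2,y_1,y_2)=(0,f_1(u_1),0,f_2(y_1))$. $\tilde{\mathcal A}$ generates a contraction semigroup $(\tilde S(t))_{t\ge0}$ on $\mathcal H$. A solution is a mild solution, i.e. a continuous $\mathcal H$-valued function satisfying $$U(t)=\tilde S(t)U_0+\int_0^t\tilde S(t-s)a_2^-PU(s)\,ds+\int_0^t\tilde S(t-s)\mathcal F(U(s))\,ds.$$ **Geometric assumptions.** A subset $\omega\subset\Omega$ satisfies the Geometric Control Condition (GCC) if there is $T>0$ such that every ray of geometrical optics starting at any point $x\in\Omega$ at $t=0$ enters $\omega$ within time $T$. A subset $\omega\subset\Omega$ satisfies the Piecewise Multipliers Geometric Condition (PMGC) if there exist subsets $\Omega_j\subset\Omega$ with Lipschitz boundaries and points $x_j\in\mathbb R^n$, $j=1,\dots,J$, such that $\Omega_i\cap\Omega_j=\emptyset$ for $i\neq j$ and $\omega$ contains a neighborhood in $\Omega$ of $\bigcup_{j}\gamma_j(x_j)\cup(\Omega\setminus\bigcup_j\Omega_j)$, where $\gamma_j(x_j)=\{x\in\partial\Omega_j:(x-x_j)\cdot\nu_j(x)\ge0\}$ and $\nu_j$ is the outward unit normal to $\partial\Omega_j$. (G1): $\omega_b\subset\omega$ and $\omega_b$ satisfies the GCC. (G2): $0\le b(x)\le b_+$ for all $x\in\Omega$ with $b_+\in(0,b^*]$, there is $b_->0$ with $b>b_-$ a.e. in $\omega_b$, and both $\omega_b$ and $\omega$ satisfy the PMGC.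 Here $b^*>0$ is a constant depending on the domain and the control region, namely the threshold in the known result of Alabau-Boussouira, Wang and Yu giving exponential stability of the linear system with $a_2=0$, $f_1=f_2=0$. Under (G1) or (G2) there exist $\tilde M,\tilde\alpha>0$ with $\|\tilde S(t)\|_{\mathcal L(\mathcal H)}\le\tilde Me^{-\tilde\alpha t}$ for all $t\ge0$; $\tilde M,\tilde\alpha$ denote such constants. **Hypothesis (N).** $f_1,f_2:\mathbb R\to\mathbb R$ are continuous and: (1) $f_1(0)=f_2(0)=0$; (2) for every $r>0$ there is $L(r)>0$ such that for $i=1,2$, $\|f_i(u)-f_i(v)\|_{L^2(\Omega)}\le L(r)\|\nabla u-\nabla v\|_{L^2(\Omega)}$ for all $u,v\in H_0^1(\Omega)$ with $\|\nabla u\|_{L^2}\le r$, $\|\nabla v\|_{L^2}\le r$, and $L(r)\to0$ as $r\to0$; (3) there are strictly increasing continuous $h_1,h_2:\mathbb R_+\to\mathbb R_+$ with $h_i(0)=0$ and $\left|\int_\Omega f_i(u)u\,dx\right|\le h_i(\|\nabla u\|_{L^2})\|\nabla u\|_{L^2}^2$ for all $u\in H_0^1(\Omega)$, $i=1,2$. *)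

(* Defs.v *)
From HB Require Import structures.
From mathcomp Require Import all_boot all_order all_algebra.
From mathcomp Require Import all_classical all_reals all_analysis.
Set Implicit Arguments.
Unset Strict Implicit.
Unset Printing Implicit Defensive.
Import Order.TTheory GRing.Theory Num.Theory.
Import numFieldNormedType.Exports.
Local Open Scope classical_set_scope.
Local Open Scope ring_scope.

(* The product sigma-algebra on R^n, which is the Borel sigma-algebra.        *)
Definition rV_display : measure_display.
Proof. exact: default_measure_display. Qed.

Section measurable_rV.
Context {R : realType} (n : nat).
Let coord (i : 'I_n) (v : 'rV[R]_n) : measurableTypeR R := v ord0 i.

Let rV_set0 : g_sigma_preimage coord set0.
Proof. exact: sigma_algebra0. Qed.
Let rV_setC A : g_sigma_preimage coord A -> g_sigma_preimage coord (~` A).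
Proof. exact: sigma_algebraC. Qed.
Let rV_bigcup (F : _^nat) : (forall i, g_sigma_preimage coord (F i)) ->
  g_sigma_preimage coord (\bigcup_i (F i)).
Proof. exact: sigma_algebra_bigcup. Qed.

HB.instance Definition _ := @isMeasurable.Build rV_display
  'rV[R]_n (g_sigma_preimage coord) rV_set0 rV_setC rV_bigcup.

Lemma measurable_fun_coord (i : 'I_n) :
  measurable_fun [set: 'rV[R]_n] (fun v : 'rV[R]_n => v ord0 i).
Proof.
move=> _ Y mY; rewrite setTI; apply: sub_sigma_algebra => /=.
rewrite -bigcup_seq/=; exists i => /=; first by rewrite mem_index_enum.
by exists Y => //; rewrite setTI.
Qed.

Lemma measurable_fun_rVP d (T : measurableType d) (f : T -> 'rV[R]_n) :
  (forall i, measurable_fun [set: T] (fun x => f x ord0 i)) ->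
  measurable_fun [set: T] f.
Proof.
move=> mf _ A mA.
suff : g_sigma_preimage (fun i => coord i \o f) `<=` measurable.
  rewrite g_sigma_preimage_comp; apply.
  by exists A.
apply: smallest_sub; first exact: sigma_algebra_measurable.
rewrite -bigcup_seq; apply: bigcup_sub => i _ B [C mC <-].
exact: mf.
Qed.

End measurable_rV.

(* Lebesgue measure on R^n as an iterated product.                            *)
Section leb.
Context {R : realType}.
Local Notation mu1 := (@lebesgue_measure R).

Definition rV_cons n (p : R * 'rV[R]_n) : 'rV[R]_n.+1 :=
  row_mx (const_mx p.1 : 'rV[R]_1) p.2.

Lemma rV_cons0 n p : @rV_cons n p ord0 ord0 = p.1.
Proof.
have -> : ord0 = lshift n (ord0 : 'I_1) by exact: val_inj.
by rewrite [LHS]row_mxEl mxE.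
Qed.

Lemma rV_consS n p j : @rV_cons n p ord0 (lift ord0 j) = p.2 ord0 j.
Proof.
have -> : lift ord0 j = rshift 1 j by exact: val_inj.
by rewrite [LHS]row_mxEr.
Qed.

Lemma measurable_rV_cons n :
  measurable_fun [set: measurableTypeR R * 'rV[R]_n] (@rV_cons n).
Proof.
apply: measurable_fun_rVP => i; case: (unliftP ord0 i) => [j ->|->].
  under eq_fun do rewrite rV_consS.
  exact: (measurableT_comp (measurable_fun_coord j) measurable_snd).
by under eq_fun do rewrite rV_cons0; exact: measurable_fst.
Qed.

Section step.
Variables (n : nat) (m : {sigma_finite_measure set 'rV[R]_n -> \bar R}).

Definition leb_step : set 'rV[R]_n.+1 -> \bar R :=
  pushforward (mu1 \x m)%E (@rV_cons n).

Let mpre (A : set 'rV[R]_n.+1) :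
  measurable A -> measurable (@rV_cons n @^-1` A).
Proof. by move=> mA; rewrite -[X in measurable X]setTI; exact: measurable_rV_cons. Qed.

Let m0 : leb_step set0 = 0%E.
Proof. by rewrite /leb_step /pushforward preimage_set0 measure0. Qed.

Let mge0 A : (0 <= leb_step A)%E.
Proof. by rewrite /leb_step /pushforward; exact: measure_ge0. Qed.

Let msa : semi_sigma_additive leb_step.
Proof.
move=> F mF tF mU; rewrite /leb_step /pushforward preimage_bigcup.
apply: measure_semi_sigma_additive.
- by move=> i; exact: mpre.
- apply/trivIsetP => /= i j _ _ ij; rewrite -preimage_setI.
  by move/trivIsetP : tF => ->//; rewrite preimage_set0.
- by rewrite -preimage_bigcup; exact: mpre.
Qed.

HB.instance Definition _ := isMeasure.Build _ _ _ leb_step m0 mge0 msa.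

Let msf : sigma_finite setT leb_step.
Proof.
have [F TF mF] : sigma_finite setT (mu1 \x m)%E.
  have /sigma_finiteP[F [TF ndF Foo]] := sigma_finiteT mu1.
  have /sigma_finiteP[G [TG ndG Goo]] := sigma_finiteT m.
  exists (fun n => F n `*` G n).
    rewrite -setXTT TF TG predeqE => -[x y]; split.
      move=> [/= [i _ Fix] [k _ Gky]]; exists (maxn i k) => //; split.
      - by move: x Fix; exact/subsetPset/ndF/leq_maxl.
      - by move: y Gky; exact/subsetPset/ndG/leq_maxr.
    by move=> [i _ []/= ? ?]; split; exists i.
  move=> k; have [? ?] := Foo k; have [? ?] := Goo k.
  split; first exact: measurableX.
  by rewrite product_measure1E// lte_mul_pinfty// ge0_fin_numE.
pose u := (fun v : 'rV[R]_n.+1 => (v ord0 ord0, \row_j v ord0 (lift ord0 j)) : measurableTypeR R * 'rV[R]_n).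
have uK : cancel (@rV_cons n) u.
  move=> [x v]; rewrite /u rV_cons0; congr pair.
  by apply/rowP => j; rewrite mxE rV_consS.
have measu : measurable_fun setT u.
  apply/measurable_fun_pairP; split; first exact: measurable_fun_coord.
  apply: measurable_fun_rVP => i.
  rewrite (_ : (fun _ => _) = (fun v : 'rV[R]_n.+1 => v ord0 (lift ord0 i))).
    exact: measurable_fun_coord.
  by apply/funext => v /=; rewrite mxE.
exists (fun k => u @^-1` F k); first by rewrite -preimage_bigcup -TF.
move=> k; have [mFk oo] := mF k; split.
  by rewrite -[X in measurable X]setTI; exact: measu.
rewrite /leb_step /pushforward -comp_preimage.
rewrite (_ : u \o _ = id) ?preimage_id//; exact/funext.
Qed.
HB.instance Definition _ := Measure_isSigmaFinite.Build _ _ _ leb_step msf.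
End step.

Fixpoint leb n : {sigma_finite_measure set 'rV[R]_n -> \bar R} :=
  match n return {sigma_finite_measure set 'rV[R]_n -> \bar R} with
  | 0%N => \d_(0 : 'rV[R]_0)
  | k.+1 => leb_step (leb k)
  end.
End leb.

Lemma leb_box (R : realType) n (a b : 'rV[R]_n) : (forall i, a ord0 i <= b ord0 i) ->
  leb n [set v : 'rV[R]_n | forall i, v ord0 i \in `]a ord0 i, b ord0 i]] =
  (\prod_i (b ord0 i - a ord0 i))%:E.
Proof.
elim: n a b => [|n IH] a b ab /=.
  by rewrite big_ord0 diracE mem_set// => -[].
pose tl (v : 'rV[R]_n.+1) : 'rV[R]_n := \row_i v ord0 (lift ord0 i).
transitivity ((@lebesgue_measure R \x leb n)%E
    (`]a ord0 ord0, b ord0 ord0]%classic `*`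
     [set v : 'rV[R]_n | forall i, v ord0 i \in `]tl a ord0 i, tl b ord0 i]])).
  apply: (congr1 (@lebesgue_measure R \x leb n)%E); apply/seteqP; split => [[x v] /= h|[x v] /= [hx hv] i].
    split; first by have := h ord0; rewrite rV_cons0.
    by move=> i; have := h (lift ord0 i); rewrite rV_consS /tl !mxE.
  case: (unliftP ord0 i) => [j ->|->]; last by rewrite rV_cons0.
  by have := hv j; rewrite rV_consS /tl !mxE.
rewrite product_measure1E//.
- rewrite IH; last by move=> i; rewrite !mxE.
  rewrite big_ord_recl EFinM; congr (_ * _)%E.
    rewrite [LHS](lebesgue_measure_itv (Interval (BRight (a ord0 ord0)) (BRight (b ord0 ord0))))/= lte_fin.
    case: ifPn => [//|]; rewrite -leNgt => h.
    by apply/esym/congr1/eqP; rewrite subr_eq0 eq_le h ab.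
  by congr EFin; apply: eq_bigr => i _; rewrite !mxE.
- rewrite (_ : [set _ | _] = \bigcap_(i in [set` index_enum 'I_n])
    ((fun v : 'rV[R]_n => v ord0 i) @^-1` `]tl a ord0 i, tl b ord0 i]%classic)).
    rewrite bigcap_seq; apply: bigsetI_measurable => i _.
    rewrite -[X in measurable X]setTI.
    by apply: measurable_fun_coord => //; exact: measurable_itv.
  apply/seteqP; split => v /= h i; first by move=> _; exact: h.
  apply: (h i).
  exact: mem_index_enum.
Qed.

Section calculus.
Context {R : realType} {n : nat}.
Implicit Types (x y : 'rV[R]_n) (f : 'rV[R]_n -> R).

Definition dot x y : R := \sum_i x ord0 i * y ord0 i.

Definition enorm x : R := Num.sqrt (dot x x).

Definition grad f x : 'rV[R]_n := \row_i 'D_(delta_mx ord0 i) f x.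

Definition partials (s : seq 'I_n) f : 'rV[R]_n -> R :=
  foldr (fun i g => 'D_(delta_mx ord0 i) g) f s.

Definition Ck (k : nat) f : Prop := forall s : seq 'I_n, (size s <= k)%N ->
  continuous (partials s f) /\
  ((size s < k)%N -> forall i x, derivable (partials s f) x (delta_mx ord0 i)).

Definition smooth f : Prop := forall k, Ck k f.

End calculus.

Section boundary.
Context {R : realType} {n : nat}.
Local Notation V := 'rV[R]_n.
Implicit Types (D : set V) (Phi : V -> R) (P : (V -> R) -> Prop).

Definition boundary D : set V := closure D `\` interior D.

(* After a rotation bringing the unit vector [e] onto a coordinate axis, [D]  *)
(* is near [x] the strict epigraph of [g] over the hyperplane orthogonal to   *)
(* [e]; [Phi] is the corresponding defining function, negative in [D].        *)
Definition chart P D (x : V) Phi : Prop :=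
  exists e g, [/\ enorm e = 1, P g,
    Phi = (fun y => g (y - dot y e *: e) - dot y e) &
    \forall y \near x, D y <-> Phi y < 0].

Definition boundary_of_class P D : Prop :=
  forall x, boundary D x -> exists Phi, chart P D x Phi.

Definition C2_boundary D := boundary_of_class (Ck 2) D.

Definition lipschitz_boundary D := boundary_of_class (fun g => lipschitz g) D.

(* For a Lipschitz boundary this exists at almost every boundary point only.  *)
Definition outward_normal D (x nu : V) : Prop := exists Phi,
  [/\ chart (fun g => lipschitz g) D x Phi, differentiable Phi x &
      nu = (enorm (grad Phi x))^-1 *: grad Phi x].

End boundary.

Section geometric_conditions.
Context {R : realType} {n : nat}.
Local Notation V := 'rV[R]_n.
Implicit Types (Omega omega : set V) (x xi : R -> V).

(* Rays of geometrical optics are the generalized bicharacteristics of the    *)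
(* wave operator in the sense of Melrose and Sjostrand (Hormander, The        *)
(* Analysis of Linear Partial Differential Operators III, Definition 24.3.6), *)
(* parametrized by time: [x] is the position and [xi] the unit velocity.      *)
(* At a glancing point the second derivative of [Phi] along [xi] is negative  *)
(* when the point is diffractive, and the ray goes straight on; otherwise     *)
(* [xi] is accelerated so as to stay tangent to the boundary.                 *)
Definition ray_regular Omega x xi (t : R) : Prop :=
  [/\ enorm (xi t) = 1, is_derive t 1 x (xi t) &
      (Omega (x t) /\ is_derive t 1 xi 0) \/
      (boundary Omega (x t) /\ exists Phi,
        [/\ chart (Ck 2) Omega (x t) Phi,
            dot (grad Phi (x t)) (xi t) = 0 &
            is_derive t 1 xi
              (- (Num.max 0 ('D_(xi t) ('D_(xi t) Phi) (x t)) /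
                  enorm (grad Phi (x t)) ^+ 2) *: grad Phi (x t))])].

Definition ray_reflection Omega x xi (t : R) : Prop :=
  [/\ boundary Omega (x t),
      \forall s \near t^'-, Omega (x s),
      \forall s \near t^'+, Omega (x s) &
      exists Phi (xi1 xi2 : V),
        [/\ chart (Ck 2) Omega (x t) Phi,
            dot (grad Phi (x t)) xi1 != 0,
            xi @ t^'- --> xi1, xi @ t^'+ --> xi2 &
            xi2 = xi1 - (2 * dot (grad Phi (x t)) xi1 /
                         enorm (grad Phi (x t)) ^+ 2) *: grad Phi (x t)]].

(* [B] is the set of reflection times. *)
Definition ray Omega x xi : Prop :=
  [/\ Omega (x 0), enorm (xi 0) = 1,
      {within `[0, +oo[%classic, continuous x},
      xi @ 0^'+ --> xi 0 &
      exists B : set R, [/\ forall T, finite_set (B `&` `[0, T]%classic),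
        forall t, 0 < t -> B t -> ray_reflection Omega x xi t &
        forall t, 0 < t -> ~ B t -> ray_regular Omega x xi t]].

Definition GCC Omega omega : Prop := exists2 T : R, 0 < T &
  forall x xi, ray Omega x xi -> exists2 t, 0 <= t <= T & omega (x t).

Definition gamma_set (D : set V) (p : V) : set V :=
  [set x | boundary D x /\
    exists2 nu, outward_normal D x nu & 0 <= dot (x - p) nu].

(* [lipschitz_boundary (D j)] makes [D j] open. *)
Definition PMGC Omega omega : Prop :=
  exists (J : nat) (D : 'I_J -> set V) (p : 'I_J -> V),
  [/\ forall j, D j `<=` Omega,
      forall j, lipschitz_boundary (D j),
      forall i j, i != j -> D i `&` D j = set0 &
      exists O : set V, [/\ open O,
        \bigcup_j gamma_set (D j) (p j) `|` (Omega `\` \bigcup_j D j) `<=` O &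
        O `&` Omega `<=` omega]].

End geometric_conditions.

(* Functions on [Omega] are represented by total functions whose values       *)
(* outside [Omega] are irrelevant.                                            *)
Section Sobolev.
Context {R : realType} {n : nat}.
Local Notation V := 'rV[R]_n.
Variable Omega : set V.
Implicit Types (f g u phi : V -> R) (i : 'I_n).
Local Notation mu := (@leb R n).

Definition in_L2 f : Prop := f \_ Omega \in Lfun mu 2%:E.

Definition in_Linfty f : Prop := f \_ Omega \in Lfun mu +oo%E.

Definition eL2norm f : \bar R := 'N[mu]_2%:E[EFin \o f \_ Omega].

Definition L2norm f : R := fine (eL2norm f).

Definition Linftynorm f : R := fine 'N[mu]_+oo[EFin \o f \_ Omega].

Definition test_function phi : Prop := smooth phi /\
  exists K : set V, [/\ compact K, K `<=` Omega & forall x, ~ K x -> phi x = 0].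

Definition weak_partial i u g : Prop := forall phi, test_function phi ->
  (\int[mu]_(x in Omega) (u x * 'D_(delta_mx ord0 i) phi x) =
   - \int[mu]_(x in Omega) (g x * phi x))%R.

(* A representative of the weak derivative of [u] in L^2(Omega). *)
Definition wderiv i u : V -> R :=
  xget (cst 0) [set g | in_L2 g /\ weak_partial i u g].

Definition laplacian u : V -> R := \sum_i wderiv i (wderiv i u).

Definition in_H1 u : Prop :=
  in_L2 u /\ forall i, exists2 g, in_L2 g & weak_partial i u g.

Definition gradnorm u : R := Num.sqrt (\sum_i L2norm (wderiv i u) ^+ 2).

Definition H1norm u : R := Num.sqrt (L2norm u ^+ 2 + gradnorm u ^+ 2).

Definition in_H10 u : Prop := in_H1 u /\ exists2 phi : nat -> V -> R,
  forall k, test_function (phi k) & H1norm (u - phi k) @[k --> \oo] --> 0.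

Definition in_H2 u : Prop := in_H1 u /\ forall i, in_H1 (wderiv i u).

End Sobolev.

Definition state (R : realType) (n : nat) : Type :=
  (('rV[R]_n -> R) * ('rV[R]_n -> R) * ('rV[R]_n -> R) * ('rV[R]_n -> R))%type.

(* The energy space, through representatives: two states are the same element *)
(* when their components agree almost everywhere in [Omega].                  *)
Section energy_space.
Context {R : realType} {n : nat}.
Variable Omega : set 'rV[R]_n.
Local Notation H := (state R n).
Local Notation mu := (@leb R n).
Implicit Types (U W : H) (T : H -> H) (S : R -> H -> H) (g : R -> H).

Definition inH U : Prop := let: (u1, u2, y1, y2) := U in
  [/\ in_H10 Omega u1, in_L2 Omega u2, in_H10 Omega y1 & in_L2 Omega y2].

Definition eqH U W : Prop :=
  let: (u1, u2, y1, y2) := U in let: (v1, v2, z1, z2) := W in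
  [/\ ae_eq mu Omega u1 v1, ae_eq mu Omega u2 v2,
      ae_eq mu Omega y1 z1 & ae_eq mu Omega y2 z2].

Definition normH U : R := let: (u1, u2, y1, y2) := U in
  Num.sqrt (gradnorm Omega u1 ^+ 2 + L2norm Omega u2 ^+ 2 +
            gradnorm Omega y1 ^+ 2 + L2norm Omega y2 ^+ 2).

Definition opnormH T : \bar R :=
  ereal_sup [set (normH (T U))%:E | U in [set U | inH U /\ normH U <= 1]].

Definition continuousH g : Prop := forall t, 0 <= t ->
  normH (g s - g t) @[s --> within `[0, +oo[%classic (nbhs t)] --> 0.

(* [I] is the Riemann integral of [g] over [[a, b]]; for continuous [g], as   *)
(* below, this is the Bochner integral.                                       *)
Definition integralH g (a b : R) (I : H) : Prop :=
  [/\ forall s, a <= s <= b -> inH (g s), inH I &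
  forall eps : R, 0 < eps -> exists2 delta : R, 0 < delta &
  forall (m : nat) (p c : nat -> R), p 0%N = a -> p m = b ->
    (forall k, (k < m)%N -> p k <= c k <= p k.+1 /\ p k.+1 - p k < delta) ->
    normH (\sum_(k < m) (p k.+1 - p k) *: g (c k) - I) < eps].

Record contraction_semigroup S : Prop := ContractionSemigroup {
  semigroup_in : forall t U, 0 <= t -> inH U -> inH (S t U) ;
  semigroup_eq : forall t U W, 0 <= t -> inH U -> inH W ->
    eqH U W -> eqH (S t U) (S t W) ;
  semigroup_linear : forall t (k : R) U W, 0 <= t -> inH U -> inH W ->
    eqH (S t (k *: U + W)) (k *: S t U + S t W) ;
  semigroup0 : forall U, inH U -> eqH (S 0 U) U ;
  semigroupD : forall s t U, 0 <= s -> 0 <= t -> inH U ->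
    eqH (S (s + t) U) (S s (S t U)) ;
  semigroup_continuous : forall U, inH U ->
    normH (S t U - U) @[t --> 0^'+] --> 0 ;
  semigroup_contraction : forall t, 0 <= t -> (opnormH (S t) <= 1)%E }.

Definition generates (dom : H -> Prop) (A : H -> H) S : Prop :=
  contraction_semigroup S /\
  forall U W, inH U -> inH W ->
    (normH (t^-1 *: (S t U - U) - W) @[t --> 0^'+] --> 0) <->
    (dom U /\ eqH W (A U)).

Definition exp_bound S (M alpha : R) : Prop :=
  forall t : R, 0 <= t -> (opnormH (S t) <= (M * expR (- alpha * t))%:E)%E.

End energy_space.

Section system.
Context {R : realType} {n : nat}.
Local Notation V := 'rV[R]_n.
Local Notation H := (state R n).
Variable Omega : set V.
Implicit Types (omega omegab : set V) (a b : V -> R) (S : R -> H -> H).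

Definition dom_A (U : H) : Prop := let: (u1, u2, y1, y2) := U in
  [/\ in_H2 Omega u1 /\ in_H10 Omega u1, in_H10 Omega u2,
      in_H2 Omega y1 /\ in_H10 Omega y1 & in_H10 Omega y2].

Definition op_A (a1 : V -> R) b (a2 : V -> R) (U : H) : H := let: (u1, u2, y1, y2) := U in
  (u2, laplacian Omega u1 - b * y2 - a1 * u2,
   y2, laplacian Omega y1 + b * u2 - a2^\+ * y2).

(* [a2^-] times the projection [P] *)
Definition op_a2P (a2 : V -> R) (U : H) : H := let: (u1, u2, y1, y2) := U in
  (0, 0, 0, a2^\- * y2).

Definition op_F (f1 f2 : R -> R) (U : H) : H := let: (u1, u2, y1, y2) := U in
  (0, f1 \o u1, 0, f2 \o y1).

Definition mild_solution S (a2 : V -> R) (f1 f2 : R -> R) (U0 : H) (U : R -> H) : Prop :=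
  [/\ forall t, 0 <= t -> inH Omega (U t), continuousH Omega U &
  forall t : R, 0 <= t -> exists I1 I2 : H,
    [/\ integralH Omega (fun s => S (t - s) (op_a2P a2 (U s))) 0 t I1,
        integralH Omega (fun s => S (t - s) (op_F f1 f2 (U s))) 0 t I2 &
        eqH Omega (U t) (S t U0 + I1 + I2)]].

Definition damping omega (a1 : V -> R) : Prop :=
  [/\ {within closure Omega, continuous a1},
      {ae @leb R n, forall x, Omega x -> 0 <= a1 x} &
      exists2 a0 : R, 0 < a0 & {ae @leb R n, forall x, omega x -> a0 < a1 x}].

Definition coupling omegab b : Prop :=
  {within closure Omega, continuous b} /\
  closure omegab `<=` [set x | Omega x /\ b x != 0].

Definition G1 omega omegab : Prop := omegab `<=` omega /\ GCC Omega omegab.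

Definition coupling_range omegab b (bmax : R) : Prop :=
  (exists2 bp : R, 0 < bp <= bmax & forall x, Omega x -> 0 <= b x <= bp) /\
  (exists2 bm : R, 0 < bm & {ae @leb R n, forall x, omegab x -> bm < b x}).

(* The theorem of Alabau-Boussouira, Wang and Yu holds with the bound [bmax]  *)
(* on the coupling coefficient.                                               *)
Definition coupling_threshold omega omegab (bmax : R) : Prop := 0 < bmax /\
  forall a1 b S, damping omega a1 -> coupling omegab b ->
    coupling_range omegab b bmax -> PMGC Omega omegab -> PMGC Omega omega ->
    generates Omega dom_A (op_A a1 b (cst 0)) S ->
    exists M alpha : R, [/\ 0 < M, 0 < alpha & exp_bound Omega S M alpha].

Definition G2 omega omegab b : Prop :=
  exists2 bmax, coupling_threshold omega omegab bmax &
  [/\ coupling_range omegab b bmax, PMGC Omega omegab & PMGC Omega omega].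

(* The first estimate uses the extended-real norm, so it includes that        *)
(* [f u - f v] is in L^2(Omega).                                              *)
Definition hypothesis_N (f1 f2 L : R -> R) : Prop :=
  [/\ continuous f1 /\ continuous f2,
      f1 0 = 0 /\ f2 0 = 0,
      forall r : R, 0 < r -> 0 < L r /\
        forall f, f = f1 \/ f = f2 ->
        forall u v, in_H10 Omega u -> in_H10 Omega v ->
        gradnorm Omega u <= r -> gradnorm Omega v <= r ->
        (eL2norm Omega ((f \o u) - (f \o v))%R <=
         (L r * gradnorm Omega (u - v)%R)%:E)%E,
      L @ 0^'+ --> 0 &
      forall f, f = f1 \/ f = f2 -> exists h : R -> R,
        [/\ {within `[0, +oo[%classic, continuous h},
            {in `[0, +oo[ &, {homo h : r s / r < s}}, h 0 = 0 &
            forall u, in_H10 Omega u ->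
              `| \int[@leb R n]_(x in Omega) (f (u x) * u x) |%R <=
              h (gradnorm Omega u) * gradnorm Omega u ^+ 2]].

End system.

(* Main.v *)
Require Import Defs.
From mathcomp Require Import all_boot all_order all_algebra.
From mathcomp Require Import all_classical all_reals all_analysis.
From mathcomp Require Import measurable_realfun ess_sup_inf ring lra.
Set Implicit Arguments.
Unset Strict Implicit.
Unset Printing Implicit Defensive.
Import Order.TTheory GRing.Theory Num.Theory.
Import numFieldNormedType.Exports.
Local Open Scope classical_set_scope.
Local Open Scope ring_scope.

(** On the set of continuous curves U with |U(t)| <= M |U_0| e^{-beta t}, where
    beta = alpha - M (k + L(C)) and k is the essential supremum of a_2^-, the
    Duhamel map is a contraction for the supremum norm on [0, oo): since
    alpha - beta = M (k + L(C)), the estimate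
      M e^{-alpha t} |U_0|
        + int_0^t M e^{-alpha (t - s)} (k + L(C)) M |U_0| e^{-beta s} ds
      = M |U_0| e^{-beta t}
    reproduces the decay rate exactly, and the Lipschitz factor is at most
    M (k + L(C)) / alpha < 1.  The bound M |U_0| <= C keeps the curve in the ball
    where f_1 and f_2 are L(C)-Lipschitz, whence rho_0 = C / M.  Any two mild
    solutions agree by a Gronwall argument on each bounded time interval.

    Elements of the energy space are represented by functions, so the fixed point
    argument takes place in a complete seminormed space.  That the energy is such
    a seminorm, vanishing exactly on the a.e. zero states, rests on the uniqueness
    of weak derivatives, the completeness of L^2 and the Poincare inequality. *)

(** * Riemann integrals in a complete seminormed space *)

(** The integrals in a mild solution are limits of Riemann sums in the energy seminorm, so the
    calculus is rebuilt at that level. Existence of integrals comes from antiderivatives whose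
    increments are matched up to an error proportional to the length of the interval. Norm estimates
    compare with a scalar function [phi] that has an explicit primitive [Phi]; in the Duhamel
    estimates the primitives are exponentials, so no scalar integral is ever computed. The weight
    [m t] bounding [S t] is left free there: it is M e^{-alpha t} for the decay and the contraction,
    and the constant 1 for uniqueness. Uniqueness cannot reuse the contraction: a competing mild
    solution is not known to decay or to stay in the ball of radius C, so the Lipschitz constant of
    a larger ball, depending on the time interval, has to be absorbed. Since the semigroup acts on
    representatives, its laws and the fixed point equation hold only up to states of zero seminorm;
    every identity therefore reads [N (x - y) = 0]. *)

Lemma uniform_on_segment (R : realType) (a b : R) (P : R -> R -> Prop) :
  (forall x, a <= x <= b -> exists2 d : R, 0 < d &
     forall h x', 0 < h < d -> `|x' - x| < d -> a <= x' <= b -> P h x') ->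
  exists2 d : R, 0 < d & forall h x, 0 < h < d -> a <= x <= b -> P h x.
Proof.
move=> H.
(* Near-covering form of compactness, along the filter of [h] tending to 0 from the right. Uniform
   continuity, boundedness and uniform strong continuity of the semigroup are all drawn from it. *)
have /compact_near_coveringP/near_covering_withinP := @segment_compact R a b.
move=> /(_ _ (0:R)^'+ P _)[].
  move=> x; rewrite /= in_itv/= => /H[d d0 dP].
  exists (ball x d, [set h | 0 < h < d]).
    split; first by exists d.
    by near=> h => /=; apply/andP; split; near: h; [exact: nbhs_right_gt|exact: nbhs_right_lt].
  move=> [y h]/= [xy hd] yab.
  by apply: dP => //; rewrite distrC.
move=> d /= d0 dP; exists d => // h x /andP[h0 hd] xab.
apply: (dP h) => //=.
by rewrite sub0r normrN gtr0_norm.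
Unshelve. all: by end_near. Qed.

Lemma subrACA (V : zmodType) (a b c d : V) : a - b - (c - d) = (a - c) - (b - d).
Proof. by rewrite !opprD !opprK addrACA. Qed.

(** [D] cuts out the states of finite energy among arbitrary functions. [N] may vanish on nonzero
    elements, so limits are determined only up to these. Nonnegativity is a consequence: N 0 = 0 is
    at most N x + N (- x), which is twice N x. *)
Record complete_seminorm (R : realType) (E : lmodType R) (D : E -> Prop)
    (N : E -> R) : Prop := CompleteSeminorm {
  csn0 : D 0 ;
  csn_lin : forall k x y, D x -> D y -> D (k *: x + y) ;
  csnZ : forall k x, D x -> N (k *: x) = `|k| * N x ;
  csnD : forall x y, D x -> D y -> N (x + y) <= N x + N y ;
  csn_complete : forall u : nat -> E, (forall k, D (u k)) ->
    (forall e : R, 0 < e -> exists K, forall j k, (K <= j)%N -> (K <= k)%N ->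
       N (u j - u k) < e) ->
    exists2 l, D l & forall e : R, 0 < e -> exists K, forall k, (K <= k)%N ->
       N (u k - l) < e }.

Section seminorm.
Context {R : realType} {E : lmodType R} (D : E -> Prop) (N : E -> R).
Hypothesis DN : complete_seminorm D N.

Lemma sn_memD x y : D x -> D y -> D (x + y).
Proof. by move=> Dx Dy; rewrite -[x]scale1r; exact: csn_lin DN _ _ _ Dx Dy. Qed.

Lemma sn_memZ k x : D x -> D (k *: x).
Proof.
by move=> Dx; rewrite -[_ *: _]addr0; exact: csn_lin DN _ _ _ Dx (csn0 DN).
Qed.

Lemma sn_memN x : D x -> D (- x).
Proof. by move=> Dx; rewrite -scaleN1r; exact: sn_memZ. Qed.

Lemma sn_memB x y : D x -> D y -> D (x - y).
Proof. by move=> Dx Dy; apply: sn_memD => //; exact: sn_memN. Qed.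

Lemma sn_mem_sum m (f : nat -> E) :
  (forall k, (k < m)%N -> D (f k)) -> D (\sum_(k < m) f k).
Proof.
move=> Df; elim/big_ind: _ => //; [exact: csn0 DN|exact: sn_memD|].
by move=> i _; exact: Df.
Qed.

Lemma sn0 : N 0 = 0.
Proof. by rewrite -(scale0r 0) (csnZ DN)// ?normr0 ?mul0r//; exact: csn0 DN. Qed.

Lemma snN x : D x -> N (- x) = N x.
Proof. by move=> Dx; rewrite -scaleN1r (csnZ DN)// normrN normr1 mul1r. Qed.

Lemma sn_ge0 x : D x -> 0 <= N x.
Proof.
move=> Dx; have := csnD DN Dx (sn_memN Dx); rewrite subrr sn0 snN//.
by rewrite -mulr2n pmulrn_lge0.
Qed.

Lemma snB x y : D x -> D y -> N (x - y) <= N x + N y.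
Proof. by move=> Dx Dy; rewrite -(snN Dy); apply: csnD DN _ _ Dx (sn_memN Dy). Qed.

Lemma snC x y : D x -> D y -> N (x - y) = N (y - x).
Proof. by move=> Dx Dy; rewrite -snN ?opprB//; exact: sn_memB. Qed.

Lemma sn_tri y x z : D x -> D y -> D z -> N (x - z) <= N (x - y) + N (y - z).
Proof.
by move=> Dx Dy Dz; rewrite -(subrKA y); apply: csnD DN _ _ _ _; exact: sn_memB.
Qed.

Lemma sn_leD x y : D x -> D y -> N x <= N y + N (x - y).
Proof.
move=> Dx Dy; rewrite -{1}(subrK y x) addrC.
by apply: (csnD DN) => //; exact: sn_memB.
Qed.

Lemma snD_sub a b c d : D a -> D b -> D c -> D d ->
  N (a + b - (c + d)) <= N (a - c) + N (b - d).
Proof.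
move=> Da Db Dc Dd; rewrite opprD addrACA.
by apply: csnD DN _ _ _ _; exact: sn_memB.
Qed.

Lemma sn_sum m (f : nat -> E) (w : nat -> R) :
  (forall k, (k < m)%N -> D (f k)) ->
  (forall k, (k < m)%N -> N (f k) <= w k) ->
  N (\sum_(k < m) f k) <= \sum_(k < m) w k.
Proof.
elim: m => [|m IH] Df fw; first by rewrite !big_ord0 sn0.
rewrite !big_ord_recr/=; apply: le_trans (_ : N (\sum_(i < m) f i) + N (f m) <= _).
  apply: csnD DN _ _ _ _; last exact: Df.
  by apply: sn_mem_sum => k km; apply: Df; rewrite ltnS ltnW.
by apply: lerD; [apply: IH => k km; [apply: Df|apply: fw]; rewrite ltnS ltnW|exact: fw].
Qed.

Lemma sn_le0 x : D x -> (forall e : R, 0 < e -> N x <= e) -> N x = 0.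
Proof.
move=> Dx H; apply/eqP; rewrite eq_le sn_ge0// andbT.
by apply/ler_addgt0Pr => e e0; rewrite add0r; exact: H.
Qed.

Definition tagged_partition (a b d : R) m (p c : nat -> R) := [/\ p 0%N = a, p m = b &
  forall k, (k < m)%N -> p k <= c k <= p k.+1 /\ p k.+1 - p k < d].

Definition rsum (g : R -> E) m (p c : nat -> R) :=
  \sum_(k < m) (p k.+1 - p k) *: g (c k).

(** Written exactly as [integralH], with [D] and [N] in place of [inH] and [normH]: the two are
    convertible at the energy space. *)
Definition integral_sn (g : R -> E) (a b : R) (I : E) : Prop :=
  [/\ forall s : R, a <= s <= b -> D (g s), D I &
  forall eps : R, 0 < eps -> exists2 delta : R, 0 < delta &
  forall (m : nat) (p c : nat -> R), p 0%N = a -> p m = b ->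
    (forall k, (k < m)%N -> p k <= c k <= p k.+1 /\ p k.+1 - p k < delta) ->
    N (\sum_(k < m) (p k.+1 - p k) *: g (c k) - I) < eps].

Lemma partition_mono a b d m p c : tagged_partition a b d m p c ->
  forall j, (j <= m)%N -> forall i, (i <= j)%N -> p i <= p j.
Proof.
move=> [_ _ H]; elim=> [|j IH] jm i; first by rewrite leqn0 => /eqP ->.
rewrite leq_eqVlt => /predU1P[->//|ij].
apply: (le_trans (IH (ltnW jm) _ ij)).
by have [/andP[h1 h2] _] := H _ jm; exact: le_trans h2.
Qed.

Lemma partition_in a b d m p c : tagged_partition a b d m p c ->
  forall k, (k < m)%N -> [/\ a <= p k, p k <= c k, c k <= p k.+1, p k.+1 <= b & p k.+1 - p k < d].
Proof.
move=> t k km; have mono := partition_mono t.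
case: (t) => p0 pm /(_ _ km)[/andP[h1 h2] h3]; split => //.
  by rewrite -p0; apply: mono => //; exact: ltnW.
by rewrite -pm; apply: mono.
Qed.

Lemma partition_tag a b d m p c : tagged_partition a b d m p c ->
  forall k, (k < m)%N -> a <= c k <= b.
Proof.
move=> t k /(partition_in t)[h1 h2 h3 h4 _].
by rewrite (le_trans h1)//= (le_trans h3).
Qed.

Lemma sum_partition a b d m p c (w : R -> R) : tagged_partition a b d m p c ->
  \sum_(k < m) (w (p k.+1) - w (p k)) = w b - w a.
Proof.
move=> [<- <- _]; elim: m => [|m IH]; first by rewrite big_ord0 subrr.
by rewrite big_ord_recr/= IH; ring.
Qed.

Lemma rsum_mem g a b d m p c : (forall s : R, a <= s <= b -> D (g s)) ->
  tagged_partition a b d m p c -> D (rsum g m p c).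
Proof.
move=> Dg t; apply: (sn_mem_sum (f := fun k => (p k.+1 - p k) *: g (c k))).
by move=> k km; apply: sn_memZ; apply: Dg; exact: partition_tag t _ km.
Qed.

(** Telescoping: the error on each cell is at most [eps] times its length, hence at most
    [eps * (b - a)] in total, for every fine partition. The tag may be any point of the cell. *)
Lemma rsum_increment g F a b d eps m p c :
  (forall s : R, a <= s <= b -> D (g s)) -> (forall s : R, a <= s <= b -> D (F s)) ->
  (forall s t u : R, a <= s -> s <= t -> t <= u -> u <= b -> u - s < d ->
     N (F u - F s - (u - s) *: g t) <= eps * (u - s)) ->
  tagged_partition a b d m p c ->
  N (rsum g m p c - (F b - F a)) <= eps * (b - a).
Proof.
move=> Dg DF H t.
have -> : F b - F a = \sum_(k < m) (F (p k.+1) - F (p k)).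
  case: t => <- <- _; elim: (m) => [|m' IH]; first by rewrite big_ord0 subrr.
  by rewrite big_ord_recr/= -IH addrC subrKA.
rewrite /rsum -sumrB -(sum_partition id t) mulr_sumr.
have pin k : (k < m)%N -> (a <= p k <= b) /\ (a <= p k.+1 <= b).
  move=> /(partition_in t)[h1 h2 h3 h4 _]; split; apply/andP; split; lra.
apply: (@sn_sum m (fun k => (p k.+1 - p k) *: g (c k) - (F (p k.+1) - F (p k)))
  (fun k => eps * (p k.+1 - p k))) => k km; have [p1 p2] := pin k km;
  have [h1 h2 h3 h4 h5] := partition_in t km.
  apply: sn_memB; first by apply/sn_memZ/Dg; exact: partition_tag t _ km.
  by apply: sn_memB; exact: DF.
rewrite snC; first by apply: H => //.
  by apply/sn_memZ/Dg; exact: partition_tag t _ km.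
by apply: sn_memB; exact: DF.
Qed.

Lemma partition_exists (a b d : R) (P : R -> R -> R -> Prop) : a <= b -> 0 < d ->
  (forall u v, a <= u -> u <= v -> v <= b -> exists2 c, u <= c <= v & P u v c) ->
  exists m p c, tagged_partition a b d m p c /\ forall k, (k < m)%N -> P (p k) (p k.+1) (c k).
Proof.
move=> ab d0 H.
(* The successor makes the mesh strictly smaller than [d] and keeps [m] positive when a = b. *)
pose m := (Num.Def.truncn ((b - a) / d)).+1.
have m0 : (0:R) < m%:R by rewrite ltr0n.
have mP : (b - a) / m%:R < d.
  rewrite ltr_pdivrMr// mulrC -ltr_pdivrMr//.
  exact: truncnS_gt.
pose p k : R := a + (b - a) / m%:R * k%:R.
have pS k : p k.+1 - p k = (b - a) / m%:R by rewrite /p -natr1; ring.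
have s0 : 0 <= (b - a) / m%:R by rewrite divr_ge0 ?subr_ge0 ?(ltW m0).
have p0 : p 0%N = a by rewrite /p mulr0 addr0.
have pm : p m = b by rewrite /p mulfVK ?gt_eqF// addrC subrK.
have ple k : (k <= m)%N -> p k <= b.
  by move=> km; rewrite -pm lerD2l ler_wpM2l// ler_nat.
have [c cP] : exists c : nat -> R, forall k, (k < m)%N ->
    p k <= c k <= p k.+1 /\ P (p k) (p k.+1) (c k).
  suff /choice[c cP] : forall k, exists c : R, (k < m)%N ->
      p k <= c <= p k.+1 /\ P (p k) (p k.+1) c by exists c.
  move=> k; case: (ltnP k m) => km; last by exists 0.
  have [|||c c1 c2] := H (p k) (p k.+1); last by exists c.
  - by rewrite lerDl mulr_ge0.
  - by rewrite -subr_ge0 pS.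
  - exact: ple.
exists m, p, c; split; last by move=> k /cP[].
by split => // k /cP[h _]; rewrite pS.
Qed.

(* The tags are chosen by the mean value theorem, so that the scalar Riemann
   sum of [phi] is exactly the increment of [Phi]. *)
Lemma integral_sn_bound g a b I (Phi phi : R -> R) : a <= b ->
  integral_sn g a b I ->
  (forall s : R, is_derive s (1 : R) Phi (phi s)) ->
  (forall s : R, a <= s <= b -> N (g s) <= phi s) ->
  N I <= Phi b - Phi a.
Proof.
move=> ab [Dg DI HI] dPhi gphi.
apply/ler_addgt0Pr => e e0.
have [d d0 dP] := HI _ e0.
have [|m [p [c [t cP]]]] := @partition_exists a b d
    (fun u v c => Phi v - Phi u = phi c * (v - u)) ab d0.
  move=> u v au uv vb; have [|c cuv ->] := @MVT_segment R Phi phi u v uv (fun x _ => dPhi x).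
  apply: derivable_within_continuous => x _.
    exact: (@ex_derive _ _ _ _ _ _ _ (dPhi x)).
  by exists c => //; rewrite in_itv/= in cuv.
have Dr := rsum_mem Dg t.
case: (t) => p0 pm pk.
have := dP m p c p0 pm pk; rewrite -/(rsum g m p c) => /ltW hr.
have := sn_leD DI Dr; rewrite snC// => /le_trans; apply.
apply: lerD => //.
rewrite -(sum_partition Phi t).
apply: (@sn_sum m (fun k => (p k.+1 - p k) *: g (c k))
   (fun k => Phi (p k.+1) - Phi (p k))) => k km.
  by apply/sn_memZ/Dg; exact: partition_tag t _ km.
have [h1 h2 h3 h4 _] := partition_in t km.
have Dgc : D (g (c k)) by apply: Dg; exact: partition_tag t _ km.
rewrite cP// (csnZ DN)// ger0_norm ?subr_ge0; last exact: le_trans h3.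
rewrite mulrC ler_wpM2r ?subr_ge0//; first exact: le_trans h3.
by apply: gphi; exact: partition_tag t _ km.
Qed.

Lemma integral_sn_const_bound g a b I C : a <= b -> integral_sn g a b I ->
  (forall s : R, a <= s <= b -> N (g s) <= C) -> N I <= C * (b - a).
Proof.
move=> ab HI HC; have := @integral_sn_bound g a b I (fun s => C * s) (fun=> C) ab HI _ HC.
rewrite mulrBr; apply => s; apply: is_derive_eq.
by rewrite /GRing.scale/= mulr1.
Qed.

Lemma integral_sn_sub g g' a b I I' : integral_sn g a b I -> integral_sn g' a b I' ->
  integral_sn (fun s => g s - g' s) a b (I - I').
Proof.
move=> [Dg DI HI] [Dg' DI' HI']; split; [by move=> s sab; apply: sn_memB; auto|exact: sn_memB|].
move=> e e0; have e2 : 0 < e / 2 by lra.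
have [d d0 dP] := HI _ e2; have [d' d'0 dP'] := HI' _ e2.
exists (Num.min d d'); first by rewrite lt_min d0.
move=> m p c p0 pm pk.
have t : tagged_partition a b (Num.min d d') m p c by split.
have -> : \sum_(k < m) (p k.+1 - p k) *: (g (c k) - g' (c k)) - (I - I') =
   (rsum g m p c - I) - (rsum g' m p c - I').
  by rewrite subrACA /rsum -sumrB; under eq_bigr do rewrite scalerBr.
have pkd k : (k < m)%N ->
    (p k <= c k <= p k.+1 /\ p k.+1 - p k < d) /\ (p k <= c k <= p k.+1 /\ p k.+1 - p k < d').
  by move=> /pk[h]; rewrite lt_min => /andP[].
apply: le_lt_trans (snB _ _) _.
- by apply: sn_memB => //; exact: rsum_mem t.
- by apply: sn_memB => //; exact: rsum_mem t.
rewrite [e](splitr e); apply: ltrD.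
  by apply: dP => // k /pkd[].
by apply: dP' => // k /pkd[].
Qed.
End seminorm.

(** Each summand is the length of the part of the k-th cell to the left of [t]; these parts fill the
    segment from [x 0] to [min t (x m)]. *)
Lemma clamp_sum (R : realType) (x : nat -> R) (t : R) m :
  (forall k, (k < m)%N -> x k <= x k.+1) -> x 0%N <= t ->
  \sum_(k < m) (Num.min (Num.max t (x k)) (x k.+1) - x k) = Num.min t (x m) - x 0%N.
Proof.
elim: m => [|m IH] xle xt; first by rewrite big_ord0 min_r ?subrr.
rewrite big_ord_recr/= IH//; last by move=> k km; apply: xle; exact: ltnW.
have := xle m (ltnSn _).
by rewrite /Num.min /Num.max; do ! case: ifPn; rewrite -?leNgt; lra.
Qed.

(** * Existence of integrals of continuous curves *)

Section integral_existence.
Context {R : realType} {E : lmodType R} (D : E -> Prop) (N : E -> R).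
Hypothesis DN : complete_seminorm D N.

Definition cont_on (g : R -> E) (a b : R) := forall t : R, a <= t <= b ->
  forall e : R, 0 < e -> exists2 d : R, 0 < d &
  forall s : R, a <= s <= b -> `|s - t| < d -> N (g s - g t) < e.

Lemma cont_on_unif g a b : (forall s : R, a <= s <= b -> D (g s)) -> cont_on g a b ->
  forall e : R, 0 < e -> exists2 d : R, 0 < d &
  forall s t : R, a <= s <= b -> a <= t <= b -> `|s - t| < d -> N (g s - g t) < e.
Proof.
move=> Dg cg e e0.
have [x xab|d d0 dP] := @uniform_on_segment R a b
    (fun h x => forall t : R, a <= t <= b -> `|x - t| < h -> N (g x - g t) < e).
  have [|d d0 dP] := cg x xab (e / 2); first by lra.
  exists (d / 2) => [|h x' /andP[h0 hd] xx' x'ab t tab x't]; first by lra.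
  apply: le_lt_trans (sn_tri DN (y := g x) _ _ _) _; [exact: Dg..|].
  rewrite (snC DN (Dg _ xab) (Dg _ tab)) [e]splitr; apply: ltrD; apply: dP => //; first by lra.
  by move: xx' x't; rewrite !ltr_norml; lra.
exists (d / 2) => [|s t sab tab st]; first by lra.
by apply: (dP (d / 2)) => //; lra.
Qed.

Section polygonal.
Variables (g : R -> E) (a b : R) (ab : a <= b).
Hypothesis Dg : forall s : R, a <= s <= b -> D (g s).

(* [J n] is the primitive of the step function equal to [g (x n k)] on the [k]-th of
   [n.+1] pieces of equal length; these primitives converge to one of [g]. *)
Let x n k : R := a + (b - a) / n.+1%:R * k%:R.
Let w n k (t : R) := Num.min (Num.max t (x n k)) (x n k.+1) - x n k.
Let J n t := \sum_(k < n.+1) w n k t *: g (x n k).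

Let xS n k : x n k.+1 = x n k + (b - a) / n.+1%:R.
Proof. by rewrite /x -natr1; ring. Qed.

Let h0 n : 0 <= (b - a) / n.+1%:R.
Proof. by rewrite divr_ge0// subr_ge0. Qed.

Let x0 n : x n 0 = a. Proof. by rewrite /x mulr0 addr0. Qed.

Let xn n : x n n.+1 = b.
Proof. by rewrite /x mulfVK ?pnatr_eq0// addrC subrK. Qed.

Let xab n k : (k <= n.+1)%N -> a <= x n k <= b.
Proof.
move=> kn; rewrite -[X in _ <= _ <= X](xn n) /x lerDl mulr_ge0//=.
by rewrite lerD2l ler_wpM2l// ler_nat.
Qed.

Let DJ n t : D (J n t).
Proof.
apply: (sn_mem_sum DN (f := fun k => w n k t *: g (x n k))) => k kn.
by apply: (sn_memZ DN); apply: Dg; apply: xab; exact: ltnW.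
Qed.

(** Only the cells meeting the segment from [s] to [u] contribute. The left node of such a cell is
    within one cell length plus [u - s] of [t], so [g] varies there by less than [e], and the
    weights add up to [u - s]. *)
Let J_increment n (s t u e d : R) : a <= s -> s <= t -> t <= u -> u <= b -> u - s < d ->
  (b - a) / n.+1%:R < d ->
  (forall y z, a <= y <= b -> a <= z <= b -> `|y - z| < d + d -> N (g y - g z) < e) ->
  N (J n u - J n s - (u - s) *: g t) <= e * (u - s).
Proof.
move=> as_ st tu ub usd hd ge.
have tab : a <= t <= b by lra.
have sab : a <= s <= b by lra.
have uab : a <= u <= b by lra.
have sumw v : a <= v <= b -> \sum_(k < n.+1) w n k v = v - a.
  move=> /andP[av vb]; rewrite /w clamp_sum ?x0 ?xn// ?min_l//.
  by move=> k _; rewrite xS lerDl.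
have -> : u - s = \sum_(k < n.+1) (w n k u - w n k s).
  by rewrite sumrB (sumw u) ?(sumw s)//; ring.
rewrite /J -sumrB scaler_suml -sumrB mulr_sumr.
have gk k : (k < n.+1)%N -> D (g (x n k) - g t).
  by move=> kn; apply: (sn_memB DN); apply: Dg => //; apply: xab; exact: ltnW.
under eq_bigr do rewrite -scalerBl -scalerBr.
apply: (@sn_sum _ _ _ _ DN n.+1 (fun k => (w n k u - w n k s) *: (g (x n k) - g t))
   (fun k => e * (w n k u - w n k s))) => k kn.
  by apply: (sn_memZ DN); exact: gk.
rewrite (csnZ DN); last exact: gk.
have [->|w0] := eqVneq (w n k u - w n k s) 0; first by rewrite normr0 mul0r mulr0.
have : 0 <= w n k u - w n k s /\ x n k < u /\ s < x n k.+1.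
  have := h0 n; have := xS n k; move: w0; rewrite /w; move: (x n k) (x n k.+1) => y z.
  move=> w0 zE hh.
  have : Num.min (Num.max u y) z <> Num.min (Num.max s y) z.
    by move=> yz; move: w0; rewrite yz subrr eqxx.
  have yz : y <= z by rewrite zE lerDl.
  have su : s <= u by exact: le_trans tu.
  have : Num.min (Num.max s y) z <= Num.min (Num.max u y) z.
    by rewrite le_min !ge_min lexx orbT andbT ge_max !le_max su lexx orbT.
  move=> le1 ne1; split; first by rewrite opprB addrA subrK subr_ge0.
  split; rewrite ltNge; apply/negP => h; apply: ne1.
    by rewrite !max_r// (le_trans su).
  by rewrite !min_r// le_max ?h ?(le_trans h su).
move=> [w0' [xu sx]].
rewrite ger0_norm// mulrC ler_wpM2r//; apply/ltW/ge => //; first exact: xab (ltnW kn).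
rewrite ltr_norml; move: sx hd (h0 n) xu; rewrite xS; move: (x n k) (_ / _) => y h.
by move=> *; lra.
Qed.

(** For large [n] the increment estimate of [J n] holds with a [d] that does not depend on [n], so
    it survives the limit; completeness is used to obtain that limit at each time. *)
Lemma antiderivative_exists : cont_on g a b ->
  exists J : R -> E, (forall t : R, a <= t <= b -> D (J t)) /\
  forall e : R, 0 < e -> exists2 d : R, 0 < d &
  forall s t u : R, a <= s -> s <= t -> t <= u -> u <= b -> u - s < d ->
    N (J u - J s - (u - s) *: g t) <= e * (u - s).
Proof.
move=> cg.
have Jinc e : 0 < e -> exists2 d : R, 0 < d & exists K, forall n, (K <= n)%N ->
  forall s t u : R, a <= s -> s <= t -> t <= u -> u <= b -> u - s < d ->
    N (J n u - J n s - (u - s) *: g t) <= e * (u - s).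
  move=> e0; have [d d0 dP] := cont_on_unif Dg cg e0.
  exists (d / 2); first by lra.
  exists (Num.Def.truncn ((b - a) / (d / 2))) => n Kn s t u s1 s2 s3 s4 usd.
  apply: (J_increment (d := d / 2)) => //; last by rewrite -splitr.
  rewrite ltr_pdivrMr// mulrC -ltr_pdivrMr//; last by lra.
  apply: (lt_le_trans (truncnS_gt _)).
  by rewrite ler_nat ltnS.
have Ja n : J n a = 0.
  rewrite /J big1// => k _; rewrite /w max_r ?min_l ?subrr ?scale0r//.
    by rewrite xS lerDl.
  by have /andP[] := @xab n k (ltnW (ltn_ord k)).
have Jcauchy t : a <= t <= b -> forall e : R, 0 < e -> exists K, forall j k,
    (K <= j)%N -> (K <= k)%N -> N (J j t - J k t) < e.
  move=> tab e e0.
  have ba1 : 0 < b - a + 1 by lra.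
  have e'0 : 0 < e / (b - a + 1) / 2 by rewrite !divr_gt0.
  have [d d0 [K KP]] := Jinc _ e'0.
  exists K => j k Kj Kk.
  (* One fine Riemann sum on the segment from [a] to [t] is close to [J i t] for every large [i],
     because [J i] vanishes at [a]; this makes the values Cauchy. *)
  have [|//||m [p [c [tpc _]]]] := @partition_exists R a t d (fun _ _ _ => True).
  - by lra.
  - by move=> u v _ uv _; exists u => //; rewrite lexx.
  have tsub s : a <= s <= t -> a <= s <= b by lra.
  have inc i : (K <= i)%N -> N (rsum g m p c - J i t) <= e / (b - a + 1) / 2 * (t - a).
    move=> Ki; rewrite -[J i t]subr0 -(Ja i).
    apply: (rsum_increment DN) tpc => //; first by move=> s /tsub; exact: Dg.
    by move=> s u v s1 s2 s3 s4; apply: KP => //; lra.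
  have Dr : D (rsum g m p c).
    by apply: (rsum_mem DN) tpc => s /tsub; exact: Dg.
  apply: le_lt_trans (sn_tri DN (y := rsum g m p c) _ _ _) _ => //.
  rewrite (snC DN (DJ _ _) Dr).
  apply: (le_lt_trans (lerD (inc _ Kj) (inc _ Kk))).
  rewrite -mulrDl -splitr mulrAC ltr_pdivrMr// ltr_pM2l//.
  by lra.
have /choice[JJ JJP] : forall t, exists l, a <= t <= b -> D l /\
    forall e : R, 0 < e -> exists K, forall k, (K <= k)%N -> N (J k t - l) < e.
  move=> t; have [tab|tab] := pselect (a <= t <= b); last by exists 0.
  have [l Dl lP] := csn_complete DN (DJ^~ t) (Jcauchy t tab).
  by exists l.
exists JJ; split; first by move=> t /JJP[].
move=> e e0; have [d d0 [K KP]] := Jinc _ e0; exists d => // s t u s1 s2 s3 s4 usd.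
have sab : a <= s <= b by lra.
have uab : a <= u <= b by lra.
have tab : a <= t <= b by lra.
have [Ds sl] := JJP _ sab; have [Du ul] := JJP _ uab.
apply/ler_addgt0Pr => r r0.
have r2 : 0 < r / 2 by lra.
have [K1 K1P] := sl _ r2; have [K2 K2P] := ul _ r2.
pose k := maxn K (maxn K1 K2).
have kK : (K <= k)%N by exact: leq_maxl.
have kK1 : (K1 <= k)%N by rewrite /k maxnCA leq_maxl.
have kK2 : (K2 <= k)%N by rewrite /k maxnA leq_maxr.
have Dgt : D ((u - s) *: g t) by apply: (sn_memZ DN); exact: Dg.
apply: le_trans (sn_leD DN (y := J k u - J k s - (u - s) *: g t) _ _) _.
- by apply: (sn_memB DN) => //; exact: (sn_memB DN).
- by apply: (sn_memB DN) => //; exact: (sn_memB DN).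
apply: lerD; first exact: KP.
rewrite subrACA subrr subr0 subrACA.
apply: le_trans (snB DN _ _) _; [exact: (sn_memB DN)..|].
rewrite [r]splitr; apply: lerD; rewrite (snC DN)//; apply/ltW; [exact: K2P|exact: K1P].
Qed.

End polygonal.

Lemma integral_antiderivative (g J : R -> E) (a b : R) :
  (forall s : R, a <= s <= b -> D (g s)) ->
  (forall t : R, a <= t <= b -> D (J t)) ->
  (forall e : R, 0 < e -> exists2 d : R, 0 < d &
   forall s t u : R, a <= s -> s <= t -> t <= u -> u <= b -> u - s < d ->
    N (J u - J s - (u - s) *: g t) <= e * (u - s)) ->
  forall s t : R, a <= s -> s <= t -> t <= b -> integral_sn D N g s t (J t - J s).
Proof.
move=> Dg DJ H s t as_ st tb.
have sub (v : R) : s <= v <= t -> a <= v <= b by lra.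
split; first by move=> v /sub; exact: Dg.
  by apply: (sn_memB DN); apply: DJ; lra.
move=> e e0; have ts1 : 0 < t - s + 1 by lra.
have e'0 : 0 < e / (t - s + 1) by rewrite divr_gt0.
have [d d0 dP] := H _ e'0; exists d => // m p c p0 pm pk.
have tpc : tagged_partition s t d m p c by split.
apply: le_lt_trans (rsum_increment DN (eps := e / (t - s + 1)) _ _ _ tpc) _.
- by move=> v /sub; exact: Dg.
- by move=> v /sub; exact: DJ.
- by move=> v1 v2 v3 *; apply: dP => //; lra.
by rewrite mulrAC ltr_pdivrMr// ltr_pM2l//; lra.
Qed.

Lemma integral_sn_exists g a b : a <= b -> (forall s : R, a <= s <= b -> D (g s)) ->
  cont_on g a b -> exists I, integral_sn D N g a b I.
Proof.
move=> ab Dg cg; have [J [DJ JP]] := antiderivative_exists ab Dg cg.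
by exists (J b - J a); apply: integral_antiderivative JP _ _ _ _ _.
Qed.

End integral_existence.

(** * Semilinear Duhamel equations for an exponentially stable semigroup *)

Lemma is_derive_expR_affine (R : realType) (K c d s : R) :
  is_derive s (1 : R) (fun s => K * expR (c * s + d)) (K * c * expR (c * s + d)).
Proof.
have h : is_derive s (1 : R) (fun s => c * s + d) c.
  by apply: is_derive_eq; rewrite /GRing.scale/= mulr1 addr0.
have := is_derive1_comp (f := expR) (g := fun s => c * s + d) (x := s).
move=> /(_ _ _ (is_derive_expR _) h) he.
by apply: is_derive_eq; rewrite /GRing.scale/= mulrA mulrAC.
Qed.

(** Contraction and exponential decay are both recorded: the first drives continuity in time and
    uniqueness, the second the decay rate and the fixed point. *)
Record stable_semigroup (R : realType) (E : lmodType R) (D : E -> Prop)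
    (N : E -> R) (S : R -> E -> E) (M alpha : R) : Prop := StableSemigroup {
  sg_in : forall (t : R) x, 0 <= t -> D x -> D (S t x) ;
  sg_lin : forall (t k : R) x y, 0 <= t -> D x -> D y ->
    N (S t (k *: x + y) - (k *: S t x + S t y)) = 0 ;
  sg_0 : forall x, D x -> N (S 0 x - x) = 0 ;
  sg_D : forall (s t : R) x, 0 <= s -> 0 <= t -> D x -> N (S (s + t) x - S s (S t x)) = 0 ;
  sg_cont : forall x, D x -> forall e : R, 0 < e -> exists2 d : R, 0 < d &
    forall t : R, 0 < t < d -> N (S t x - x) < e ;
  sg_contr : forall (t : R) x, 0 <= t -> D x -> N (S t x) <= N x ;
  sg_exp : forall (t : R) x, 0 <= t -> D x -> N (S t x) <= M * expR (- alpha * t) * N x }.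

(** * Convolution of the semigroup with a continuous curve *)

Section convolution.
Context {R : realType} {E : lmodType R} (D : E -> Prop) (N : E -> R).
Hypothesis DN : complete_seminorm D N.
Variables (S : R -> E -> E) (M alpha : R).
Hypothesis SG : stable_semigroup D N S M alpha.

Definition cont0 (g : R -> E) := forall t : R, 0 <= t ->
  forall e : R, 0 < e -> exists2 d : R, 0 < d &
  forall s : R, 0 <= s -> `|s - t| < d -> N (g s - g t) < e.

Lemma cont0_on g T : cont0 g -> cont_on N g 0 T.
Proof.
move=> cg t /andP[t0 _] e e0; have [d d0 dP] := cg t t0 e e0.
by exists d => // s /andP[s0 _]; exact: dP.
Qed.

(** Boundedness is read as a statement about small [h] by taking [h^-1] as the bound. *)
Lemma cont_on_bounded g a b : (forall s : R, a <= s <= b -> D (g s)) -> cont_on N g a b ->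
  exists2 G : R, 0 < G & forall s : R, a <= s <= b -> N (g s) <= G.
Proof.
move=> Dg cg; have [x xab|d d0 dP] := @uniform_on_segment R a b (fun h x => N (g x) <= h^-1).
  have [d d0 dP] := cg x xab 1 ltr01.
  have Ng := sn_ge0 DN (Dg _ xab).
  exists (Num.min d (N (g x) + 1)^-1); first by rewrite lt_min d0 invr_gt0; lra.
  move=> h x' /andP[h0]; rewrite !lt_min => /andP[_ hN] /andP[xd _] x'ab.
  have /ltW : N (g x) + 1 < h^-1 by rewrite -[X in X < _]invrK ltf_pV2// posrE invr_gt0; lra.
  apply: le_trans; apply: le_trans (sn_leD DN (Dg _ x'ab) (Dg _ xab)) _.
  by rewrite lerD2l; apply/ltW/dP.
exists (d / 2)^-1 => [|s sab]; first by rewrite invr_gt0; lra.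
by apply: dP => //; lra.
Qed.

Lemma sg_sub t x y : 0 <= t -> D x -> D y -> N (S t x - S t y) <= N (S t (x - y)).
Proof.
move=> t0 Dx Dy; have Sx := sg_in SG t0 Dx; have Sy := sg_in SG t0 Dy.
have Sxy := sg_in SG t0 (sn_memB DN Dx Dy).
have := sg_lin SG (-1) t0 Dy Dx; rewrite !scaleN1r ![- _ + _]addrC => h.
have Dd := sn_memB DN Sx Sy.
by apply: le_trans (sn_leD DN Dd Sxy) _; rewrite (snC DN Dd Sxy) h addr0.
Qed.

Lemma sg_sub_contr t x y : 0 <= t -> D x -> D y -> N (S t x - S t y) <= N (x - y).
Proof.
move=> t0 Dx Dy; apply: le_trans (sg_sub t0 Dx Dy) _.
by apply: (sg_contr SG) => //; exact: (sn_memB DN).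
Qed.

(** Factoring out the contraction [S a] reduces every time increment to strong continuity at time
    0. *)
Lemma sg_time a b x : 0 <= a -> a <= b -> D x -> N (S b x - S a x) <= N (S (b - a) x - x).
Proof.
move=> a0 ab Dx; have ba0 : 0 <= b - a by rewrite subr_ge0.
have Sb := sg_in SG (le_trans a0 ab) Dx; have Sa := sg_in SG a0 Dx.
have Sba := sg_in SG ba0 Dx.
have := sg_D SG a0 ba0 Dx; rewrite subrKC => h.
apply: le_trans (sn_tri DN (y := S a (S (b - a) x)) _ _ _) _ => //.
  exact: sg_in SG _ _ a0 Sba.
by rewrite h add0r; exact: sg_sub_contr.
Qed.

(** Replacing [g r] by [g s] costs only their distance, by contraction; the time shift then acts on
    the fixed element [g s], where strong continuity applies. *)
Lemma conv_cont_on g t : 0 <= t -> (forall s : R, 0 <= s -> D (g s)) -> cont0 g ->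
  cont_on N (fun s => S (t - s) (g s)) 0 t.
Proof.
move=> t0 Dg cg s /andP[s0 st] e e0; have e2 : 0 < e / 2 by lra.
have [d d0 dP] := cg s s0 _ e2.
have [d' d'0 dP'] := sg_cont SG (Dg s s0) e2.
exists (Num.min d d'); first by rewrite lt_min d0.
move=> r /andP[r0 rt]; rewrite lt_min => /andP[rd rd'].
have Ds := Dg _ s0; have Dr := Dg _ r0.
have h : N (S (t - r) (g s) - S (t - s) (g s)) < e / 2.
  have [rs|sr|->] := ltgtP r s; last by rewrite subrr (sn0 DN).
  - have -> : t - s = t - r - (s - r) by ring.
    apply: le_lt_trans (@sg_time (t - r - (s - r)) (t - r) _ _ _ Ds) _; [lra|lra|].
    by apply: dP'; move: rd'; rewrite ltr_norml; lra.
  - rewrite (snC DN (sg_in SG _ Ds) (sg_in SG _ Ds)); [|lra|lra].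
    apply: le_lt_trans (@sg_time (t - r) (t - s) _ _ _ Ds) _; [lra|lra|].
    by apply: dP'; move: rd'; rewrite ltr_norml; lra.
have tr0 : 0 <= t - r by lra.
have ts0 : 0 <= t - s by lra.
apply: le_lt_trans (sn_tri DN (y := S (t - r) (g s)) _ _ _) _; [exact: (sg_in SG)..|].
rewrite [e]splitr ltrD//; apply: le_lt_trans (dP _ r0 rd).
exact: sg_sub_contr.
Qed.

Definition sg_conv g t I := integral_sn D N (fun s => S (t - s) (g s)) 0 t I.

Lemma conv_exists g t : 0 <= t -> (forall s : R, 0 <= s -> D (g s)) -> cont0 g ->
  exists I, sg_conv g t I.
Proof.
move=> t0 Dg cg; apply: (integral_sn_exists DN t0); last exact: conv_cont_on.
by move=> s /andP[s0 st]; apply: (sg_in SG); [rewrite subr_ge0|exact: Dg].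
Qed.

(** The increment of [V] from [t1] to [t2] is the integral over [t1, t2], at most [G * (t2 - t1)],
    plus the effect on [0, t1] of replacing S (t1 - s) by S (t2 - s), which is controlled by
    [S h (g s) - g s] with h = t2 - t1. *)
Lemma conv_cont0 g V : (forall s : R, 0 <= s -> D (g s)) -> cont0 g ->
  (forall t : R, 0 <= t -> sg_conv g t (V t)) -> cont0 V.
Proof.
move=> Dg cg cV; have DV t : 0 <= t -> D (V t) by move=> /cV[].
suff H (T e : R) : 0 <= T -> 0 < e -> exists2 d : R, 0 < d &
    forall t1 t2 : R, 0 <= t1 -> t1 <= t2 -> t2 <= T -> t2 - t1 < d -> N (V t2 - V t1) < e.
  move=> t t0 e e0; have [|d d0 dP] := H (t + 1) e _ e0; first by lra.
  exists (Num.min d 1) => [|s s0]; first by rewrite lt_min d0 ltr01.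
  rewrite lt_min !ltr_norml => /andP[/andP[h1 h2] /andP[h3 h4]].
  by have [st|ts] := leP s t; [rewrite (snC DN (DV _ s0) (DV _ t0))|]; apply: dP; lra.
move=> T0 e0.
have [G G0 GP] := cont_on_bounded (fun s (h : 0 <= s <= T) => Dg s (andP h).1) (cont0_on (T := T) cg).
have e'0 : 0 < e / (2 * (T + 1)) by rewrite divr_gt0//; lra.
set e' := e / _ in e'0.
(* Strong continuity at time 0, made uniform along the compact arc of [g]: passing from [x] to a
   nearby [x'] costs e'/4 twice, and the point [x] itself e'/2. *)
have [x /andP[x0 xT]|d d0 dP] := @uniform_on_segment R 0 T
    (fun h x => N (S h (g x) - g x) <= e').
  have Dx := Dg _ x0.
  have [|d1 d10 d1P] := sg_cont SG Dx (e := e' / 2); first by lra.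
  have [|d2 d20 d2P] := cg x x0 (e' / 4); first by lra.
  exists (Num.min d1 d2) => [|h x' /andP[h0]]; first by rewrite lt_min d10.
  rewrite !lt_min => /andP[h1 h2] /andP[xd1 xd2] /andP[x'0 x'T].
  have Dx' := Dg _ x'0.
  have Sx := sg_in SG (ltW h0) Dx; have Sx' := sg_in SG (ltW h0) Dx'.
  apply: le_trans (sn_tri DN (y := S h (g x)) _ _ _) _ => //.
  apply: le_trans (lerD (lexx _) (sn_tri DN (y := g x) _ _ _)) _ => //.
  have h3 := sg_sub_contr (ltW h0) Dx' Dx.
  have h4 := d2P _ x'0 xd2.
  have h5 : N (S h (g x) - g x) < e' / 2 by apply: d1P; rewrite h0.
  have h6 := snC DN Dx Dx'.
  by move: h3 h4 h5; rewrite h6; lra.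
exists (Num.min d (e / (2 * G))); first by rewrite lt_min d0 divr_gt0//; lra.
move=> t1 t2 t10; rewrite le_eqVlt => /predU1P[<- _ _|]; first by rewrite subrr (sn0 DN).
move=> t12 t2T; rewrite lt_min => /andP[td tG].
have t20 : 0 <= t2 by lra.
have Dg2 s : 0 <= s <= t2 -> D (S (t2 - s) (g s)).
  by move=> /andP[s0 st]; apply: (sg_in SG); [rewrite subr_ge0|exact: Dg].
(* A single antiderivative represents the integrals over [0, t2], [0, t1] and [t1, t2], so that
   additivity is a cancellation of its values. *)
have [J [DJ JP]] := antiderivative_exists DN t20 Dg2 (conv_cont_on t20 Dg cg).
have Ji := integral_antiderivative DN Dg2 DJ JP.
have D0 : D (J 0) by apply: DJ; lra.
have D1 : D (J t1) by apply: DJ; lra.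
have D2 : D (J t2) by apply: DJ; lra.
have V1 := DV _ t10; have V2 := DV _ t20.
have E2 : N (V t2 - (J t2 - J 0)) <= 0.
  have Ji2 := Ji 0 t2 (lexx _) t20 (lexx _).
  have := integral_sn_const_bound DN t20 (integral_sn_sub DN (cV _ t20) Ji2) (C := 0).
  by rewrite mul0r; apply => s _; rewrite subrr (sn0 DN).
have E1 : N ((J t1 - J 0) - V t1) <= e' * (t1 - 0).
  have Ji1 := Ji 0 t1 (lexx _) t10 (ltW t12).
  apply: (integral_sn_const_bound DN t10 (integral_sn_sub DN Ji1 (cV _ t10))).
  move=> s /andP[s0 st]; apply: le_trans (sg_time _ _ (Dg _ s0)) _; [lra|lra|].
  by apply: dP; lra.
have E3 : N (J t2 - J t1) <= G * (t2 - t1).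
  have Ji3 := Ji t1 t2 t10 (ltW t12) (lexx _).
  apply: (integral_sn_const_bound DN (ltW t12) Ji3) => s /andP[s1 s2].
  apply: le_trans (sg_contr SG _ (Dg s _)) _; [lra|lra|].
  by apply: GP; lra.
have F1 : e' * (t1 - 0) < e / 2.
  rewrite /e' subr0 mulrAC ltr_pdivrMr; last by lra.
  by rewrite mulrA divfK// ltr_pM2l//; lra.
have F3 : G * (t2 - t1) < e / 2.
  move: tG; rewrite ltr_pdivlMr; last by lra.
  lra.
apply: le_lt_trans (sn_tri DN (y := J t2 - J 0) _ _ _) _ => //.
  exact: (sn_memB DN).
apply: le_lt_trans (lerD E2 (sn_tri DN (y := J t1 - J 0) _ _ _)) _ => //; try exact: (sn_memB DN).
by rewrite subrACA subrr subr0; lra.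
Qed.

Section bounds.
Variable m : R -> R.
Hypothesis Sm : forall (t : R) x, 0 <= t -> D x -> N (S t x) <= m t * N x.
Hypothesis m0 : forall t : R, 0 <= m t.

Lemma conv_bound g t I (psi Phi : R -> R) : 0 <= t -> (forall s : R, 0 <= s -> D (g s)) ->
  sg_conv g t I ->
  (forall s : R, is_derive s (1 : R) Phi (m (t - s) * psi s)) ->
  (forall s : R, 0 <= s <= t -> N (g s) <= psi s) ->
  N I <= Phi t - Phi 0.
Proof.
move=> t0 Dg cI dPhi gpsi; apply: (integral_sn_bound DN t0 cI dPhi) => s /andP[s0 st].
apply: le_trans (Sm _ (Dg _ s0)) _; first by lra.
by rewrite ler_wpM2l//; apply: gpsi; rewrite s0.
Qed.

Lemma conv_sub_bound g g' t I I' (psi Phi : R -> R) : 0 <= t ->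
  (forall s : R, 0 <= s -> D (g s)) -> (forall s : R, 0 <= s -> D (g' s)) ->
  sg_conv g t I -> sg_conv g' t I' ->
  (forall s : R, is_derive s (1 : R) Phi (m (t - s) * psi s)) ->
  (forall s : R, 0 <= s <= t -> N (g s - g' s) <= psi s) ->
  N (I - I') <= Phi t - Phi 0.
Proof.
move=> t0 Dg Dg' cI cI' dPhi gpsi.
apply: (integral_sn_bound DN t0 (integral_sn_sub DN cI cI') dPhi) => s /andP[s0 st].
have ts : 0 <= t - s by lra.
apply: le_trans (sg_sub ts (Dg _ s0) (Dg' _ s0)) _.
apply: le_trans (Sm ts (sn_memB DN (Dg _ s0) (Dg' _ s0))) _.
by rewrite ler_wpM2l//; apply: gpsi; rewrite s0.
Qed.
End bounds.
End convolution.

Lemma geometric_lt (R : realType) (q K e : R) : 0 <= q -> q < 1 -> 0 < K -> 0 < e ->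
  exists n, q ^+ n * K < e.
Proof.
move=> q0 q1 K0 e0; have qq : `|q| < 1 by rewrite ger0_norm.
have /cvgrPdist_lt/(_ (e / K)) := cvg_expr qq.
rewrite divr_gt0// => /(_ isT)[n _ /(_ n (leqnn n))] /=.
rewrite sub0r normrN ger0_norm ?exprn_ge0// => h.
by exists n; rewrite -ltr_pdivlMr.
Qed.

(** * The Duhamel map: estimates, uniqueness and fixed point *)

Section semilinear.
Context {R : realType} {E : lmodType R} (D : E -> Prop) (N : E -> R).
Hypothesis DN : complete_seminorm D N.
Variables (S : R -> E -> E) (M alpha : R).
Hypothesis SG : stable_semigroup D N S M alpha.
Hypotheses (M0 : 0 < M) (alpha0 : 0 < alpha).
Variables (P F : E -> E) (k : R) (L : R -> R).
Hypothesis k0 : 0 <= k.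
Hypothesis P_in : forall x, D x -> D (P x).
Hypothesis F_in : forall x, D x -> D (F x).
Hypothesis P_lip : forall x y, D x -> D y -> N (P x - P y) <= k * N (x - y).
Hypothesis L_gt0 : forall r : R, 0 < r -> 0 < L r.
Hypothesis F_lip : forall (r : R) x y, 0 < r -> D x -> D y -> N x <= r -> N y <= r ->
  N (F x - F y) <= L r * N (x - y).
Hypotheses (P0 : N (P 0) = 0) (F0 : N (F 0) = 0).

Definition admissible (U : R -> E) := (forall t : R, 0 <= t -> D (U t)) /\ cont0 N U.

(** A relation instead of a map, since integrals are determined only up to null elements: [W] is an
    image of [U], and a fixed point is a curve related to itself. *)
Definition duhamel (U0 : E) (U W : R -> E) := forall t : R, 0 <= t -> exists I1 I2 : E,
  [/\ integral_sn D N (fun s => S (t - s) (P (U s))) 0 t I1,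
      integral_sn D N (fun s => S (t - s) (F (U s))) 0 t I2 &
      N (W t - (S t U0 + I1 + I2)) = 0].

Definition mild (U0 : E) (U : R -> E) :=
  [/\ forall t : R, 0 <= t -> D (U t), cont0 N U & duhamel U0 U U].

Lemma lip_cont0 B U : (forall x, D x -> D (B x)) ->
  (forall r : R, 0 < r -> exists2 l : R, 0 <= l & forall x y, D x -> D y -> N x <= r -> N y <= r ->
    N (B x - B y) <= l * N (x - y)) ->
  admissible U -> cont0 N (fun s => B (U s)).
Proof.
move=> B_in B_lip [DU cU] t t0 e e0; have Dt := DU _ t0.
have Nt := sn_ge0 DN Dt.
have [|l l0 lP] := B_lip (N (U t) + 1); first by lra.
(* The 1 keeps [U s] in the ball of radius [N (U t) + 1] where [l] is valid; the [+ 1] in the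
   quotient covers l = 0. *)
have e'0 : 0 < Num.min 1 (e / (l + 1)) by rewrite lt_min ltr01 divr_gt0//; lra.
have [d d0 dP] := cU t t0 _ e'0; exists d => // s s0 /(dP _ s0).
rewrite lt_min ltr_pdivlMr; last by lra.
move=> /andP[h1 h2]; have Ds := DU _ s0.
have Nd := sn_ge0 DN (sn_memB DN Ds Dt).
apply: le_lt_trans (lP _ _ Ds Dt _ _) _; [|lra|lra].
by apply: le_trans (sn_leD DN Ds Dt) _; lra.
Qed.

Lemma P_cont0 U : admissible U -> cont0 N (fun s => P (U s)).
Proof.
by apply: lip_cont0 => // r r0; exists k => // x y Dx Dy _ _; exact: P_lip.
Qed.

Lemma F_cont0 U : admissible U -> cont0 N (fun s => F (U s)).
Proof.
apply: lip_cont0 => // r r0; exists (L r); first exact/ltW/L_gt0.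
by move=> x y Dx Dy; exact: F_lip.
Qed.

Lemma cont0D g g' : (forall t : R, 0 <= t -> D (g t)) ->
  (forall t : R, 0 <= t -> D (g' t)) -> cont0 N g -> cont0 N g' ->
  cont0 N (fun t => g t + g' t).
Proof.
move=> Dg Dg' cg cg' t t0 e e0; have e2 : 0 < e / 2 by lra.
have [d d0 dP] := cg _ t0 _ e2; have [d' d'0 dP'] := cg' _ t0 _ e2.
exists (Num.min d d'); first by rewrite lt_min d0.
move=> s s0; rewrite lt_min => /andP[/(dP _ s0) h /(dP' _ s0) h'].
apply: le_lt_trans (snD_sub DN _ _ _ _) _; [exact: Dg|exact: Dg'|exact: Dg|exact: Dg'|].
by rewrite [e]splitr ltrD.
Qed.

Lemma orbit_cont0 x : D x -> cont0 N (fun t => S t x).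
Proof.
move=> Dx t t0 e e0; have [d d0 dP] := sg_cont SG Dx e0; exists d => // s s0.
have Ds := sg_in SG s0 Dx; have Dt := sg_in SG t0 Dx.
rewrite ltr_norml => /andP[h1 h2].
have [st|ts|->] := ltgtP s t; last by rewrite subrr (sn0 DN).
- rewrite (snC DN Ds Dt); apply: le_lt_trans (sg_time DN SG s0 (ltW st) Dx) _.
  by apply: dP; lra.
- apply: le_lt_trans (sg_time DN SG t0 (ltW ts) Dx) _.
  by apply: dP; lra.
Qed.

Lemma duhamel_exists U0 U : D U0 -> admissible U ->
  exists W, admissible W /\ duhamel U0 U W.
Proof.
move=> DU0 aU; have DU := aU.1.
have DPU (s : R) : 0 <= s -> D (P (U s)) by move=> /DU; exact: P_in.
have DFU (s : R) : 0 <= s -> D (F (U s)) by move=> /DU; exact: F_in.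
have conv_ex B : (forall s : R, 0 <= s -> D (B (U s))) -> cont0 N (fun s => B (U s)) ->
    exists V, forall t : R, 0 <= t -> sg_conv D N S (fun s => B (U s)) t (V t).
  move=> DB cB; suff /choice[V VP] : forall t : R, exists I, 0 <= t ->
      sg_conv D N S (fun s => B (U s)) t I by exists V.
  move=> t; have [t0|t0] := leP 0 t; last by exists 0.
  by have [I IP] := conv_exists DN SG t0 DB cB; exists I.
have [V1 V1P] := conv_ex _ DPU (P_cont0 aU).
have [V2 V2P] := conv_ex _ DFU (F_cont0 aU).
have D1 (t : R) : 0 <= t -> D (V1 t) by move=> /V1P[].
have D2 (t : R) : 0 <= t -> D (V2 t) by move=> /V2P[].
have D0 (t : R) : 0 <= t -> D (S t U0) by move=> t0; exact: (sg_in SG).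
exists (fun t => S t U0 + V1 t + V2 t); split; first split.
- move=> t t0; apply: (sn_memD DN); last exact: D2.
  by apply: (sn_memD DN); [exact: D0|exact: D1].
- apply: cont0D => //.
  + by move=> t t0; apply: (sn_memD DN); [exact: D0|exact: D1].
  + apply: cont0D => //; first exact: orbit_cont0.
    exact: (conv_cont0 DN SG DPU (P_cont0 aU) V1P).
  + exact: (conv_cont0 DN SG DFU (F_cont0 aU) V2P).
- move=> t t0; exists (V1 t), (V2 t); split; [exact: V1P|exact: V2P|].
  by rewrite subrr (sn0 DN).
Qed.

Section bounds.
Variable m : R -> R.
Hypothesis Sm : forall (t : R) x, 0 <= t -> D x -> N (S t x) <= m t * N x.
Hypothesis m0 : forall t : R, 0 <= m t.

Let is_deriveZ' (Phi : R -> R) (t l : R) (phi : R -> R) :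
  (forall s : R, is_derive s (1 : R) Phi (m (t - s) * phi s)) ->
  forall s : R, is_derive s (1 : R) (fun s => l * Phi s) (m (t - s) * (l * phi s)).
Proof.
move=> h s; have := h s => hs; apply: is_derive_eq.
by rewrite /GRing.scale/= mulrCA.
Qed.

Lemma duhamel_sub U0 U U' W W' t (r : R) (phi Phi : R -> R) : 0 <= t -> 0 < r -> D U0 ->
  admissible U -> admissible U' -> admissible W -> admissible W' ->
  duhamel U0 U W -> duhamel U0 U' W' ->
  (forall s : R, 0 <= s <= t -> N (U s) <= r /\ N (U' s) <= r) ->
  (forall s : R, 0 <= s <= t -> N (U s - U' s) <= phi s) ->
  (forall s : R, is_derive s (1 : R) Phi (m (t - s) * phi s)) ->
  N (W t - W' t) <= (k + L r) * (Phi t - Phi 0).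
Proof.
move=> t0 r0 DU0 [DU cU] [DU' cU'] [DW _] [DW' _] UW UW' Ur Uphi dPhi.
have [I1 [I2 [c1 c2 WE]]] := UW _ t0; have [I1' [I2' [c1' c2' WE']]] := UW' _ t0.
have D1 : D I1 by case: c1. have D2 : D I2 by case: c2.
have D1' : D I1' by case: c1'. have D2' : D I2' by case: c2'.
have DS : D (S t U0) by exact: (sg_in SG).
have DX : D (S t U0 + I1 + I2) by do !apply: (sn_memD DN).
have DX' : D (S t U0 + I1' + I2') by do !apply: (sn_memD DN).
have Wt := DW _ t0; have Wt' := DW' _ t0.
apply: le_trans (sn_tri DN (y := S t U0 + I1 + I2) _ _ _) _ => //.
rewrite WE add0r; apply: le_trans (sn_tri DN (y := S t U0 + I1' + I2') _ _ _) _ => //.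
rewrite (snC DN DX' Wt') WE' addr0 -(addrA _ I1) -(addrA _ I1') opprD addrACA subrr add0r.
apply: le_trans (snD_sub DN _ _ _ _) _ => //.
rewrite mulrDl; apply: lerD.
- rewrite mulrBr; apply: (conv_sub_bound DN SG Sm m0 (psi := fun s => k * phi s)
    (Phi := fun s => k * Phi s) t0 _ _ c1 c1').
  + by move=> s /DU; exact: P_in.
  + by move=> s /DU'; exact: P_in.
  + exact: is_deriveZ'.
  + move=> s sT; have s0 : 0 <= s by lra.
    apply: le_trans (P_lip (DU _ s0) (DU' _ s0)) _.
    by rewrite ler_wpM2l// Uphi.
- rewrite mulrBr; apply: (conv_sub_bound DN SG Sm m0 (psi := fun s => L r * phi s)
    (Phi := fun s => L r * Phi s) t0 _ _ c2 c2').
  + by move=> s /DU; exact: F_in.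
  + by move=> s /DU'; exact: F_in.
  + exact: is_deriveZ'.
  + move=> s sT; have s0 : 0 <= s by lra.
    have [h h'] := Ur _ sT.
    apply: le_trans (F_lip r0 (DU _ s0) (DU' _ s0) h h') _.
    by rewrite ler_wpM2l ?Uphi// ltW// L_gt0.
Qed.

(** Comparison with the zero state, whose images under [P] and [F] are null, turns the Lipschitz
    bounds into growth bounds. *)
Lemma duhamel_norm U0 U W t (r : R) (phi Phi : R -> R) : 0 <= t -> 0 < r -> D U0 ->
  admissible U -> admissible W -> duhamel U0 U W ->
  (forall s : R, 0 <= s <= t -> N (U s) <= r) ->
  (forall s : R, 0 <= s <= t -> N (U s) <= phi s) ->
  (forall s : R, is_derive s (1 : R) Phi (m (t - s) * phi s)) ->
  N (W t) <= m t * N U0 + (k + L r) * (Phi t - Phi 0).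
Proof.
move=> t0 r0 DU0 [DU cU] [DW _] UW Ur Uphi dPhi.
have [I1 [I2 [c1 c2 WE]]] := UW _ t0.
have D1 : D I1 by case: c1. have D2 : D I2 by case: c2.
have DS : D (S t U0) by exact: (sg_in SG).
have DX : D (S t U0 + I1 + I2) by do !apply: (sn_memD DN).
have Wt := DW _ t0.
apply: le_trans (sn_leD DN (y := S t U0 + I1 + I2) _ _) _ => //.
rewrite WE addr0 -addrA; apply: le_trans (csnD DN _ _) _ => //; first exact: (sn_memD DN).
apply: lerD; first exact: Sm.
apply: le_trans (csnD DN _ _) _ => //.
have D00 := csn0 DN.
rewrite mulrDl; apply: lerD.
- rewrite mulrBr. apply: (conv_bound DN Sm m0 (psi := fun s => k * phi s)
    (Phi := fun s => k * Phi s) t0 _ c1).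
  + by move=> s /DU; exact: P_in.
  + exact: is_deriveZ'.
  + move=> s sT; have s0 : 0 <= s by lra.
    apply: le_trans (sn_leD DN (P_in (DU _ s0)) (P_in D00)) _; rewrite P0 add0r.
    by apply: le_trans (P_lip (DU _ s0) D00) _; rewrite subr0 ler_wpM2l// Uphi.
- rewrite mulrBr; apply: (conv_bound DN Sm m0 (psi := fun s => L r * phi s)
    (Phi := fun s => L r * Phi s) t0 _ c2).
  + by move=> s /DU; exact: F_in.
  + exact: is_deriveZ'.
  + move=> s sT; have s0 : 0 <= s by lra.
    apply: le_trans (sn_leD DN (F_in (DU _ s0)) (F_in D00)) _; rewrite F0 add0r.
    apply: le_trans (F_lip r0 (DU _ s0) D00 (Ur _ sT) _) _; first by rewrite (sn0 DN) ltW.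
    by rewrite subr0 ler_wpM2l ?Uphi// ltW// L_gt0.
Qed.
End bounds.

(* Gronwall by iteration: with the weight [expR (2 * kp * s)], the Duhamel estimate
   halves any bound on the distance between the two solutions. *)
Lemma mild_unique U0 U W : D U0 -> mild U0 U -> mild U0 W ->
  forall t : R, 0 <= t -> N (W t - U t) = 0.
Proof.
move=> DU0 [DU cU dU] [DW cW dW] T T0.
have sub0 (s : R) : 0 <= s <= T -> 0 <= s by lra.
have [G1 G10 G1P] := cont_on_bounded DN (fun s h => DU s (sub0 s h)) (cont0_on (T := T) cU).
have [G2 G20 G2P] := cont_on_bounded DN (fun s h => DW s (sub0 s h)) (cont0_on (T := T) cW).
(* [r] bounds both solutions on [0, T], which fixes the Lipschitz constant [L r], and also their
   distance, which starts the iteration. *)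
pose r := G1 + G2; have r0 : 0 < r by rewrite /r; lra.
have Lr := L_gt0 r0; pose kp := k + L r; have kp0 : 0 < kp by rewrite /kp ltr_wpDl.
have H j : forall s : R, 0 <= s <= T -> N (W s - U s) <= r / 2 ^+ j * expR (2 * kp * s + 0).
  elim: j => [|j IH] s sT; have s0 := sub0 _ sT.
    apply: le_trans (snB DN (DW _ s0) (DU _ s0)) _.
    apply: (@le_trans _ _ r); first by rewrite /r addrC; apply: lerD; auto.
    rewrite expr0 divr1 ler_peMr ?(ltW r0)// -expR0 ler_expR addr0 mulr_ge0//.
    by rewrite mulr_ge0// ltW.
  pose B := r / 2 ^+ j; have B0 : 0 < B by rewrite divr_gt0// exprn_gt0.
  have := @duhamel_sub (fun=> 1) _ _ U0 W U W U s r
    (fun s => B * expR (2 * kp * s + 0))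
    (fun s => B / (2 * kp) * expR (2 * kp * s + 0)) s0 r0 DU0.
  move=> /(_ _ _ _ _ _ _ _ _ _ _ _) h.
  apply: le_trans (h _ _ (conj DW cW) (conj DU cU) (conj DW cW) (conj DU cU) dW dU _ _ _) _.
  - by move=> u x u0 Dx; rewrite mul1r; exact: (sg_contr SG).
  - by [].
  - move=> {h} u us; have uT : 0 <= u <= T by lra.
    by split; [apply: le_trans (G2P _ uT) _|apply: le_trans (G1P _ uT) _];
      rewrite /r ?lerDl ?lerDr ltW.
  - by move=> {h} u us; apply: IH; lra.
  - move=> u; rewrite mul1r.
    have := @is_derive_expR_affine R (B / (2 * kp)) (2 * kp) 0 u.
    by rewrite divfK// gt_eqF// mulr_gt0.
  have -> : r / 2 ^+ j.+1 = B / 2 by rewrite /B exprS invfM mulrCA mulrC.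
  rewrite -/kp mulr0 add0r expR0; set x := expR _.
  have -> : kp * (B / (2 * kp) * x - B / (2 * kp) * 1) = B / 2 * x - B / 2.
    by field; rewrite gt_eqF.
  by clear h; lra.
apply: (sn_le0 DN); first by apply: (sn_memB DN); auto.
move=> e e0.
have Tt : 0 <= T <= T by rewrite T0 lexx.
have rT0 : 0 < r * expR (2 * kp * T + 0) by rewrite mulr_gt0 ?expR_gt0.
have [||j jP] := @geometric_lt R (2^-1) _ e _ _ rT0 e0; [by lra|by lra|].
apply: le_trans (H j T Tt) _; apply/ltW; apply: le_lt_trans jP.
by rewrite exprVn mulrCA mulrA.
Qed.

Section existence.
Variables (C : R) (U0 : E).
Hypotheses (C0 : 0 < C) (LC : L C < (alpha - M * k) / M).
Hypotheses (DU0 : D U0) (U0C : M * N U0 <= C).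
Let kC := k + L C.
Let beta := alpha - M * k - M * L C.
(** Lipschitz constant of the source times the integral of M e^{-alpha s} over the half-line. As M
    kC = alpha - beta, both q < 1 and beta > 0 restate the hypothesis on [L C]. *)
Let q := kC * (M / alpha).

Let beta0 : 0 < beta.
Proof. by move: LC; rewrite ltr_pdivlMr// mulrC /beta; lra. Qed.

Let kC0 : 0 < kC. Proof. by rewrite /kC ltr_wpDl// L_gt0. Qed.

Let q0 : 0 <= q. Proof. by rewrite /q mulr_ge0 ?divr_ge0// ltW. Qed.

Let q1 : q < 1.
Proof.
by rewrite /q mulrA ltr_pdivrMr// mul1r -subr_gt0 /kC; move: beta0; rewrite /beta; lra.
Qed.

Definition decaying (U : R -> E) :=
  forall t : R, 0 <= t -> N (U t) <= M * N U0 * expR (- beta * t).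

Let decaying_le U : decaying U -> forall t : R, 0 <= t -> N (U t) <= C.
Proof.
move=> dU t t0; apply: le_trans (dU t t0) _; apply: le_trans _ U0C.
rewrite ler_piMr//; first by rewrite mulr_ge0 ?(sn_ge0 DN)// ltW.
by rewrite -expR0 ler_expR mulNr oppr_le0 mulr_ge0// ltW.
Qed.

Let m t := M * expR (- alpha * t).

Let m0 t : 0 <= m t.
Proof. by rewrite /m mulr_ge0 ?expR_ge0// ltW. Qed.

Lemma duhamel_decaying U W : admissible U -> admissible W -> duhamel U0 U W ->
  decaying U -> decaying W.
Proof.
move=> aU aW UW dU t t0.
pose K := M * N U0.
have ab : alpha - beta = M * kC by rewrite /beta /kC; ring.
have ab0 : 0 < alpha - beta by rewrite ab mulr_gt0.
have := @duhamel_norm m (sg_exp SG) m0 U0 U W t C (fun s => K * expR (- beta * s))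
  (fun s => M * K / (alpha - beta) * expR ((alpha - beta) * s + (- alpha * t))) t0 C0 DU0 aU aW UW.
move=> h; apply: le_trans (h _ _ _) _.
- by move=> s /andP[s0 _]; exact: decaying_le.
- by move=> s /andP[s0 _]; exact: dU.
- move=> s; have := @is_derive_expR_affine R (M * K / (alpha - beta)) (alpha - beta) (- alpha * t) s.
  rewrite divfK ?gt_eqF// => hd.
  apply: (is_derive_eq hd); rewrite /m mulrACA -expRD; congr (_ * expR _).
  by ring.
rewrite -/kC ab mulr0 add0r /m.
have -> : M * kC * t + - alpha * t = - beta * t by rewrite -ab; ring.
rewrite le_eqVlt; apply/orP; left; apply/eqP.
rewrite /K; field.
by rewrite !gt_eqF.
Qed.

Lemma duhamel_contraction U U' W W' d : admissible U -> admissible U' ->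
  admissible W -> admissible W' ->
  duhamel U0 U W -> duhamel U0 U' W' -> decaying U -> decaying U' ->
  (forall t : R, 0 <= t -> N (U t - U' t) <= d) ->
  forall t : R, 0 <= t -> N (W t - W' t) <= q * d.
Proof.
move=> aU aU' aW aW' UW UW' dU dU' Ud t t0.
have d0 : 0 <= d.
  apply: le_trans (Ud 0 (lexx _)); apply: (sn_ge0 DN); apply: (sn_memB DN).
    exact: aU.1. 
  exact: aU'.1.
have := @duhamel_sub m (sg_exp SG) m0 U0 U U' W W' t C (fun=> d)
  (fun s => M * d / alpha * expR (alpha * s + (- alpha * t))) t0 C0 DU0 aU aU' aW aW' UW UW'.
move=> h; apply: le_trans (h _ _ _) _.
- by move=> s /andP[s0 _]; split; exact: decaying_le.
- by move=> s /andP[s0 _]; exact: Ud.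
- move=> s; have := @is_derive_expR_affine R (M * d / alpha) alpha (- alpha * t) s.
  rewrite divfK ?gt_eqF// => hd.
  by apply: (is_derive_eq hd); rewrite /m mulrAC; congr (_ * expR _ * _); ring.
rewrite -/kC /q -[leRHS]mulrA ler_wpM2l ?(ltW kC0)//.
(* The integral of the weight over [0, t] is (M / alpha) (1 - e^{-alpha t}); the negative term is
   dropped. *)
rewrite mulNr subrr expR0 mulr1 [X in _ <= X]mulrAC lerBlDr lerDl mulr_ge0 ?expR_ge0//.
by rewrite divr_ge0 ?mulr_ge0// ltW.
Qed.

Lemma mild_exists : exists U, mild U0 U /\ decaying U.
Proof.
have adm0 : admissible (fun=> 0) /\ decaying (fun=> 0).
  split; first split; first by move=> _ _; exact: (csn0 DN).
    by move=> t _ e e0; exists 1 => // s _ _; rewrite subrr (sn0 DN).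
  by move=> t _; rewrite (sn0 DN) mulr_ge0 ?expR_ge0// mulr_ge0 ?(sn_ge0 DN)// ltW.
(* Choice turns the Duhamel relation into a map; its value on other curves is arbitrary. *)
have /choice[T TP] : forall U : R -> E, exists W, admissible U /\ decaying U ->
    (admissible W /\ decaying W) /\ duhamel U0 U W.
  move=> U; have [[aU dU]|nU] := pselect (admissible U /\ decaying U); last by exists U.
  have [W [aW UW]] := duhamel_exists DU0 aU; exists W => _.
  by split => //; split => //; exact: duhamel_decaying UW dU.
pose u n : R -> E := iter n T (fun=> 0).
have uP n : admissible (u n) /\ decaying (u n).
  by elim: n => [//|n IH]; have [] := TP _ IH.
have uD n (t : R) : 0 <= t -> D (u n t) by move=> t0; exact: (uP n).1.1.
(* All iterates are bounded by C, whence the initial distance 2 C. As [j] is arbitrary throughout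
   the induction, no geometric series has to be summed. *)
have udist n j (t : R) : 0 <= t -> N (u (n + j)%N t - u n t) <= q ^+ n * (2 * C).
  elim: n t => [|n IH] t t0.
    rewrite mul1r; apply: le_trans (snB DN (uD _ _ t0) (uD _ _ t0)) _.
    have h1 := decaying_le (uP (0 + j)%N).2 t0.
    have h2 := decaying_le (uP 0%N).2 t0.
    by lra.
  rewrite exprS -mulrA.
  have [[a1 d1] s1] := TP _ (uP (n + j)%N); have [[a2 d2] s2] := TP _ (uP n).
  exact: (duhamel_contraction (uP (n + j)%N).1 (uP n).1 a1 a2 s1 s2 (uP _).2 (uP _).2 IH).
have qn : forall e : R, 0 < e -> exists n, q ^+ n * (2 * C) < e.
  by move=> e e0; apply: geometric_lt => //; rewrite mulr_gt0.
have /choice[U UP] : forall t : R, exists l, 0 <= t -> D l /\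
    forall e : R, 0 < e -> exists K, forall n, (K <= n)%N -> N (u n t - l) < e.
  move=> t; have [t0|t0] := leP 0 t; last by exists 0.
  have [|l Dl lP] := csn_complete DN (uD^~ t ^~ t0); last by exists l.
  move=> e e0; have [|K KP] := qn (e / 2); first by lra.
  exists K => i j Ki Kj.
  apply: le_lt_trans (sn_tri DN (y := u K t) (uD _ _ t0) (uD _ _ t0) (uD _ _ t0)) _.
  rewrite (snC DN (uD _ _ t0) (uD j _ t0)).
  have := udist K (i - K)%N t t0; have := udist K (j - K)%N t t0.
  rewrite !subnKC// => h1 h2; lra.
have DU (t : R) : 0 <= t -> D (U t) by move=> /UP[].
have uU n (t : R) : 0 <= t -> N (u n t - U t) <= q ^+ n * (2 * C).
  move=> t0; apply/ler_addgt0Pr => e e0; have [_ /(_ _ e0)[K KP]] := UP _ t0.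
  apply: le_trans (sn_tri DN (y := u (n + K)%N t) (uD _ _ t0) (uD _ _ t0) (DU _ t0)) _.
  rewrite (snC DN (uD _ _ t0) (uD _ _ t0)); apply: lerD; first exact: udist.
  by apply/ltW/KP; exact: leq_addl.
have cU : cont0 N U.
  move=> t t0 e e0; have [|n nP] := qn (e / 3); first by lra.
  have [|d d0 dP] := (uP n).1.2 t t0 (e / 3); first by lra.
  exists d => // s s0 st.
  apply: le_lt_trans (sn_tri DN (y := u n s) (DU _ s0) (uD _ _ s0) (DU _ t0)) _.
  apply: le_lt_trans (lerD (lexx _) (sn_tri DN (y := u n t) (uD _ _ s0) (uD _ _ t0) (DU _ t0))) _.
  rewrite (snC DN (DU _ s0) (uD _ _ s0)).
  by have := uU n s s0; have := uU n t t0; have := dP s s0 st => h1 h2 h3; lra.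
have dU : decaying U.
  move=> t t0; apply/ler_addgt0Pr => e e0; have [n nP] := qn _ e0.
  apply: le_trans (sn_leD DN (DU _ t0) (uD n _ t0)) _.
  rewrite (snC DN (DU _ t0) (uD _ _ t0)); apply: lerD; first exact: (uP n).2.
  exact/ltW/(le_lt_trans (uU _ _ t0)).
have [[aW dW] UW] := TP U (conj (conj DU cU) dU).
have DW (t : R) : 0 <= t -> D (T U t) by move=> t0; exact: aW.1.
(* Both sides are close to [u n.+1]: [U] as the limit of the iterates, [T U] by one contraction step
   from [u n]. *)
have UTU (t : R) : 0 <= t -> N (U t - T U t) = 0.
  move=> t0; apply: (sn_le0 DN); first exact: (sn_memB DN (DU _ t0) (DW _ t0)).
  move=> e e0; have [|n nP] := qn (e / 2); first by lra.
  apply: le_trans (sn_tri DN (y := u n.+1 t) (DU _ t0) (uD _ _ t0) (DW _ t0)) _.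
  have [[a1 d1] s1] := TP _ (uP n).
  have := duhamel_contraction (uP n).1 (conj DU cU) a1 aW s1 UW (uP _).2 dU (fun t => uU n t) t0.
  have := uU n.+1 t t0; rewrite exprS -mulrA (snC DN (uD n.+1 _ t0) (DU _ t0)).
  have : q * (q ^+ n * (2 * C)) <= q ^+ n * (2 * C).
    by rewrite ler_piMl ?(ltW q1)// mulr_ge0 ?exprn_ge0// mulr_ge0// ltW.
  by rewrite -[T (u n) t]/(u n.+1 t) => h1 h2 h3; lra.
exists U; split => //; split => // t t0.
(* These are already integrals along [U]; only the left-hand side [T U t] is exchanged for [U t], at
   distance zero. *)
have [I1 [I2 [c1 c2 WE]]] := UW _ t0; exists I1, I2; split => //.
have D1 : D I1 by case: c1. have D2 : D I2 by case: c2.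
have DS : D (S t U0) by exact: (sg_in SG).
have DX : D (S t U0 + I1 + I2) by do !apply: (sn_memD DN).
apply: (sn_le0 DN); first exact: (sn_memB DN (DU _ t0) DX).
move=> e e0; apply: le_trans (sn_tri DN (y := T U t) (DU _ t0) (DW _ t0) DX) _.
by rewrite WE addr0 UTU// ltW.
Qed.

End existence.
End semilinear.

(** * The space L^2 *)

Section L2_space.
Context d (T : measurableType d) (R : realType).
Variable mu : {measure set T -> \bar R}.
Implicit Types f g : T -> R.
Local Notation L2 := (Lfun mu 2%:E).

(** At [f \_ Omega] it is convertible with [L2norm Omega f], so results on the whole space transfer
    to the domain. *)
Definition nrm2 f : R := fine 'N[mu]_2%:E[EFin \o f].

Lemma Lnorm2_sqr f : ('N[mu]_2%:E[EFin \o f] `^ 2 = \int[mu]_x (f x ^+ 2)%:E)%E.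
Proof.
rewrite poweR_Lnorm//; apply: eq_integral => x _.
by rewrite /= powR_mulrn// real_normK// num_real.
Qed.

Lemma L2P f : f \in L2 <->
  measurable_fun setT f /\ (\int[mu]_x (f x ^+ 2)%:E < +oo)%E.
Proof.
rewrite inE; split=> [/andP[]|[mf f2]].
  rewrite inE/= => mf; rewrite inE/= /finite_norm => f2; split => //.
  by rewrite -Lnorm2_sqr poweR_lty.
apply/andP; split; rewrite inE//= /finite_norm.
by move: f2; rewrite -Lnorm2_sqr => /lty_poweRy; apply.
Qed.

Lemma L2_measurable f : f \in L2 -> measurable_fun setT f.
Proof. by move=> /L2P[]. Qed.

Lemma nrm2_fin f : f \in L2 -> ((nrm2 f)%:E = 'N[mu]_2%:E[EFin \o f])%E.
Proof.
rewrite inE => /andP[_]; rewrite inE/= /finite_norm => f2.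
by rewrite /nrm2 fineK// ge0_fin_numE// Lnorm_ge0.
Qed.

Lemma nrm2_ge0 f : 0 <= nrm2 f.
Proof. by rewrite fine_ge0// Lnorm_ge0. Qed.

Lemma nrm2_sqrE f : f \in L2 -> ((nrm2 f ^+ 2)%:E = \int[mu]_x (f x ^+ 2)%:E)%E.
Proof.
move=> f2; rewrite -Lnorm2_sqr -nrm2_fin// poweR_EFin powR_mulrn//.
exact: nrm2_ge0.
Qed.

Lemma nrm2_sqr f : f \in L2 -> nrm2 f ^+ 2 = \int[mu]_x (f x ^+ 2).
Proof. by move=> f2; rewrite /Rintegral -nrm2_sqrE. Qed.

Lemma L2D f g : f \in L2 -> g \in L2 -> f \+ g \in L2.
Proof. exact: (Lfun_addr_closed mu (lee1n 2 : (1 <= 2%:E)%E)).2. Qed.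

Lemma L2Z k f : f \in L2 -> k *: f \in L2.
Proof.
move=> f2; have [h0 h] := Lfun_submod_closed mu (lee1n 2 : (1 <= 2%:E)%E).
by rewrite -[_ *: _]addr0; apply: h.
Qed.

Lemma L2_0 : (0 : T -> R) \in L2.
Proof. exact: (Lfun_addr_closed mu (lee1n 2 : (1 <= 2%:E)%E)).1. Qed.

Lemma nrm2D f g : f \in L2 -> g \in L2 -> nrm2 (f \+ g) <= nrm2 f + nrm2 g.
Proof.
move=> f2 g2; rewrite -lee_fin EFinD !nrm2_fin//; last exact: L2D.
apply: minkowski_EFin; [exact: L2_measurable..|].
by rewrite ler1n.
Qed.

Lemma nrm2Z k f : f \in L2 -> nrm2 (k *: f) = `|k| * nrm2 f.
Proof.
move=> f2; apply/eqP; rewrite -(@eqrXn2 _ 2) ?mulr_ge0 ?nrm2_ge0//.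
rewrite exprMn real_normK ?num_real// -eqe [in X in _ == X]EFinM !nrm2_sqrE//; last exact: L2Z.
rewrite -ge0_integralZl ?lee_fin ?sqr_ge0//=.
- by apply/eqP/eq_integral => x _; rewrite -EFinM -exprMn.
- by apply/measurable_EFinP; apply: measurable_funX; exact: L2_measurable.
- by move=> x _; rewrite lee_fin sqr_ge0.
Qed.

Lemma nrm2_ae_eq f g : f \in L2 -> g \in L2 -> f = g %[ae mu] -> nrm2 f = nrm2 g.
Proof.
move=> f2 g2 fg; apply/eqP; rewrite -(@eqrXn2 _ 2) ?nrm2_ge0// -eqe.
rewrite !nrm2_sqrE//; apply/eqP/ae_eq_integral => //.
- by apply/measurable_EFinP; apply: measurable_funX; exact: L2_measurable.
- by apply/measurable_EFinP; apply: measurable_funX; exact: L2_measurable.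
- by apply: filterS fg => x fg xT; rewrite fg.
Qed.

Lemma nrm2_eq0 f : f \in L2 -> nrm2 f = 0 -> f = 0 %[ae mu].
Proof.
move=> f2 f0; have := @Lnorm_eq0_eq0 _ _ _ mu (EFin \o f) 2%:E.
move=> /(_ _ _ _)h; have /= : \forall x \ae mu, setT x -> (EFin \o f) x = 0%E.
  apply: h => //; first by apply/measurable_EFinP; exact: L2_measurable.
  by rewrite -nrm2_fin// f0.
by apply: filterS => x /(_ I)[].
Qed.

Lemma L2_mul_integrable f g : f \in L2 -> g \in L2 ->
  mu.-integrable setT (EFin \o (f \* g)).
Proof. by move=> f2 g2; apply/Lfun1_integrable; exact: Lfun2_mul_Lfun1. Qed.

Lemma cauchy_schwarz f g : f \in L2 -> g \in L2 ->
  `|\int[mu]_x (f x * g x)| <= nrm2 f * nrm2 g.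
Proof.
move=> f2 g2; have ifg := L2_mul_integrable f2 g2.
apply: le_trans (le_normr_Rintegral _ _) _ => //.
rewrite -lee_fin EFinM !nrm2_fin//.
have := @hoelder _ _ _ mu f g 2 2 (L2_measurable f2) (L2_measurable g2).
rewrite Lnorm1 => h; apply: le_trans (h _ _ _) => //; last by rewrite [RHS]splitr !div1r.
rewrite /Rintegral fineK//.
by case/integrableP : ifg => _ h'; rewrite ge0_fin_numE// integral_ge0.
Qed.

Lemma L2_dominated f g : measurable_fun setT f -> g \in L2 ->
  (\forall x \ae mu, `|f x| <= `|g x|) -> f \in L2 /\ nrm2 f <= nrm2 g.
Proof.
move=> mf g2 fg; have mg := L2_measurable g2.
have le : (\int[mu]_x (f x ^+ 2)%:E <= \int[mu]_x (g x ^+ 2)%:E)%E.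
  apply: ae_ge0_le_integral => //.
  - by move=> x _; rewrite lee_fin sqr_ge0.
  - by apply/measurable_EFinP; exact: measurable_funX.
  - by move=> x _; rewrite lee_fin sqr_ge0.
  - by apply/measurable_EFinP; exact: measurable_funX.
  - apply: filterS fg => x fg _; rewrite lee_fin -[leLHS]real_normK ?num_real//.
    by rewrite -[leRHS]real_normK ?num_real// lerXn2r ?nnegrE.
have f2 : f \in L2.
  by apply/L2P; split => //; apply: le_lt_trans le _; case/L2P : g2.
split => //; rewrite -ler_sqr ?nnegrE ?nrm2_ge0//.
by rewrite -lee_fin !nrm2_sqrE.
Qed.

End L2_space.

(** * Completeness of L^2 *)

Section riesz_fischer.
Context d (T : measurableType d) (R : realType).
Variable mu : {measure set T -> \bar R}.
Local Notation L2 := (Lfun mu 2%:E).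
Local Notation nrm2 := (nrm2 mu).

Lemma L2B (f g : T -> R) : f \in L2 -> g \in L2 -> f - g \in L2.
Proof. by move=> f2 g2; apply: L2D => //; rewrite -scaleN1r; exact: L2Z. Qed.

Lemma nrm2_norm (f : T -> R) : f \in L2 -> Num.norm \o f \in L2 /\ nrm2 (Num.norm \o f) <= nrm2 f.
Proof.
move=> f2; apply: L2_dominated => //.
  by apply: measurableT_comp; [exact: normr_measurable|exact: L2_measurable f2].
by apply/nearW => x /=; rewrite normr_id.
Qed.

Lemma limn_einf_le (u : (\bar R)^nat) (c : \bar R) :
  (\forall n \near \oo, (u n <= c)%E) -> (limn_einf u <= c)%E.
Proof.
move=> [K _ uc]; rewrite limn_einf_lim.
apply: lime_le; first exact: is_cvg_einfs.
apply: nearW => n.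
apply: le_trans (uc (maxn K n) _); last exact: leq_maxl.
by apply: ereal_inf_lbound; exists (maxn K n) => //=; exact: leq_maxr.
Qed.

(** The partial sums [G m] of the absolute increments have norm below 2, so by monotone convergence
    their squares have an integrable limit, finite almost everywhere. There the telescoping series
    converges absolutely. *)
Lemma L2_fast_cauchy (g : nat -> T -> R) : (forall j, g j \in L2) ->
  (forall j, nrm2 (g j.+1 - g j) <= 2^-1 ^+ j) ->
  \forall x \ae mu, cvgn (fun j => g j x).
Proof.
move=> g2 gfast.
pose h j x : R := `|g j.+1 x - g j x|.
have h2 j : h j \in L2 /\ nrm2 (h j) <= 2^-1 ^+ j.
  have [h1 h2] := nrm2_norm (L2B (g2 j.+1) (g2 j)); split => //.
  exact: le_trans (gfast j).
pose G m x : R := \sum_(j < m) h j x.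
have GS m : G m.+1 = G m \+ h m.
  by apply/funext => x; rewrite /G big_ord_recr.
have G2 m : G m \in L2 /\ nrm2 (G m) <= 2 - 2 * 2^-1 ^+ m.
  elim: m => [|m [IH1 IH2]].
    have -> : G 0%N = 0 by apply/funext => x; rewrite /G big_ord0.
    split; first exact: L2_0.
    have := nrm2Z 0 (L2_0 mu); rewrite scale0r normr0 mul0r => ->.
    by rewrite expr0; lra.
  have [h1 h2'] := h2 m.
  rewrite GS; split; first exact: L2D.
  by apply: le_trans (nrm2D IH1 h1) _; rewrite exprS; lra.
have h0 j x : 0 <= h j x by rewrite normr_ge0.
have G0 m x : 0 <= G m x by rewrite sumr_ge0.
have Gnd x : nondecreasing_seq (G ^~ x).
  by apply/nondecreasing_seqP => m; rewrite /= GS lerDl.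
pose F m x := ((G m x ^+ 2)%:E).
have mF m : measurable_fun setT (F m).
  by apply/measurable_EFinP/measurable_funX; apply: L2_measurable (G2 m).1.
have F0 m x : (0 <= F m x)%E by rewrite lee_fin sqr_ge0.
have Fnd x : nondecreasing_seq (F ^~ x).
  by move=> m n mn; rewrite lee_fin lerXn2r ?nnegrE//; exact: Gnd.
have iF : (\int[mu]_x limn (F ^~ x) <= 4%:E)%E.
  rewrite (monotone_convergence mu measurableT mF)//.
  apply: lime_le.
    apply: ereal_nondecreasing_is_cvgn => m n mn.
    by apply: ge0_le_integral => // x _; exact: Fnd.
  apply: nearW => m; have [m1 m2] := G2 m.
  rewrite -nrm2_sqrE// lee_fin.
  have := nrm2_ge0 mu (G m); have : 0 <= 2^-1 ^+ m :> R by rewrite exprn_ge0.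
  by move=> ? ?; nra.
have mlim : measurable_fun setT (fun x => limn (F ^~ x)).
  apply: (emeasurable_fun_cvg F) => // x _.
  by apply: ereal_nondecreasing_is_cvgn => m n mn; exact: Fnd.
have lim0 x : (0 <= limn (F ^~ x))%E.
  apply: lime_ge; first by apply: ereal_nondecreasing_is_cvgn => m n mn; exact: Fnd.
  exact: nearW.
have intF : mu.-integrable setT (fun x => limn (F ^~ x)).
  apply/integrableP; split => //.
  under eq_integral do rewrite gee0_abs//.
  exact: le_lt_trans iF (ltry _).
have := integrable_ae measurableT intF; apply: filterS => x /(_ I) Fx.
have Fle m : (F m x <= limn (F ^~ x))%E.
  have -> := cvg_lim (@ereal_hausdorff R) (ereal_nondecreasing_cvgn (Fnd x)).
  by apply: ereal_sup_ubound; exists m.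
have Gcvg : cvgn (G ^~ x).
  apply: nondecreasing_is_cvgn; first exact: Gnd.
  (* From G <= G^2 + 1: a bound on the squares bounds the sums. *)
  exists (fine (limn (F ^~ x)) + 1) => _ [m _ <-].
  have : G m x ^+ 2 <= fine (limn (F ^~ x)) by rewrite -lee_fin fineK//; exact: Fle m.
  by have := G0 m x; move=> ? ?; nra.
have : cvgn (series (fun j => g j.+1 x - g j x)).
  apply: normed_cvg; rewrite (_ : [normed _] = G ^~ x)//.
  by apply/funext => m; rewrite /G -(big_mkord xpredT (h ^~ x)).
rewrite (_ : series _ = fun m => g m x - g 0%N x); last first.
  by apply/funext => m; rewrite /series/= telescope_sumr.
move=> cg; rewrite (_ : (fun j => g j x) = fun j => (g j x - g 0%N x) + g 0%N x).
  by apply: is_cvgD => //; exact: is_cvg_cst.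
by apply/funext => j; rewrite subrK.
Qed.

Lemma L2_complete (f : nat -> T -> R) : (forall k, f k \in L2) ->
  (forall e : R, 0 < e -> exists K, forall j k, (K <= j)%N -> (K <= k)%N ->
     nrm2 (f j - f k) < e) ->
  exists2 l, l \in L2 & forall e : R, 0 < e -> exists K, forall k, (K <= k)%N ->
     nrm2 (f k - l) < e.
Proof.
move=> f2 fC.
have /choice[K KP] : forall n, exists K, forall j k, (K <= j)%N -> (K <= k)%N ->
    nrm2 (f j - f k) < 2^-1 ^+ n.
  by move=> n; apply: fC; rewrite exprn_gt0.
(* The sum dominates [K n] and makes [phi] nondecreasing; the summand [n] makes it cofinal. *)
pose phi n := (n + \sum_(i < n.+1) K i)%N.
have phiK n : (K n <= phi n)%N by rewrite /phi big_ord_recr/= addnA leq_addl.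
have phiS n : (phi n <= phi n.+1)%N by rewrite {2}/phi big_ord_recr/= leq_add// leq_addr.
pose g j := f (phi j).
have g2 j : g j \in L2 by exact: f2.
have gC : \forall x \ae mu, cvgn (fun j => g j x).
  apply: L2_fast_cauchy => // j; apply/ltW/KP => //.
  exact: leq_trans (phiK j) (phiS j).
(* The upper limit is measurable without any convergence, and equals the limit wherever there is
   one. *)
pose l x := fine (limn_esup (fun j => (g j x)%:E)).
have ml : measurable_fun setT l.
  apply: measurableT_comp => //; apply: measurable_fun_limn_esup => j.
  by apply/measurable_EFinP; exact: L2_measurable.
have gl : \forall x \ae mu, (fun j => g j x) @ \oo --> l x.
  apply: filterS gC => x gx.
  suff -> : l x = limn (fun j => g j x) by [].
  have : (fun j => (g j x)%:E) @ \oo --> (limn (fun j => g j x))%:E.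
    by apply/cvg_EFin => //; exact: nearW.
  by rewrite /l => /cvg_limn_einf_sup[_ ->].
(* Fatou along the subsequence carries a bound on the distances from [f i] to [g j] over to the
   distance from [f i] to [l]. *)
have key i c : 0 <= c -> (\forall j \near \oo, nrm2 (f i - g j) <= c) ->
    (\int[mu]_x ((f i x - l x) ^+ 2)%:E <= (c ^+ 2)%:E)%E.
  move=> c0 Hc.
  have mfg j : measurable_fun setT (fun x => ((f i x - g j x) ^+ 2)%:E).
    by apply/measurable_EFinP/measurable_funX; apply: L2_measurable (L2B (f2 i) (g2 j)).
  apply: le_trans (_ : \int[mu]_x limn_einf (fun j => ((f i x - g j x) ^+ 2)%:E) <= _)%E; last first.
    apply: le_trans (fatou mu measurableT mfg _) _.
      by move=> j x _; rewrite lee_fin sqr_ge0.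
    apply: limn_einf_le; apply: filterS Hc => j Hc.
    rewrite -(nrm2_sqrE (L2B (f2 i) (g2 j))) lee_fin lerXn2r ?nnegrE//.
    exact: nrm2_ge0.
  apply: ae_ge0_le_integral => //.
  - by move=> x _; rewrite lee_fin sqr_ge0.
  - apply/measurable_EFinP/measurable_funX/measurable_funB => //.
    exact: L2_measurable (f2 i).
  - move=> x _; rewrite limn_einf_lim; apply: lime_ge; first exact: is_cvg_einfs.
    apply: nearW => n; apply: le_ereal_inf_tmp => _ [m _ <-].
    by rewrite lee_fin sqr_ge0.
  - rewrite (_ : (fun x => _) = fun x => (- limn_esup (fun j => - ((f i x - g j x) ^+ 2)%:E))%E)//.
    apply: measurableT_comp => //; apply: measurable_fun_limn_esup => j.
    exact: measurableT_comp.
  - apply: filterS gl => x gx _.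
    suff : (fun j => ((f i x - g j x) ^+ 2)%:E) @ \oo --> ((f i x - l x) ^+ 2)%:E.
      by move=> /cvg_limn_einf_sup[-> _].
    apply/cvg_EFin; first exact: nearW.
    rewrite (_ : _ \o _ = fun j => (f i x - g j x) ^+ 2)//.
    rewrite expr2; under eq_fun do rewrite expr2.
    by apply: cvgM; (apply: cvgB => //; exact: cvg_cst).
have lim e : 0 < e -> exists K, forall k, (K <= k)%N -> f k - l \in L2 /\ nrm2 (f k - l) < e.
  move=> e0; have [|K' K'P] := fC (e / 2); first by lra.
  exists K' => k Kk.
  have : (\int[mu]_x ((f k x - l x) ^+ 2)%:E <= ((e / 2) ^+ 2)%:E)%E.
    apply: key; first by lra.
    exists K' => // j /= K'j; apply/ltW/K'P => //.
    by rewrite (leq_trans K'j)// leq_addr.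
  move=> le.
  have fkl : f k - l \in L2.
    apply/L2P; split; last exact: le_lt_trans le (ltry _).
    by apply: measurable_funB => //; exact: L2_measurable.
  split => //; apply: (@le_lt_trans _ _ (e / 2)); last by lra.
  rewrite -(@ler_pXn2r _ 2) ?nnegrE ?nrm2_ge0//; last by lra.
  by rewrite -lee_fin nrm2_sqrE.
have [K' K'P] := lim 1 ltr01.
exists l.
  have -> : l = f K' - (f K' - l) by rewrite opprB addrC subrK.
  by apply: L2B => //; apply: (K'P _ (leqnn _)).1.
by move=> e /lim[K2 K2P]; exists K2 => k /K2P[].
Qed.
End riesz_fischer.

(** * Lebesgue measure on R^n *)

Section rV_measurable.
Context {R : realType} {n : nat}.
Local Notation V := 'rV[R]_n.

Lemma ball_rVP (x y : V) (e : R) : 0 < e ->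
  ball x e y <-> forall i, `|x ord0 i - y ord0 i| < e.
Proof.
move=> e0; split=> [[_ h] i|h]; first exact: h.
by split => // i j; rewrite (ord1 i); exact: h.
Qed.

Lemma measurable_forall_coord (P : 'I_n -> R -> Prop) :
  (forall i, measurable [set t | P i t]) ->
  measurable [set v : V | forall i, P i (v ord0 i)].
Proof.
move=> mP.
rewrite (_ : [set _ | _] = \bigcap_(i in [set` index_enum 'I_n])
    ((fun v : 'rV[R]_n => v ord0 i) @^-1` [set t | P i t])).
  rewrite bigcap_seq; apply: bigsetI_measurable => i _.
  by rewrite -[X in measurable X]setTI; exact: measurable_fun_coord.
apply/seteqP; split => v /= h i; first by move=> _; exact: h.
by apply: h; exact: mem_index_enum.
Qed.

Lemma measurable_ball_rV (x : V) (e : R) : 0 < e -> measurable (ball x e).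
Proof.
move=> e0.
rewrite (_ : ball x e = [set v : V | forall i, `|x ord0 i - v ord0 i| < e]).
  apply: (measurable_forall_coord (P := fun i t => `|x ord0 i - t| < e)) => i.
  rewrite (_ : [set t | _] = `]x ord0 i - e, x ord0 i + e[%classic); first exact: measurable_itv.
  by apply/seteqP; split => t /=; rewrite in_itv/= ltr_distlC.
by apply/seteqP; split => v /ball_rVP; exact.
Qed.

(** The sigma-algebra is generated by the coordinates. Sup-norm balls are products of intervals,
    hence measurable, and those with rational centre and radius 1/(k+1) contained in [U] form a
    countable cover of it. *)
Lemma open_measurable_rV (U : set V) : open U -> measurable U.
Proof.
move=> oU.
pose B (p : 'rV[rat]_n * nat) : set V := ball (map_mx (@ratr R) p.1) (p.2.+1%:R^-1).
pose F p : set V := if `[< B p `<=` U >] then B p else set0.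
rewrite (_ : U = \bigcup_p F p); last first.
  apply/seteqP; split=> [x Ux|x [p _]]; last first.
    by rewrite /F; case: ifPn => // /asboolP + Bx; apply.
  have /nbhs_ballP[e /= e0 eU] := open_nbhs_nbhs (conj oU Ux).
  pose k := Num.Def.truncn (e^-1 * 2).
  have ke : k.+1%:R^-1 < e / 2.
    rewrite -[e / 2]invrK ltf_pV2// ?posrE ?invr_gt0 ?divr_gt0// invfM invrK.
    exact: truncnS_gt.
  have k0 : (0 : R) < k.+1%:R^-1 by rewrite invr_gt0.
  have /choice[q qP] : forall i, exists q : rat, `|x ord0 i - ratr q| < k.+1%:R^-1 :> R.
    move=> i; have [|q] := @rat_in_itvoo R (x ord0 i - k.+1%:R^-1) (x ord0 i + k.+1%:R^-1).
      by rewrite ltrD2l gtrN.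
    by rewrite in_itv/= => h; exists q; rewrite ltr_distlC.
  exists (\row_i q i, k) => //; rewrite /F.
  have Bx : B (\row_i q i, k) x.
    by apply/ball_rVP => // i; rewrite !mxE distrC.
  case: ifPn => // /asboolPn; case => y /ball_rVP-/(_ k0) h; apply: eU.
  apply/ball_rVP => // i; rewrite -(subrKA (ratr (q i))).
  apply: le_lt_trans (ler_normD _ _) _.
  rewrite [e]splitr ltrD//; first exact: lt_trans (qP i) ke.
  by apply: lt_trans ke; have := h i; rewrite !mxE.
apply: countable_bigcupT_measurable => [|p]; first exact: countableP.
rewrite /F; case: ifPn => // _.
by apply: measurable_ball_rV; rewrite invr_gt0.
Qed.

Lemma continuous_measurable_rV (f : V -> R) : continuous f -> measurable_fun setT f.
Proof.
move=> cf.
apply: (measurability _ (RGenOpens.measurableE R)).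
move=> _ [_ [a [b ->] <-]]; rewrite setTI.
by apply: open_measurable_rV; move/continuousP : cf; apply; exact: interval_open.
Qed.

End rV_measurable.

(** * Vanishing integrals of partial derivatives *)

Section integral_partial.
Context {R : realType}.
Local Notation mu1 := (@lebesgue_measure R).

Lemma integral_derivative0 (f g : R -> R) (A : R) : 0 <= A ->
  (forall t, A < `|t| -> f t = 0 /\ g t = 0) ->
  (forall t : R, is_derive t (1 : R) f (g t)) -> continuous g ->
  (\int[mu1]_t (g t)%:E = 0)%E.
Proof.
move=> A0 fg0 df cg.
(* The margin 1 puts both endpoints where [f] vanishes. *)
transitivity (\int[mu1]_(t in `[(- A - 1)%R, (A + 1)%R]) (g t)%:E)%E.
  rewrite [RHS]integral_mkcond; apply: eq_integral => t _.
  rewrite patchE; case: ifPn => // tA.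
  suff /fg0[_ ->] : A < `|t| by [].
  rewrite ltNge; apply: contra tA; rewrite ler_norml inE/= in_itv/=; lra.
rewrite (@continuous_FTC2 R g f).
- have h1 : A < `|A + 1| by rewrite ger0_norm; lra.
  have h2 : A < `|- A - 1| by rewrite ler0_norm; lra.
  have [-> _] := fg0 _ h1; have [-> _] := fg0 _ h2.
  by rewrite subee.
- by lra.
- exact/continuous_subspaceT.
- have cf t : {for t, continuous f}.
    by apply/differentiable_continuous/derivable1_diffP; have [] := df t.
  split.
  + by move=> t _; have [] := df t.
  + exact/cvg_at_right_filter/cf.
  + exact/cvg_at_left_filter/cf.
- by move=> t _; rewrite derive1E; have [] := df t.
Qed.

Definition cube n (A : R) : set 'rV[R]_n := [set v | forall j, `|v ord0 j| <= A].
Arguments cube : clear implicits.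

Lemma measurable_cube n A : measurable (cube n A).
Proof.
apply: (measurable_forall_coord (P := fun _ t => `|t| <= A)) => _.
rewrite (_ : [set t | _] = `[- A, A]%classic); first exact: measurable_itv.
by apply/seteqP; split => t /=; rewrite in_itv/= ler_norml.
Qed.

Lemma cube_lty n A : (leb n (cube n A) < +oo)%E.
Proof.
(* Boxes of known measure are open on the left, so the lower corner is moved down by 1; the absolute
   value keeps the corners ordered for negative [A]. *)
pose a : 'rV[R]_n := const_mx (- `|A| - 1); pose b : 'rV[R]_n := const_mx `|A|.
pose box := [set v : 'rV[R]_n | forall i, v ord0 i \in `]a ord0 i, b ord0 i]].
have mbox : measurable box.
  apply: (measurable_forall_coord (P := fun i t => t \in `]a ord0 i, b ord0 i])) => i.
  exact: measurable_itv.
apply: (@le_lt_trans _ _ (leb n box)).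
  apply: le_measure; rewrite ?inE//; first exact: measurable_cube.
  move=> v /= vA i; have := vA i; rewrite !mxE in_itv/= ler_norml => /andP[h1 h2].
  have := ler_norm A => h3.
  by apply/andP; split; lra.
rewrite leb_box ?ltry// => i; rewrite !mxE.
by have := normr_ge0 A; lra.
Qed.

Lemma integrable_cube n (g : 'rV[R]_n -> R) (A B : R) :
  measurable_fun setT g -> (forall v, `|g v| <= B) ->
  (forall v, ~ cube n A v -> g v = 0) ->
  (leb n).-integrable setT (EFin \o g).
Proof.
move=> mg gB g0; have B0 : 0 <= B by exact: le_trans (normr_ge0 _) (gB 0).
apply/integrableP; split; first exact/measurable_EFinP.
have -> : (\int[leb n]_x `|(EFin \o g) x| = \int[leb n]_(x in cube n A) `|(EFin \o g) x|)%E.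
  rewrite [RHS]integral_mkcond; apply: eq_integral => v _.
  rewrite patchE; case: ifPn => // vA.
  by rewrite /= g0 ?normr0// => h; move/negP: vA; apply; rewrite inE.
apply: (@le_lt_trans _ _ (\int[leb n]_(x in cube n A) B%:E)%E).
  apply: ge0_le_integral => //; first exact: measurable_cube.
  - apply/measurable_EFinP; apply: measurableT_comp => //.
    exact: measurable_funTS.
  - by move=> v _; rewrite lee_fin.
rewrite integral_cst; last exact: measurable_cube.
by rewrite lte_mul_pinfty// ?lee_fin// cube_lty.
Qed.

Lemma rV_consD0 n (x : R) (v : 'rV[R]_n) :
  rV_cons (x, v) = rV_cons (0, v) + x *: delta_mx ord0 ord0.
Proof.
apply/rowP => j; rewrite [RHS]mxE [X in _ = _ + X]mxE [X in _ = _ + _ * X]mxE.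
case: (unliftP ord0 j) => [i ->|->].
  by rewrite !rV_consS/= mulr0 addr0.
by rewrite !rV_cons0/= mulr1 add0r.
Qed.

Lemma rV_consDS n (x t : R) (v : 'rV[R]_n) j :
  rV_cons (x, v + t *: delta_mx ord0 j) = rV_cons (x, v) + t *: delta_mx ord0 (lift ord0 j).
Proof.
apply/rowP => k; rewrite [RHS]mxE [X in _ = _ + X]mxE [X in _ = _ + _ * X]mxE.
case: (unliftP ord0 k) => [i ->|->].
  by rewrite !rV_consS/= !mxE (inj_eq lift_inj).
by rewrite !rV_cons0/= mulr0 addr0.
Qed.

(** Fubini on the head coordinate and the tail: if [i] is the head, the inner integral vanishes by
    the fundamental theorem of calculus; otherwise by induction on slices. The hypotheses are stated
    along lines in direction [i] so that they restrict to slices. *)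
Lemma integral_partial0 n (i : 'I_n) (f g : 'rV[R]_n -> R) (A B : R) : 0 <= A ->
  measurable_fun setT g -> (forall v, `|g v| <= B) ->
  (forall v, ~ cube n A v -> f v = 0 /\ g v = 0) ->
  (forall v (t : R), is_derive t (1 : R) (fun t => f (v + t *: delta_mx ord0 i))
     (g (v + t *: delta_mx ord0 i))) ->
  (forall v, continuous (fun t : R => g (v + t *: delta_mx ord0 i))) ->
  (\int[leb n]_v (g v)%:E = 0)%E.
Proof.
elim: n i f g => [[]//|n IH] i f g A0 mg gB fg0 df cg.
pose h (p : measurableTypeR R * 'rV[R]_n) := g (rV_cons p).
have mh : measurable_fun setT h by apply: measurableT_comp => //; exact: measurable_rV_cons.
have ig : (leb n.+1).-integrable setT (EFin \o g).
  by apply: (integrable_cube mg gB) => v /fg0[].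
have ih : (mu1 \x leb n)%E.-integrable setT (EFin \o h).
  apply/integrableP; split; first exact/measurable_EFinP.
  case/integrableP : ig => _; rewrite [X in (X < _)%E -> _]ge0_integral_pushforward//.
  - exact: measurable_rV_cons.
  - by apply/measurable_EFinP; exact: measurableT_comp.
have -> : (\int[leb n.+1]_v (g v)%:E = \int[mu1 \x leb n]_p (h p)%:E)%E.
  rewrite [LHS]integral_pushforward//; first exact: measurable_rV_cons.
  exact/measurable_EFinP.
case: (unliftP ord0 i) => [j ij|i0].
- rewrite -(integral12_prod_meas1 ih) integral0_eq// => x _.
  apply: (IH j (fun v => f (rV_cons (x, v))) (fun v => g (rV_cons (x, v)))) => //.
  + exact: (measurableT_comp mh (measurable_pair1 x)).
  + move=> v vA; apply: fg0 => h'; apply: vA => k.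
    by have := h' (lift ord0 k); rewrite rV_consS.
  + move=> v t; rewrite rV_consDS -ij.
    have := df (rV_cons (x, v)) t.
    by under [X in is_derive _ _ X _ -> _]eq_fun do rewrite {1}ij -rV_consDS.
  + move=> v; have := cg (rV_cons (x, v)).
    rewrite (_ : (fun t : R => g (rV_cons (x, v + t *: delta_mx ord0 j))) =
       fun t : R => g (rV_cons (x, v) + t *: delta_mx ord0 i))//.
    by apply/funext => t; rewrite rV_consDS -ij.
- rewrite -(integral21_prod_meas1 ih) integral0_eq// => v _.
  apply: (integral_derivative0 (f := fun x => f (rV_cons (x, v)))
    (g := fun x : R => g (rV_cons (x, v))) A0).
  + move=> t tA; apply: fg0 => /(_ ord0); rewrite rV_cons0/=.
    by rewrite leNgt tA.
  + move=> t; rewrite [X in g X]rV_consD0 -i0.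
    have := df (rV_cons (0, v)) t.
    by under [X in is_derive _ _ X _ -> _]eq_fun do rewrite {1}i0 -rV_consD0.
  + have := cg (rV_cons (0, v)).
    rewrite (_ : (fun x : R => g (rV_cons (x, v))) =
       fun t : R => g (rV_cons (0, v) + t *: delta_mx ord0 i))//.
    by apply/funext => t; rewrite rV_consD0 -i0.
Qed.
End integral_partial.
Arguments cube {R} n A.

(** * Test functions and the fundamental lemma of the calculus of variations *)

(** The two difference quotients are the same function of the increment. One-variable rules, the
    chain rule above all, thereby apply to directional derivatives. *)
Lemma is_derive_line (R : realType) (V : normedModType R) (f : V -> R) (x v : V) (t l : R) :
  is_derive t (1 : R) (fun h : R => f (h *: v + x)) l <-> is_derive (t *: v + x) v f l.
Proof.
have E : (fun h : R => h^-1 *: (((fun h : R => f (h *: v + x)) \o shift t) (h *: (1 : R)) - f (t *: v + x))) =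
    (fun h : R => h^-1 *: ((f \o shift (t *: v + x)) (h *: v) - f (t *: v + x))).
  apply/funext => h /=; congr (_ *: (f _ - _)).
  by rewrite [_%:A]mulr1 scalerDl addrA.
have Ed := congr1 (fun g : R -> R => cvg (g @ 0^')) E.
have Ev := congr1 (fun g : R -> R => lim (g @ 0^')) E.
split=> -[d1 d2]; apply: DeriveDef.
- by rewrite /derivable -Ed.
- by rewrite /derive -Ev.
- by rewrite /derivable Ed.
- by rewrite /derive Ev.
Qed.

(** * Smooth functions with compact support *)

Section flat.
Context {R : realType}.

(* This family is closed under differentiation, up to linear combinations. *)
Definition flat (k : nat) (x : R) : R := if 0 < x then x^-1 ^+ k * expR (- x^-1) else 0.

Lemma flat_ge0 k x : 0 <= flat k x.
Proof.
by rewrite /flat; case: ifPn => // x0; rewrite mulr_ge0 ?expR_ge0 ?exprn_ge0 ?invr_ge0 ?ltW.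
Qed.

(** From e^y >= y^(k+1) / (k+1)! at y = 1/x. *)
Lemma flat_le k x : flat k x <= k.+1`!%:R * `|x|.
Proof.
rewrite /flat; case: ifPn => [x0|_]; last by rewrite mulr_ge0.
rewrite gtr0_norm// -ler_pdivrMr// -mulrA [expR _ * _]mulrC mulrA -exprSr expRN.
rewrite ler_pdivrMr ?expR_gt0//.
have := @expR_ge1Dxn R x^-1 k; rewrite invr_ge0 => /(_ (ltW x0)) h.
rewrite mulrC -ler_pdivrMr ?ltr0n ?fact_gt0//.
by apply: le_trans h; rewrite lerDr.
Qed.

Lemma flat_le1 x : flat 0 x <= 1.
Proof.
rewrite /flat; case: ifPn => // x0.
by rewrite expr0 mul1r expR_le1 oppr_le0 invr_ge0 ltW.
Qed.

Lemma flatMr k x : flat k x = x * flat k.+1 x.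
Proof.
rewrite /flat; case: ifPn => [x0|_]; last by rewrite mulr0.
by rewrite exprS !mulrA mulfV ?mul1r// gt_eqF.
Qed.

Lemma is_derive_flat k (x : R) :
  is_derive x (1 : R) (flat k) (- k%:R * flat k.+1 x + flat k.+2 x).
Proof.
have [x0|x0|->] := ltgtP x 0.
- apply: (near_eq_is_derive (f := cst 0)).
    near=> y; rewrite /flat ltNge ltW//.
    by near: y; exact: lt_nbhsl.
  have -> : - k%:R * flat k.+1 x + flat k.+2 x = 0.
    by rewrite /flat ltNge ltW//= mulr0 addr0.
  exact: is_derive_cst.
- have : is_derive x (1 : R) (fun y : R => y^-1 ^+ k * expR (- y^-1))
    (- k%:R * flat k.+1 x + flat k.+2 x); last first.
    apply: near_eq_is_derive.
    near=> y; rewrite /flat ifT//.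
    by near: y; exact: lt_nbhsr.
  have xn0 : x != 0 by rewrite gt_eqF.
  have dV : is_derive x (1 : R) (fun y : R => y^-1) (- x^-1 ^+ 2).
    rewrite exprVn; apply: DeriveDef; first exact: (@derivableV _ _ (fun y : R => y)).
    rewrite (@deriveV _ _ (fun y : R => y))// derive_id.
    by rewrite /GRing.scale/= mulr1.
  have dX : is_derive x (1 : R) (fun y : R => y^-1 ^+ k) (- k%:R * x^-1 ^+ k.+1).
    have -> : (fun y : R => y^-1 ^+ k) = (fun y : R => y^-1) ^+ k.
      by apply/funext => y; rewrite exprfctE.
    apply: is_derive_eq.
    rewrite /GRing.scale/=; case: (k) => [|j]; first by rewrite mulr0n !mul0r oppr0 mul0r.
    by rewrite /= -mulr_natl !mulrN mulNr -!mulrA -exprD addn2.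
  have dN : is_derive x (1 : R) (fun y : R => - y^-1) (x^-1 ^+ 2).
    by apply: is_derive_eq; rewrite opprK.
  have dE := is_derive1_comp (f := expR) (g := fun y : R => - y^-1) (is_derive_expR _) dN.
  apply: is_derive_eq.
  rewrite /flat x0 /GRing.scale/= !exprS; ring.
- have -> : - k%:R * flat k.+1 0 + flat k.+2 0 = 0 :> R.
    by rewrite /flat ltxx mulr0 addr0.
  have : (fun h : R => h^-1 *: ((flat k \o shift 0) (h *: (1 : R)) - flat k 0)) @ 0^' --> (0 : R).
    rewrite (_ : (fun h => _) = (fun h : R => h^-1 * flat k h)); last first.
      by apply/funext => h; rewrite /= addr0 /GRing.scale/= mulr1 {2}/flat ltxx subr0.
    apply/cvgr0Pnorm_lt => e e0.
    near=> h.
    have h0 : h != 0 by near: h; exact: nbhs_dnbhs_neq.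
    (* The quotient [flat k h / h] is [flat k.+1 h], which is at most a multiple of [|h|]. *)
    rewrite flatMr mulKf// ger0_norm ?flat_ge0//.
    apply: le_lt_trans (flat_le _ _) _.
    rewrite mulrC -ltr_pdivlMr ?ltr0n ?fact_gt0//.
    near: h; apply: dnbhs0_lt; rewrite divr_gt0// ltr0n fact_gt0.
  move=> h; apply: DeriveDef; first by apply/cvg_ex; exists 0.
  exact: cvg_lim h.
Unshelve. all: by end_near. Qed.

Lemma continuous_flat k : continuous (flat k).
Proof.
move=> x; apply/differentiable_continuous/derivable1_diffP.
by have [] := is_derive_flat k x.
Qed.

End flat.

Section flat_generated.
Context {R : realType} {n : nat}.
Local Notation V := 'rV[R]_n.

(** A class of expressions stable under partial derivatives: continuity and one derivative for each
    constructor then give smoothness of every order. *)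
Inductive flat_generated : (V -> R) -> Prop :=
| flat_generated_cst c : flat_generated (fun=> c)
| flat_generated_coord i : flat_generated (fun v => v ord0 i)
| flat_generatedD f g : flat_generated f -> flat_generated g ->
    flat_generated (fun v => f v + g v)
| flat_generatedM f g : flat_generated f -> flat_generated g ->
    flat_generated (fun v => f v * g v)
| flat_generated_flat k f : flat_generated f -> flat_generated (fun v => flat k (f v)).

Lemma flat_generated_continuous f : flat_generated f -> continuous f.
Proof.
elim=> {f} [c|i|f g _ cf _ cg|f g _ cf _ cg|k f _ cf] v.
- exact: cst_continuous.
- exact: coord_continuous.
- by apply: continuousD; [exact: cf|exact: cg].
- by apply: continuousM; [exact: cf|exact: cg].
- by apply: continuous_comp; [exact: cf|exact: continuous_flat].
Qed.

Lemma flat_generated_partial f i : flat_generated f -> exists2 g, flat_generated g &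
  forall v, is_derive v (delta_mx ord0 i) f (g v).
Proof.
elim=> {f} [c|j|f g _ [f' Ff' df] _ [g' Fg' dg]
  |f g Ff [f' Ff' df] Fg [g' Fg' dg]|k f Ff [f' Ff' df]].
- by exists (fun=> 0); [exact: flat_generated_cst|move=> v; exact: is_derive_cst].
- exists (fun=> (j == i)%:R); first exact: flat_generated_cst.
  move=> v; rewrite -[v]add0r -[0](scale0r (delta_mx ord0 i)).
  apply/is_derive_line.
  rewrite (_ : (fun h => _) = (fun h : R => (j == i)%:R * h + v ord0 j)); last first.
    by apply/funext => h; rewrite !mxE eqxx/= mulrC.
  by apply: is_derive_eq; rewrite /GRing.scale/= mulr1 addr0.
- exists (fun v => f' v + g' v); first exact: flat_generatedD.
  by move=> v; exact: is_deriveD.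
- exists (fun v => f v * g' v + g v * f' v).
    by apply: flat_generatedD; exact: flat_generatedM.
  by move=> v; exact: is_deriveM.
- exists (fun v => (- k%:R * flat k.+1 (f v) + flat k.+2 (f v)) * f' v).
    apply: flat_generatedM => //; apply: flat_generatedD; last exact: flat_generated_flat.
    by apply: flat_generatedM; [exact: flat_generated_cst|exact: flat_generated_flat].
  move=> v; have := df v; rewrite -[v]add0r -[0](scale0r (delta_mx ord0 i)).
  move=> /is_derive_line h; apply/is_derive_line.
  apply: (is_derive_eq (is_derive1_comp (f := flat k) (is_derive_flat k _) h)).
  by rewrite /GRing.scale/= mulrC.
Qed.

Lemma flat_generated_smooth f : flat_generated f -> smooth f.
Proof.
move=> Ff k s _.
have Fs : flat_generated (partials s f).
  elim: s => [//|i s IH] /=.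
  have [g Fg dg] := flat_generated_partial i IH.
  suff -> : 'D_(delta_mx ord0 i) (partials s f) = g by [].
  by apply/funext => v; have [] := dg v.
split; first exact: flat_generated_continuous.
move=> _ i v; have [g _ dg] := flat_generated_partial i Fs.
by have [] := dg v.
Qed.

Lemma flat_generated_prod (F : 'I_n -> V -> R) : (forall i, flat_generated (F i)) ->
  flat_generated (fun v => \prod_i F i v).
Proof.
move=> FF; elim: (index_enum _) => [|i s IH].
  by under eq_fun do rewrite big_nil; exact: flat_generated_cst.
by under eq_fun do rewrite big_cons; exact: flat_generatedM.
Qed.

End flat_generated.

Lemma restrict_cst0_mul (T : Type) (R : realType) (D : set T) (f g : T -> R) :
  ((f \* g) \_ D) = (f \_ D) \* g.
Proof.
by apply/funext => x; rewrite /= !patchE; case: ifP => //; rewrite mul0r.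
Qed.

Section boxes.
Context {R : realType} {n : nat}.
Local Notation V := 'rV[R]_n.
Implicit Types a b : 'I_n -> R.

Definition open_box a b : set V := [set v | forall i, a i < v ord0 i < b i].
Definition closed_box a b : set V := [set v | forall i, a i <= v ord0 i <= b i].

Lemma measurable_open_box a b : measurable (open_box a b).
Proof.
apply: (measurable_forall_coord (P := fun i t => a i < t < b i)) => i.
rewrite (_ : [set t | _] = `]a i, b i[%classic); first exact: measurable_itv.
by apply/seteqP; split => t /=; rewrite in_itv/=.
Qed.

Lemma compact_closed_box a b : compact (closed_box a b).
Proof.
rewrite (_ : closed_box a b = [set v : V | forall i, `[a i, b i]%classic (v ord0 i)]).
  apply: (@rV_compact _ n (fun i => `[a i, b i]%classic)) => i.
  exact: segment_compact.
by apply/seteqP; split => v /= h i; have := h i; rewrite in_itv.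
Qed.

Lemma open_box_sub_cube a b : exists A, open_box a b `<=` cube n A.
Proof.
exists (\sum_i (`|a i| + `|b i|)) => v h i; have /andP[h1 h2] := h i.
apply: le_trans (_ : `|a i| + `|b i| <= _).
  have := ler_norm (b i); have := ler_norm (- a i); rewrite normrN => h3 h4.
  have := normr_ge0 (b i); have := normr_ge0 (a i) => h5 h6.
  by rewrite ler_norml; apply/andP; split; lra.
by rewrite (bigD1 i)//= lerDl sumr_ge0// => j _; rewrite addr_ge0.
Qed.

(** Inside the box each factor is exp(-1/((m+1)(v_i - a_i)(b_i - v_i))). The values lie between 0
    and 1 and increase [m] towards the indicator of the open box. *)
Definition bump a b (m : nat) (v : V) : R :=
  \prod_i flat 0 (m.+1%:R * ((v ord0 i - a i) * (b i - v ord0 i))).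

Lemma bump_generated a b m : flat_generated (bump a b m).
Proof.
apply: flat_generated_prod => i; apply: flat_generated_flat.
apply: flat_generatedM; first exact: flat_generated_cst.
have F c : flat_generated (fun v : V => v ord0 i - c).
  by apply: flat_generatedD; [exact: flat_generated_coord|exact: flat_generated_cst].
apply: flat_generatedM => //.
rewrite (_ : (fun v : V => _) = fun v => -1 * (v ord0 i - b i)); last first.
  by apply/funext => v; rewrite mulN1r opprB.
by apply: flat_generatedM; [exact: flat_generated_cst|exact: F].
Qed.

(** Outside the interval the two factors have a nonpositive product. With [b i < a i] both could be
    negative, whence the ordering hypothesis. *)
Lemma bump_out a b m v : (forall i, a i <= b i) -> ~ open_box a b v -> bump a b m v = 0.
Proof.
move=> ab nv; have [i] : exists i, ~ (a i < v ord0 i < b i).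
  by apply/existsNP => h; apply: nv.
move=> /negP; rewrite negb_and -!leNgt => h.
rewrite /bump (bigD1 i)//= /flat ifF ?mul0r//.
apply/negbTE; rewrite -leNgt pmulr_rle0 ?ltr0Sn//.
have := ab i; case/orP: h => h1 h2; nra.
Qed.


Lemma bump_ge0_le1 a b m v : 0 <= bump a b m v <= 1.
Proof.
rewrite /bump; apply/andP; split; first by apply: prodr_ge0 => i _; exact: flat_ge0.
by rewrite prodr_ile1// => i _; rewrite flat_ge0 flat_le1.
Qed.

Lemma bump_cvg a b v : open_box a b v -> bump a b m v @[m --> \oo] --> (1 : R).
Proof.
move=> vab; rewrite /bump.
have E : \prod_(i < n) (1 : R) = 1 by rewrite big1.
rewrite -[X in _ --> X]E.
have : forall i,
    flat 0 (m.+1%:R * ((v ord0 i - a i) * (b i - v ord0 i))) @[m --> \oo] --> (1 : R); last first.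
  move=> h; elim: (index_enum _) => [|i s IH].
    by under eq_fun do rewrite big_nil; rewrite big_nil; exact: cvg_cst.
  by under eq_fun do rewrite big_cons; rewrite big_cons; apply: cvgM; [exact: h|exact: IH].
move=> i.
pose q := (v ord0 i - a i) * (b i - v ord0 i).
have q0 : 0 < q by have /andP[h1 h2] := vab i; rewrite mulr_gt0// subr_gt0.
rewrite (_ : (fun m => _) = fun m : nat => expR (- (m.+1%:R^-1 * q^-1))); last first.
  by apply/funext => m; rewrite -/q /flat mulr_gt0 ?ltr0Sn// expr0 mul1r invfM.
rewrite -[X in _ --> X]expR0.
apply: continuous_cvg; first exact: continuous_expR.
rewrite -[X in _ --> X]oppr0; apply: cvgN.
rewrite -[X in _ --> X](mul0r q^-1); apply: cvgMl; exact: cvg_harmonic.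
Qed.

Lemma bump_test Omega a b m : (forall i, a i <= b i) -> closed_box a b `<=` Omega ->
  test_function Omega (bump a b m).
Proof.
move=> ab abO; split; first exact/flat_generated_smooth/bump_generated.
exists (closed_box a b); split => //; first exact: compact_closed_box.
move=> v nv; apply: bump_out => // h; apply: nv => i.
by have /andP[h1 h2] := h i; rewrite !ltW.
Qed.

End boxes.

(** * The du Bois-Reymond lemma *)

Section du_bois_reymond.
Context {R : realType} {n : nat}.
Local Notation V := 'rV[R]_n.
Local Notation mu := (@leb R n).
Variables (Omega : set V) (g : V -> R).
Hypothesis oO : open Omega.
Hypothesis g2 : in_L2 Omega g.
Hypothesis gtest : forall phi, test_function Omega phi ->
  \int[mu]_(x in Omega) (g x * phi x) = 0.

Let G : V -> R := g \_ Omega.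

Let mG : measurable_fun setT G. Proof. exact: L2_measurable g2. Qed.

Let integrable_box a b : mu.-integrable (open_box a b) (EFin \o G).
Proof.
have mB := measurable_open_box a b.
have [A BA] := open_box_sub_cube a b.
have L1 : \1_(open_box a b) \in Lfun mu 2%:E.
  apply/L2P; split; first exact: measurable_indic.
  have : mu.-integrable setT (EFin \o (fun x => (\1_(open_box a b) x : R) ^+ 2)).
    apply: (@integrable_cube _ _ _ A 1).
    - by apply: measurable_funX; exact: measurable_indic.
    - by move=> v; rewrite indicE; case: (_ \in _); rewrite ?expr1n ?normr1// expr0n/= normr0.
    - move=> v nv; rewrite indicE memNset ?expr0n//.
      by move=> /BA.
  move=> /integrableP[_]; apply: le_lt_trans.
  by rewrite le_eqVlt; apply/orP; left; apply/eqP/eq_integral => x _; rewrite /= ger0_norm ?sqr_ge0.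
have := L2_mul_integrable g2 L1.
rewrite -/G; move=> h.
rewrite -[X in integrable _ X](setIidl (@subsetT _ _)) setIC.
rewrite integrable_mkcond; last by rewrite setTI.
rewrite (_ : _ \_ _ = EFin \o (G \* \1_(open_box a b)))//.
apply/funext => x; rewrite patchE /= indicE setTI.
by case: ifPn => xB; rewrite ?xB ?(negbTE xB) ?mulr1 ?mulr0.
Qed.

(** The bumps are admissible test functions and converge to the indicator of the open box, dominated
    by |G| on it. *)
Lemma integral_box0 a b : (forall i, a i <= b i) -> closed_box a b `<=` Omega ->
  (\int[mu]_(x in open_box a b) (G x)%:E = 0)%E.
Proof.
move=> ab abO; have mB := measurable_open_box a b.
rewrite integral_mkcond.
have iGB : mu.-integrable setT ((EFin \o G) \_ (open_box a b)).
  exact: (integrable_mkcond _ mB).1 (integrable_box a b).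
have := @dominated_convergence _ _ R mu setT measurableT
  (fun m x => (G x * bump a b m x)%:E) ((EFin \o G) \_ (open_box a b))
  (fun x => `|((EFin \o G) \_ (open_box a b)) x|)%E.
have mbump m : measurable_fun setT (bump a b m).
  by apply: continuous_measurable_rV; apply: flat_generated_continuous; exact: bump_generated.
have mGb m : measurable_fun setT (fun x => (G x * bump a b m x)%:E).
  by apply/measurable_EFinP; exact: measurable_funM.
have dom m x : (`|(G x * bump a b m x)%:E| <= `|((EFin \o G) \_ (open_box a b)) x|)%E.
  rewrite patchE; case: ifPn => xB; last first.
    rewrite bump_out ?mulr0//.
    by move=> h; move/negP : xB; apply; rewrite inE.
  rewrite /= lee_fin normrM ler_piMr//.
  by have /andP[h1 h2] := bump_ge0_le1 a b m x; rewrite ger0_norm.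
move=> /(_ mGb (measurable_int _ iGB)).
case.
- apply: nearW => x _; rewrite patchE; case: ifPn => xB.
    apply/cvg_EFin; first exact: nearW.
    rewrite -[X in _ --> X]mulr1.
    by apply: cvgMr; apply: bump_cvg; rewrite inE in xB.
  rewrite (_ : (fun m => _) = cst 0%E); first exact: cvg_cst.
  apply/funext => m; rewrite bump_out ?mulr0// => h.
  by move/negP : xB; apply; rewrite inE.
- exact: integrable_abse.
- by apply: nearW => x m _; exact: dom.
move=> _ _; rewrite (_ : (fun m => _) = cst 0%E).
  by move/cvg_lim => <- //; rewrite lim_cst.
apply/funext => m /=.
have iGb : mu.-integrable setT (fun x => (G x * bump a b m x)%:E).
  apply: le_integrable iGB => // x _; exact: dom.
have := gtest (bump_test m ab abO).
rewrite Rintegral_mkcond.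
rewrite (_ : _ \_ _ = fun x => G x * bump a b m x); last first.
  exact: (restrict_cst0_mul Omega g (bump a b m)).
rewrite /Rintegral => h; rewrite -[LHS]fineK ?h//.
exact: integrable_fin_num.
Qed.

(* Allowing [setT] as a side puts the preimages of intervals under a single coordinate
   in this pi-system, so that it generates the Borel sets. *)
Definition interval_product (A : set V) := exists2 U : 'I_n -> set R,
  forall i, U i = setT \/ exists x y, U i = `]x, y[%classic &
  A = [set v | forall i, U i (v ord0 i)].

Lemma interval_productI : setI_closed interval_product.
Proof.
move=> A A' [U HU ->] [U' HU' ->]; exists (fun i => U i `&` U' i).
  move=> i; have [->|[x [y ->]]] := HU i; have [->|[x' [y' ->]]] := HU' i.
  - by left; rewrite setTI.
  - by right; exists x', y'; rewrite setTI.
  - by right; exists x, y; rewrite setIT.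
  - right; exists (Num.max x x'), (Num.min y y').
    apply/seteqP; split => t /=; rewrite !in_itv/= gt_max lt_min.
      by move=> [/andP[-> ->] /andP[-> ->]].
    by move=> /andP[/andP[-> ->] /andP[-> ->]].
apply/seteqP; split => v /=; first by move=> [h h'] i; split.
by move=> h; split => i; have [] := h i.
Qed.

Lemma measurable_interval_product :
  @measurable _ V = <<s interval_product >>.
Proof.
apply/seteqP; split; last first.
  apply: smallest_sub; first exact: sigma_algebra_measurable.
  move=> _ [U HU ->]; apply: measurable_forall_coord => i.
  by have [->|[x [y ->]]] := HU i; [exact: measurableT|exact: measurable_itv].
apply: smallest_sub; first exact: smallest_sigma_algebra.
rewrite -bigcup_seq; apply: bigcup_sub => i _ _ [B mB <-]; rewrite setTI.
pose D := [set B : set R | <<s interval_product >> ((fun v : V => v ord0 i) @^-1` B)].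
suff : @measurable _ (measurableTypeR R) `<=` D by exact.
have [s0 sC sU] := smallest_sigma_algebra (setT : set V) interval_product.
rewrite [X in X `<=` _](RGenOpens.measurableE R); apply: smallest_sub.
  split.
  - by rewrite /D/= preimage_set0.
  - by move=> C DC; rewrite /D/= setTD preimage_setC -setTD; exact: sC.
  - by move=> F DF; rewrite /D/= preimage_bigcup; exact: sU.
move=> _ [x [y ->]]; apply: sub_sigma_algebra.
exists (fun j => if j == i then `]x, y[%classic else setT).
  by move=> j; case: ifP => _; [right; exists x, y|left].
apply/seteqP; split => v /=; last by move/(_ i); rewrite eqxx.
by move=> h j; case: eqP => // ->.
Qed.

(** An interval product meets the box in a smaller box, where the integral of [G] vanishes. Dynkin's
    theorem extends this to all measurable sets, and a function with zero integral on every
    measurable subset is zero almost everywhere. *)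
Lemma ae_box0 a b : (forall i, a i <= b i) -> closed_box a b `<=` Omega ->
  ae_eq mu (open_box a b) G (cst 0).
Proof.
move=> ab abO; have mQ := measurable_open_box a b; have iQ := integrable_box a b.
have key A : measurable A -> (\int[mu]_(x in A `&` open_box a b) (G x)%:E = 0)%E.
  rewrite measurable_interval_product; apply: (dynkin_induction
    (P := fun A => \int[mu]_(x in A `&` open_box a b) (G x)%:E = 0)%E).
  - exact: measurable_interval_product.
  - exact: interval_productI.
  - by rewrite setTI; exact: integral_box0.
  - move=> _ [U HU ->].
    have /choice[c cP] : forall i, exists c : R * R, [/\ a i <= c.1, c.2 <= b i &
        U i `&` `]a i, b i[%classic = `]c.1, c.2[%classic].
      move=> i; have [->|[x [y ->]]] := HU i.
        by exists (a i, b i); rewrite setTI.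
      exists (Num.max (a i) x, Num.min (b i) y); split => /=.
      + by rewrite le_max lexx.
      + by rewrite ge_min lexx.
      + apply/seteqP; split => t /=; rewrite !in_itv/= gt_max lt_min.
          by move=> [/andP[-> ->] /andP[-> ->]].
        by move=> /andP[/andP[-> ->] /andP[-> ->]].
    have -> : [set v : V | forall i, U i (v ord0 i)] `&` open_box a b =
        open_box (fun i => (c i).1) (fun i => (c i).2).
      apply/seteqP; split => v /=.
        move=> [h1 h2] i; have [_ _ E] := cP i.
        have : (U i `&` `]a i, b i[%classic) (v ord0 i).
          by split; [exact: h1|rewrite /= in_itv/=; exact: h2].
        by rewrite E /= in_itv.
      move=> h; suff H i : (U i `&` `]a i, b i[%classic) (v ord0 i).
        by split => i; have [h1] := H i; rewrite /= ?in_itv.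
      by have [_ _ ->] := cP i; rewrite /= in_itv/=; exact: h.
    (* If some side is reversed, the intersection is empty. *)
    have [cc|] := pselect (forall i, (c i).1 <= (c i).2).
      apply: integral_box0 => // v h; apply: abO => i.
      have /andP[h1 h2] := h i; have [h3 h4 _] := cP i.
      by rewrite (le_trans h3)//= (le_trans h2).
    move=> /existsNP[i /negP]; rewrite -ltNge => ci.
    rewrite (_ : open_box _ _ = set0) ?integral_set0//.
    apply/seteqP; split => // v /(_ i) /andP[h1 h2].
    by have := lt_trans (lt_trans h1 h2) ci; rewrite ltxx.
  - move=> C mC C0.
    have : (\int[mu]_(x in open_box a b) (G x)%:E = 0)%E by exact: integral_box0.
    rewrite -{1}(setTI (open_box a b)) -(setUv C) setIUl integral_setU//.
    + by rewrite C0 add0e.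
    + exact: measurableI.
    + by apply: measurableI => //; exact: measurableC.
    + exact/measurable_funTS/measurable_EFinP.
    + by apply/disj_setPS => x [[h _] [h' _]].
  - move=> F mF tF F0.
    rewrite setI_bigcupl integral_bigcup//.
    + by rewrite eseries0// => i _ _; exact: F0.
    + exact: trivIset_setIr.
    + by move=> k; exact: measurableI.
    + apply: integrableS iQ => //; last by apply: bigcup_sub => k _; exact: subIsetr.
      by apply: bigcupT_measurable => k; exact: measurableI.
have := @integral_ae_eq _ _ R mu _ mQ (cst 0%E) (EFin \o G) iQ (measurable_cst _).
have h E : E `<=` open_box a b -> measurable E ->
    (\int[mu]_(x in E) (EFin \o G) x = \int[mu]_(x in E) cst 0 x)%E.
  by move=> EQ mE; rewrite integral0 -(key E mE) (setIidl EQ).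
by move=> /(_ h); apply: filterS => x /[apply] -[].
Qed.

(** The index set is countable, as is required to combine the almost everywhere statements on the
    boxes. *)
Lemma open_bigcup_boxes : exists F : 'rV[rat]_n * nat -> ('I_n -> R) * ('I_n -> R),
  forall x, Omega x -> exists p, [/\ open_box (F p).1 (F p).2 x,
    forall i, (F p).1 i <= (F p).2 i & closed_box (F p).1 (F p).2 `<=` Omega].
Proof.
exists (fun p : 'rV[rat]_n * nat =>
  (fun i : 'I_n => ratr (p.1 ord0 i) - p.2.+1%:R^-1,
   fun i : 'I_n => ratr (p.1 ord0 i) + p.2.+1%:R^-1)).
move=> x Ox; have /nbhs_ballP[e /= e0 eU] := open_nbhs_nbhs (conj oO Ox).
pose k := Num.Def.truncn (e^-1 * 2).
have : (k.+1%:R^-1 : R) < e / 2.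
  rewrite -[e / 2]invrK ltf_pV2// ?posrE ?invr_gt0 ?divr_gt0// invfM invrK.
  exact: truncnS_gt.
have : (0 : R) < k.+1%:R^-1 by rewrite invr_gt0.
set r : R := k.+1%:R^-1 => r0 re.
have /choice[q qP] : forall i, exists q : rat, `|x ord0 i - ratr q| < r.
  move=> i; have [|q] := @rat_in_itvoo R (x ord0 i - r) (x ord0 i + r); first by lra.
  by rewrite in_itv/= => h; exists q; rewrite ltr_distlC.
exists (\row_i q i, k) => /=; split.
- by move=> i; have := qP i; rewrite mxE ltr_distl.
- by move=> i; rewrite lerD2l -/r; lra.
- move=> y yb; apply: eU; apply/ball_rVP => // i.
  have := yb i; rewrite mxE => /andP[h1 h2].
  have := qP i; rewrite ltr_distl => /andP[h3 h4].
  by rewrite ltr_distl; rewrite -/r in h1 h2; apply/andP; split; lra.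
Qed.

Lemma du_bois_reymond : ae_eq mu Omega g (cst 0).
Proof.
have [F FP] := open_bigcup_boxes.
(* The enumeration also runs through boxes that leave [Omega], so the conditions on the box are
   premises here. *)
pose P m x := if unpickle m is Some p then
   (forall i, (F p).1 i <= (F p).2 i) -> closed_box (F p).1 (F p).2 `<=` Omega ->
   open_box (F p).1 (F p).2 x -> G x = 0 else True.
have : \forall x \ae mu, forall m, P m x.
  apply/ae_foralln => m; rewrite /P; case: unpickle => [p|]; last exact: nearW.
  have [h1|h1] := pselect (forall i, (F p).1 i <= (F p).2 i); last first.
    by apply: nearW => x /h1.
  have [h2|h2] := pselect (closed_box (F p).1 (F p).2 `<=` Omega); last first.
    by apply: nearW => x _ /h2.
  by have := ae_box0 h1 h2; apply: filterS => x h _ _ /h.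
apply: filterS => x H Ox; have [p [p1 p2 p3]] := FP _ Ox.
have := H (pickle p); rewrite /P pickleK => /(_ p2 p3 p1).
by rewrite /G patchE mem_set.
Qed.

End du_bois_reymond.

(** * Sobolev spaces on an open set *)

Section euclidean_sums.
Context {R : realType}.

Lemma sqrt_sqrD_triangle (x y a b c d : R) : 0 <= x -> 0 <= y -> 0 <= a -> 0 <= b ->
  0 <= c -> 0 <= d -> x <= a + c -> y <= b + d ->
  Num.sqrt (x ^+ 2 + y ^+ 2) <= Num.sqrt (a ^+ 2 + b ^+ 2) + Num.sqrt (c ^+ 2 + d ^+ 2).
Proof.
move=> x0 y0 a0 b0 c0 d0 xac ybd.
set p := Num.sqrt (a ^+ 2 + b ^+ 2); set q := Num.sqrt (c ^+ 2 + d ^+ 2).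
have p0 : 0 <= p by exact: sqrtr_ge0.
have q0 : 0 <= q by exact: sqrtr_ge0.
have pE : p ^+ 2 = a ^+ 2 + b ^+ 2 by rewrite sqr_sqrtr// addr_ge0// sqr_ge0.
have qE : q ^+ 2 = c ^+ 2 + d ^+ 2 by rewrite sqr_sqrtr// addr_ge0// sqr_ge0.
(* Cauchy-Schwarz in the plane by Lagrange's identity: the squares differ by (ad - bc)^2. *)
have cs : a * c + b * d <= p * q.
  rewrite -(@ler_pXn2r _ 2) ?nnegrE ?addr_ge0 ?mulr_ge0//.
  by rewrite exprMn pE qE -subr_ge0 (_ : _ - _ = (a * d - b * c) ^+ 2) ?sqr_ge0//; ring.
rewrite -[leRHS]ger0_norm ?addr_ge0// -sqrtr_sqr ler_sqrt ?sqr_ge0//.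
have h1 : x ^+ 2 <= (a + c) ^+ 2 by rewrite lerXn2r ?nnegrE// addr_ge0.
have h2 : y ^+ 2 <= (b + d) ^+ 2 by rewrite lerXn2r ?nnegrE// addr_ge0.
apply: le_trans (lerD h1 h2) _; rewrite [leRHS]sqrrD pE qE.
rewrite -subr_ge0 (_ : _ - _ = 2 * (p * q - (a * c + b * d))); first by rewrite mulr_ge0// subr_ge0.
by rewrite -mulr_natl; ring.
Qed.

Lemma sqrt_sum_sqr_triangle (I : Type) (s : seq I) (x a b : I -> R) :
  (forall i, 0 <= x i) -> (forall i, 0 <= a i) -> (forall i, 0 <= b i) ->
  (forall i, x i <= a i + b i) ->
  Num.sqrt (\sum_(i <- s) x i ^+ 2) <=
  Num.sqrt (\sum_(i <- s) a i ^+ 2) + Num.sqrt (\sum_(i <- s) b i ^+ 2).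
Proof.
move=> x0 a0 b0 xab; elim: s => [|i s IH]; first by rewrite !big_nil sqrtr0 addr0.
have E (y : I -> R) : \sum_(j <- i :: s) y j ^+ 2 =
    y i ^+ 2 + Num.sqrt (\sum_(j <- s) y j ^+ 2) ^+ 2.
  by rewrite big_cons sqr_sqrtr// sumr_ge0// => j _; exact: sqr_ge0.
by rewrite !E; apply: sqrt_sqrD_triangle => //; exact: sqrtr_ge0.
Qed.

Lemma sqrt_sum_sqrZ (I : Type) (s : seq I) (k : R) (x : I -> R) :
  Num.sqrt (\sum_(i <- s) (`|k| * x i) ^+ 2) = `|k| * Num.sqrt (\sum_(i <- s) x i ^+ 2).
Proof.
under eq_bigr do rewrite exprMn real_normK ?num_real//.
by rewrite -mulr_sumr sqrtrM ?sqr_ge0// sqrtr_sqr.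
Qed.

Lemma le_sqrt_sum_sqr (I : finType) (x : I -> R) i : 0 <= x i ->
  x i <= Num.sqrt (\sum_j x j ^+ 2).
Proof.
move=> x0; rewrite -{1}[x i]ger0_norm// -sqrtr_sqr ler_sqrt; last first.
  by apply: sumr_ge0 => j _; exact: sqr_ge0.
by rewrite (bigD1 i)//= lerDl; apply: sumr_ge0 => j _; exact: sqr_ge0.
Qed.

Lemma sqrt_sum_sqr_le (I : finType) (x : I -> R) : (forall i, 0 <= x i) ->
  Num.sqrt (\sum_j x j ^+ 2) <= \sum_j x j.
Proof.
move=> x0; rewrite -[leRHS]ger0_norm ?sumr_ge0// -sqrtr_sqr ler_sqrt ?sqr_ge0//.
elim: (index_enum _) => [|i s IH]; first by rewrite !big_nil expr0n.
rewrite !big_cons sqrrD -addrA lerD2l; apply: le_trans IH _.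
by rewrite lerDr mulrn_wge0// mulr_ge0// sumr_ge0.
Qed.

End euclidean_sums.

Section L2_Omega.
Context {R : realType} {n : nat}.
Local Notation V := 'rV[R]_n.
Local Notation mu := (@leb R n).
Variable Omega : set V.
Hypothesis mO : measurable Omega.
Implicit Types f g h : V -> R.

Lemma restrictD f g : (f + g) \_ Omega = f \_ Omega + g \_ Omega.
Proof. by apply/funext => x; rewrite !fctE !patchE; case: ifP => //; rewrite addr0. Qed.

Lemma restrictZ k f : (k *: f) \_ Omega = k *: (f \_ Omega).
Proof. by apply/funext => x; rewrite !fctE !patchE; case: ifP => //; rewrite scaler0. Qed.

Lemma in_L2D f g : in_L2 Omega f -> in_L2 Omega g -> in_L2 Omega (f + g).
Proof. by move=> f2 g2; rewrite /in_L2 restrictD; exact: L2D. Qed.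

Lemma in_L2Z k f : in_L2 Omega f -> in_L2 Omega (k *: f).
Proof. by move=> f2; rewrite /in_L2 restrictZ; exact: L2Z. Qed.

Lemma in_L2N f : in_L2 Omega f -> in_L2 Omega (- f).
Proof. by move=> f2; rewrite -scaleN1r; exact: in_L2Z. Qed.

Lemma in_L2B f g : in_L2 Omega f -> in_L2 Omega g -> in_L2 Omega (f - g).
Proof. by move=> f2 g2; apply: in_L2D => //; exact: in_L2N. Qed.

Lemma in_L2_0 : in_L2 Omega 0.
Proof. by rewrite -(scale0r 0) /in_L2 restrictZ scale0r; exact: L2_0. Qed.

Lemma L2norm_ge0 f : 0 <= L2norm Omega f.
Proof. exact: nrm2_ge0. Qed.

Lemma L2normD f g : in_L2 Omega f -> in_L2 Omega g ->
  L2norm Omega (f + g) <= L2norm Omega f + L2norm Omega g.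
Proof.
move=> f2 g2; rewrite /L2norm /eL2norm restrictD.
exact: (nrm2D f2 g2).
Qed.

Lemma L2normZ k f : in_L2 Omega f -> L2norm Omega (k *: f) = `|k| * L2norm Omega f.
Proof. by move=> f2; rewrite /L2norm /eL2norm restrictZ; exact: (nrm2Z k f2). Qed.

Lemma L2normN f : in_L2 Omega f -> L2norm Omega (- f) = L2norm Omega f.
Proof. by move=> f2; rewrite -scaleN1r L2normZ// normrN1 mul1r. Qed.

Lemma L2normC f g : in_L2 Omega f -> in_L2 Omega g ->
  L2norm Omega (f - g) = L2norm Omega (g - f).
Proof. by move=> f2 g2; rewrite -opprB L2normN//; exact: in_L2B. Qed.

Lemma restrict_ae_eq f g : ae_eq mu Omega f g -> f \_ Omega = g \_ Omega %[ae mu].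
Proof.
by apply: filterS => x h _; rewrite !patchE; case: ifPn => //; rewrite inE => /h.
Qed.

Lemma L2norm_ae f g : in_L2 Omega f -> in_L2 Omega g -> ae_eq mu Omega f g ->
  L2norm Omega f = L2norm Omega g.
Proof. by move=> f2 g2 fg; exact: nrm2_ae_eq f2 g2 (restrict_ae_eq fg). Qed.

Lemma L2norm_eq0 f : in_L2 Omega f -> L2norm Omega f = 0 -> ae_eq mu Omega f 0.
Proof.
move=> f2 /(nrm2_eq0 f2); apply: filterS => x /(_ I) h Ox.
by rewrite -h patchE mem_set.
Qed.

Lemma L2norm0 : L2norm Omega 0 = 0.
Proof. by rewrite -(scale0r 0) L2normZ ?normr0 ?mul0r//; exact: in_L2_0. Qed.

Lemma L2norm_ae0 f : in_L2 Omega f -> ae_eq mu Omega f 0 -> L2norm Omega f = 0.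
Proof. by move=> f2 f0; rewrite (L2norm_ae f2 in_L2_0 f0) L2norm0. Qed.

(** The limit on the whole space may be nonzero outside [Omega]; restricting it only decreases the
    distances. *)
Lemma in_L2_complete (f : nat -> V -> R) : (forall k, in_L2 Omega (f k)) ->
  (forall e : R, 0 < e -> exists K, forall j k, (K <= j)%N -> (K <= k)%N ->
     L2norm Omega (f j - f k) < e) ->
  exists2 l, in_L2 Omega l & forall e : R, 0 < e -> exists K, forall k, (K <= k)%N ->
     L2norm Omega (f k - l) < e.
Proof.
move=> f2 fC; have [|l l2 lP] := L2_complete f2.
  move=> e /fC[K KP]; exists K => j k Kj Kk.
  by have := KP _ _ Kj Kk; rewrite /L2norm /eL2norm restrictD -scaleN1r restrictZ scaleN1r.
have ml (h : V -> R) : measurable_fun setT h -> measurable_fun setT (h \_ Omega).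
  move=> mh; apply/(measurable_restrictT _ mO).
  exact: measurable_funTS.
have lO : in_L2 Omega l.
  have [] // := @L2_dominated _ _ _ mu (l \_ Omega) l (ml _ (L2_measurable l2)) l2.
  by apply: nearW => x; rewrite patchE; case: ifP => // _; rewrite normr0.
exists l => // e /lP[K KP]; exists K => k /KP; apply: le_lt_trans.
have fl := L2B (f2 k) l2.
have [] // := @L2_dominated _ _ _ mu ((f k - l) \_ Omega) _ _ fl.
  by apply: L2_measurable (in_L2B (f2 k) lO).
apply: nearW => x; rewrite [in leRHS]fctE !patchE /=.
by case: ifP => // _; rewrite normr0.
Qed.

Lemma in_L2_mul_integrable f g : in_L2 Omega f -> in_L2 Omega g ->
  mu.-integrable Omega (EFin \o (f \* g)).
Proof.
move=> f2 g2; apply/integrable_mkcond => //.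
rewrite (_ : _ \_ _ = EFin \o ((f \_ Omega) \* (g \_ Omega))).
  exact: L2_mul_integrable.
by apply/funext => x; rewrite /= !patchE; case: ifP => //; rewrite mulr0.
Qed.

Lemma in_L2_cauchy_schwarz f g : in_L2 Omega f -> in_L2 Omega g ->
  `|\int[mu]_(x in Omega) (f x * g x)| <= L2norm Omega f * L2norm Omega g.
Proof.
move=> f2 g2; rewrite Rintegral_mkcond.
rewrite (_ : _ \_ _ = fun x => (f \_ Omega) x * (g \_ Omega) x).
  exact: cauchy_schwarz.
by apply/funext => x; rewrite !patchE; case: ifP => //; rewrite mulr0.
Qed.

Lemma L2norm_sqr f : in_L2 Omega f -> L2norm Omega f ^+ 2 = \int[mu]_(x in Omega) (f x * f x).
Proof.
move=> f2; rewrite [LHS](nrm2_sqr f2) [RHS]Rintegral_mkcond; apply: eq_Rintegral => x _.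
by rewrite !patchE; case: ifP => //; rewrite expr2 ?mulr0.
Qed.

End L2_Omega.

Section test_functions.
Context {R : realType} {n : nat}.
Local Notation V := 'rV[R]_n.
Local Notation mu := (@leb R n).
Implicit Types (phi psi u v g h : V -> R) (i : 'I_n).

(** Asking only for continuity keeps the class stable under products with continuous functions such
    as coordinates, and it contains the partial derivatives of test functions: this suffices for
    integration by parts. *)
Definition compactly_supported (Omega : set V) h := continuous h /\
  exists K : set V, [/\ compact K, K `<=` Omega & forall x, ~ K x -> h x = 0].

Lemma bounded_sub_cube (K : set V) : bounded_set K -> exists2 A, 0 <= A & K `<=` cube n A.
Proof.
move=> /ex_strict_bound_gt0[A A0 KA]; exists A; first exact: ltW.
move=> v Kv j; apply: ltW; apply: le_lt_trans (KA _ Kv); rewrite [leRHS]mx_normrE.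
exact: (le_bigmax _ (fun i : 'I_1 * 'I_n => `|v i.1 i.2|) (ord0, j)).
Qed.

Lemma compactly_supported_bounds Omega h : compactly_supported Omega h ->
  exists A B : R, [/\ 0 <= A, forall x, `|h x| <= B & forall x, ~ cube n A x -> h x = 0].
Proof.
move=> [ch [K [cK KO hK]]]; have [A A0 KA] := bounded_sub_cube (compact_bounded cK).
have /compact_bounded/ex_strict_bound_gt0[B B0 hB] : compact (h @` K).
  by apply: continuous_compact => //; exact: continuous_subspaceT.
exists A, B; split => // [x|x nx]; last by apply: hK => /KA.
have [Kx|/hK ->] := pselect (K x); last by rewrite normr0 ltW.
by apply/ltW/hB; exists x.
Qed.

Lemma compactly_supported_L2 Omega h : compactly_supported Omega h -> in_L2 Omega h.
Proof.
move=> cs; have [A [B [A0 hB hA]]] := compactly_supported_bounds cs.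
have [ch [K [cK KO hK]]] := cs.
rewrite /in_L2 (_ : h \_ Omega = h); last first.
  apply/funext => x; rewrite patchE; case: ifPn => // /negP xO.
  by rewrite hK// => /KO xO'; apply: xO; rewrite inE.
have mh := continuous_measurable_rV ch.
apply/L2P; split => //.
have : mu.-integrable setT (EFin \o (fun x => h x ^+ 2)).
  apply: (@integrable_cube _ _ _ A (B ^+ 2)).
  - exact: measurable_funX.
  - by move=> x; rewrite normrX lerXn2r ?nnegrE//; apply: le_trans (hB x).
  - by move=> x /hA ->; rewrite expr0n.
move=> /integrableP[_]; apply: le_lt_trans.
by rewrite le_eqVlt; apply/orP; left; apply/eqP/eq_integral => x _; rewrite /= ger0_norm ?sqr_ge0.
Qed.

Lemma compactly_supported_restrict Omega h : compactly_supported Omega h ->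
  h \_ Omega = h.
Proof.
move=> [_ [K [_ KO hK]]]; apply/funext => x; rewrite patchE; case: ifPn => // /negP xO.
by rewrite hK// => /KO xO'; apply: xO; rewrite inE.
Qed.

Lemma compactly_supportedM Omega g h : continuous g -> compactly_supported Omega h ->
  compactly_supported Omega (fun x => g x * h x).
Proof.
move=> cg [ch [K [cK KO hK]]]; split; first by move=> x; apply: continuousM; [exact: cg|exact: ch].
by exists K; split => // x /hK ->; rewrite mulr0.
Qed.

Lemma compactly_supportedD Omega g h : compactly_supported Omega g ->
  compactly_supported Omega h -> compactly_supported Omega (fun x => g x + h x).
Proof.
move=> [cg [K [cK KO gK]]] [ch [K' [cK' KO' hK]]]; split.
  by move=> x; apply: continuousD; [exact: cg|exact: ch].
exists (K `|` K'); split; [exact: compactU|by move=> x [/KO|/KO']|].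
by move=> x /not_orP[/gK -> /hK ->]; rewrite addr0.
Qed.

Variable Omega : set V.

Lemma test_compactly_supported phi : test_function Omega phi -> compactly_supported Omega phi.
Proof.
by move=> [sphi hK]; split => //; have [] := sphi 0%N [::] isT.
Qed.

Lemma test_derivable phi i x : test_function Omega phi -> derivable phi x (delta_mx ord0 i).
Proof. by move=> [sphi _]; have [_] := sphi 1%N [::] isT; apply. Qed.

Lemma test_partial_compactly_supported phi i : test_function Omega phi ->
  compactly_supported Omega ('D_(delta_mx ord0 i) phi).
Proof.
move=> [sphi [K [cK KO phiK]]]; split; first by have [] := sphi 1%N [:: i] isT.
exists K; split => // x Kx.
have cK' : closed K by apply: compact_closed => //; exact: norm_hausdorff.
rewrite (@near_eq_derive _ _ _ phi (cst 0)) ?derive_cst//.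
have : nbhs x (~` K) by apply: open_nbhs_nbhs; split => //; exact: closed_openC.
by apply: filterS => y /phiK.
Qed.

Lemma partials_lin k phi psi s : smooth phi -> smooth psi ->
  partials s (k *: phi + psi) = k *: partials s phi + partials s psi.
Proof.
move=> sphi spsi; elim: s => [//|i s IH] /=; rewrite IH; apply/funext => x.
have d1 : derivable (partials s phi) x (delta_mx ord0 i).
  by have [_] := sphi (size s).+1 s (leqW (leqnn _)); apply.
have d2 : derivable (partials s psi) x (delta_mx ord0 i).
  by have [_] := spsi (size s).+1 s (leqW (leqnn _)); apply.
by rewrite (deriveD (derivableZ (k := k) d1) d2) (deriveZ k d1).
Qed.

Lemma test_lin k phi psi : test_function Omega phi -> test_function Omega psi ->
  test_function Omega (k *: phi + psi).
Proof.
move=> [sphi [K [cK KO phiK]]] [spsi [K' [cK' KO' psiK']]]; split.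
  move=> m s sm; rewrite partials_lin//; have [c1 d1] := sphi m s sm.
  have [c2 d2] := spsi m s sm; split.
    by move=> x; apply: continuousD; [apply: continuousZ; [exact: cst_continuous|exact: c1]|exact: c2].
  by move=> lt i x; apply: derivableD; [apply: derivableZ; exact: d1|exact: d2].
exists (K `|` K'); split; first exact: compactU.
  by move=> x [/KO|/KO'].
by move=> x /not_orP[/phiK h /psiK' h']; rewrite !fctE h h' scaler0 addr0.
Qed.

Lemma test0 : test_function Omega 0.
Proof.
split; last by exists set0; split => //; exact: compact0.
apply: flat_generated_smooth; exact: (flat_generated_cst 0).
Qed.

Lemma integral_test_partial0 (f : V -> R) (g : V -> R) i : compactly_supported Omega f ->
  compactly_supported Omega g -> (forall x, is_derive x (delta_mx ord0 i) f (g x)) ->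
  \int[mu]_(x in Omega) g x = 0.
Proof.
move=> cf cg df.
have [A [B [A0 fB fA]]] := compactly_supported_bounds cf.
have [A' [B' [A'0 gB' gA']]] := compactly_supported_bounds cg.
rewrite Rintegral_mkcond (compactly_supported_restrict cg) /Rintegral.
suff -> : (\int[mu]_x (g x)%:E = 0)%E by [].
apply: (@integral_partial0 R n i f g (Num.max A A') B') => //.
- by rewrite le_max A0.
- exact: continuous_measurable_rV cg.1.
- move=> v nv; split.
    by apply: fA => h; apply: nv => j; rewrite le_max h.
  by apply: gA' => h; apply: nv => j; rewrite le_max h orbT.
- move=> v t; rewrite (_ : (fun t => _) = fun t : R => f (t *: delta_mx ord0 i + v)); last first.
    by apply/funext => s; rewrite addrC.
  by apply/is_derive_line; rewrite addrC; exact: df.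
- move=> v t; apply: continuous_comp; last exact: cg.1.
  apply: continuousD; first exact: cst_continuous.
  by apply: continuousZr_tmp.
Qed.

End test_functions.

(** * Weak derivatives and the space H^1 *)

Section weak_derivatives.
Context {R : realType} {n : nat}.
Local Notation V := 'rV[R]_n.
Local Notation mu := (@leb R n).
Variable Omega : set V.
Hypothesis oO : open Omega.
Implicit Types (phi psi u v g h w : V -> R) (i : 'I_n).

Let mO : measurable Omega. Proof. exact: open_measurable_rV. Qed.

Lemma Rintegral_lin_mul k u v w : in_L2 Omega u -> in_L2 Omega v -> in_L2 Omega w ->
  \int[mu]_(x in Omega) ((k *: u + v) x * w x) =
  k * \int[mu]_(x in Omega) (u x * w x) + \int[mu]_(x in Omega) (v x * w x).
Proof.
move=> u2 v2 w2.
have iu : mu.-integrable Omega (EFin \o (fun x => u x * w x)) := in_L2_mul_integrable mO u2 w2.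
have iv : mu.-integrable Omega (EFin \o (fun x => v x * w x)) := in_L2_mul_integrable mO v2 w2.
have iku : mu.-integrable Omega (EFin \o (fun x => k * (u x * w x))).
  exact: (integrableZl mO k iu).
rewrite -RintegralZl// -RintegralD//; apply: eq_Rintegral => x _.
by rewrite !fctE mulrDl; congr (_ + _); rewrite /GRing.scale/= mulrA.
Qed.

Lemma Rintegral_mul_ae u v w : in_L2 Omega u -> in_L2 Omega v -> in_L2 Omega w ->
  ae_eq mu Omega u v ->
  \int[mu]_(x in Omega) (u x * w x) = \int[mu]_(x in Omega) (v x * w x).
Proof.
move=> u2 v2 w2 uv; congr fine; apply: ae_eq_integral => //.
- exact: measurable_int (in_L2_mul_integrable mO u2 w2).
- exact: measurable_int (in_L2_mul_integrable mO v2 w2).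
- by apply: filterS uv => x h Ox; rewrite h.
Qed.

Lemma test_L2 phi : test_function Omega phi -> in_L2 Omega phi.
Proof. by move=> /test_compactly_supported/compactly_supported_L2. Qed.

Lemma test_partial_L2 phi i : test_function Omega phi ->
  in_L2 Omega ('D_(delta_mx ord0 i) phi).
Proof. by move=> /(test_partial_compactly_supported i)/compactly_supported_L2. Qed.

Lemma weak_partial_lin i k u v g h : in_L2 Omega u -> in_L2 Omega v ->
  in_L2 Omega g -> in_L2 Omega h -> weak_partial Omega i u g -> weak_partial Omega i v h ->
  weak_partial Omega i (k *: u + v) (k *: g + h).
Proof.
move=> u2 v2 g2 h2 ug vh phi tphi.
have p2 := test_L2 tphi; have dp2 := test_partial_L2 i tphi.
by rewrite !Rintegral_lin_mul// ug// vh// mulrN opprD.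
Qed.

(** The difference g - h integrates to zero against every test function. Allowing [u] and [v] to
    differ on a null set gives at once that weak derivatives depend only on the class. *)
Lemma weak_partial_unique i u v g h : in_L2 Omega u -> in_L2 Omega v ->
  in_L2 Omega g -> in_L2 Omega h -> weak_partial Omega i u g -> weak_partial Omega i v h ->
  ae_eq mu Omega u v -> ae_eq mu Omega g h.
Proof.
move=> u2 v2 g2 h2 ug vh uv.
have : ae_eq mu Omega (g - h) (cst 0).
  apply: du_bois_reymond => //; first exact: in_L2B.
  move=> phi tphi; have p2 := test_L2 tphi; have dp2 := test_partial_L2 i tphi.
  rewrite (_ : g - h = (-1) *: h + g); last by rewrite scaleN1r addrC.
  rewrite Rintegral_lin_mul//.
  have := ug _ tphi; have := vh _ tphi; rewrite (Rintegral_mul_ae u2 v2 dp2 uv).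
  by move=> -> /oppr_inj <-; rewrite mulN1r addNr.
by apply: filterS => x gh Ox; apply/eqP; rewrite -subr_eq0; apply/eqP; exact: gh.
Qed.

Lemma wderivP i u : in_H1 Omega u ->
  in_L2 Omega (wderiv Omega i u) /\ weak_partial Omega i u (wderiv Omega i u).
Proof.
move=> [_ /(_ i)[g g2 gu]].
by apply: (xgetPex (cst 0) (P := [set g | in_L2 Omega g /\ weak_partial Omega i u g])); exists g.
Qed.

Lemma wderiv_L2 i u : in_H1 Omega u -> in_L2 Omega (wderiv Omega i u).
Proof. by move=> /(wderivP i)[]. Qed.

Lemma wderiv_unique i u g : in_H1 Omega u -> in_L2 Omega g -> weak_partial Omega i u g ->
  ae_eq mu Omega (wderiv Omega i u) g.
Proof.
move=> uH g2 ug; have [w2 uw] := wderivP i uH; have [u2 _] := uH.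
exact: (weak_partial_unique u2 u2 w2 g2 uw ug (nearW _ _)).
Qed.

Lemma in_H1_L2 u : in_H1 Omega u -> in_L2 Omega u.
Proof. by case. Qed.

Lemma in_H1_lin k u v : in_H1 Omega u -> in_H1 Omega v -> in_H1 Omega (k *: u + v).
Proof.
move=> uH vH; have u2 := in_H1_L2 uH; have v2 := in_H1_L2 vH.
split; first by apply: in_L2D => //; exact: in_L2Z.
move=> i; have [a1 a2] := wderivP i uH; have [b1 b2] := wderivP i vH.
exists (k *: wderiv Omega i u + wderiv Omega i v).
  by apply: in_L2D => //; exact: in_L2Z.
exact: weak_partial_lin.
Qed.

(** [wderiv] selects a representative, so linearity holds only almost everywhere. *)
Lemma wderiv_lin i k u v : in_H1 Omega u -> in_H1 Omega v ->
  ae_eq mu Omega (wderiv Omega i (k *: u + v)) (k *: wderiv Omega i u + wderiv Omega i v).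
Proof.
move=> uH vH; have u2 := in_H1_L2 uH; have v2 := in_H1_L2 vH.
have [a1 a2] := wderivP i uH; have [b1 b2] := wderivP i vH.
apply: wderiv_unique; first exact: in_H1_lin.
  by apply: in_L2D => //; exact: in_L2Z.
exact: weak_partial_lin.
Qed.

Lemma weak_partial0 i : weak_partial Omega i 0 0.
Proof.
move=> phi tphi; have E f : \int[mu]_(x in Omega) ((0 : V -> R) x * f x) = 0.
  rewrite -[RHS](mul0r (fine (mu Omega))) -Rintegral_cst//.
  by apply: eq_Rintegral => x _; exact: mul0r.
by rewrite !E oppr0.
Qed.

Lemma in_H1_0 : in_H1 Omega 0.
Proof.
split; first exact: in_L2_0.
by move=> i; exists 0; [exact: in_L2_0|exact: weak_partial0].
Qed.

Lemma in_H1Z k u : in_H1 Omega u -> in_H1 Omega (k *: u).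
Proof. by move=> uH; rewrite -[_ *: _]addr0; apply: in_H1_lin => //; exact: in_H1_0. Qed.

Lemma in_H1B u v : in_H1 Omega u -> in_H1 Omega v -> in_H1 Omega (u - v).
Proof. by move=> uH vH; rewrite addrC -scaleN1r; exact: in_H1_lin. Qed.

Lemma wderiv_norm_lin i k u v : in_H1 Omega u -> in_H1 Omega v ->
  L2norm Omega (wderiv Omega i (k *: u + v)) =
  L2norm Omega (k *: wderiv Omega i u + wderiv Omega i v).
Proof.
move=> uH vH; apply: L2norm_ae; last exact: wderiv_lin.
- exact/wderiv_L2/in_H1_lin.
- by apply: in_L2D; [exact/in_L2Z/wderiv_L2|exact: wderiv_L2].
Qed.

Lemma wderiv_normB i u v : in_H1 Omega u -> in_H1 Omega v ->
  L2norm Omega (wderiv Omega i (u - v)) = L2norm Omega (wderiv Omega i u - wderiv Omega i v).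
Proof.
move=> uH vH; rewrite (_ : u - v = (-1) *: v + u); last by rewrite scaleN1r addrC.
by rewrite wderiv_norm_lin// scaleN1r addrC.
Qed.

Lemma gradnorm_ge0 u : 0 <= gradnorm Omega u.
Proof. exact: sqrtr_ge0. Qed.

Lemma gradnorm_ae u v : in_H1 Omega u -> in_H1 Omega v -> ae_eq mu Omega u v ->
  gradnorm Omega u = gradnorm Omega v.
Proof.
move=> uH vH uv; congr Num.sqrt; apply: eq_bigr => i _; congr (_ ^+ 2).
have [a1 a2] := wderivP i uH; have [b1 b2] := wderivP i vH.
apply: L2norm_ae => //.
exact: (weak_partial_unique (in_H1_L2 uH) (in_H1_L2 vH) a1 b1 a2 b2 uv).
Qed.

Lemma gradnorm_lin k u v : in_H1 Omega u -> in_H1 Omega v ->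
  gradnorm Omega (k *: u + v) <= `|k| * gradnorm Omega u + gradnorm Omega v.
Proof.
move=> uH vH; rewrite -sqrt_sum_sqrZ; apply: sqrt_sum_sqr_triangle => i.
- exact: L2norm_ge0.
- by rewrite mulr_ge0// L2norm_ge0.
- exact: L2norm_ge0.
- rewrite wderiv_norm_lin//; have a := wderiv_L2 i uH; have b := wderiv_L2 i vH.
  by apply: le_trans (L2normD (in_L2Z k a) b) _; rewrite L2normZ.
Qed.

Lemma gradnormZ k u : in_H1 Omega u -> gradnorm Omega (k *: u) = `|k| * gradnorm Omega u.
Proof.
move=> uH; rewrite -sqrt_sum_sqrZ; congr Num.sqrt; apply: eq_bigr => i _; congr (_ ^+ 2).
have [a1 a2] := wderivP i uH; rewrite -L2normZ//.
apply: L2norm_ae; [exact/wderiv_L2/in_H1Z|exact: in_L2Z|].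
apply: wderiv_unique; [exact: in_H1Z|exact: in_L2Z|].
rewrite -[_ *: u]addr0 -[_ *: wderiv _ _ _]addr0.
by apply: weak_partial_lin => //; [exact: in_H1_L2|exact: in_L2_0..|exact: weak_partial0].
Qed.

Lemma gradnorm0 : gradnorm Omega 0 = 0.
Proof. by rewrite -(scale0r 0) gradnormZ ?normr0 ?mul0r//; exact: in_H1_0. Qed.

Lemma gradnormD u v : in_H1 Omega u -> in_H1 Omega v ->
  gradnorm Omega (u + v) <= gradnorm Omega u + gradnorm Omega v.
Proof.
by move=> uH vH; have := gradnorm_lin 1 uH vH; rewrite scale1r normr1 mul1r.
Qed.

Lemma gradnormC u v : in_H1 Omega u -> in_H1 Omega v ->
  gradnorm Omega (u - v) = gradnorm Omega (v - u).
Proof.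
move=> uH vH; rewrite -opprB -scaleN1r (gradnormZ _ (in_H1B vH uH)).
by rewrite normrN1 mul1r.
Qed.

Lemma L2norm_wderiv_le i u : L2norm Omega (wderiv Omega i u) <= gradnorm Omega u.
Proof. exact: (@le_sqrt_sum_sqr _ _ (fun i => L2norm Omega (wderiv Omega i u)) i (L2norm_ge0 _ _)). Qed.

Lemma gradnorm_le u : gradnorm Omega u <= \sum_i L2norm Omega (wderiv Omega i u).
Proof. by apply: sqrt_sum_sqr_le => i; exact: L2norm_ge0. Qed.

Lemma H1norm_le u : H1norm Omega u <= L2norm Omega u + gradnorm Omega u.
Proof.
have h1 := L2norm_ge0 Omega u; have h2 := gradnorm_ge0 u.
rewrite -[leRHS]ger0_norm ?addr_ge0// -sqrtr_sqr ler_sqrt ?sqr_ge0//.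
by rewrite sqrrD -addrA lerD2l lerDr mulrn_wge0// mulr_ge0.
Qed.

Lemma L2norm_le_H1norm u : L2norm Omega u <= H1norm Omega u.
Proof.
rewrite -[leLHS]ger0_norm ?L2norm_ge0// -sqrtr_sqr ler_sqrt ?addr_ge0 ?sqr_ge0//.
by rewrite lerDl sqr_ge0.
Qed.

Lemma gradnorm_le_H1norm u : gradnorm Omega u <= H1norm Omega u.
Proof.
rewrite -[leLHS]ger0_norm ?gradnorm_ge0// -sqrtr_sqr ler_sqrt ?addr_ge0 ?sqr_ge0//.
by rewrite lerDr sqr_ge0.
Qed.

Lemma is_derive_test i phi x : test_function Omega phi ->
  is_derive x (delta_mx ord0 i) phi ('D_(delta_mx ord0 i) phi x).
Proof. by move=> tphi; apply: derivableP; exact: test_derivable tphi. Qed.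

(** The partial derivative of the product of two test functions has zero integral. *)
Lemma test_weak_partial i phi : test_function Omega phi ->
  weak_partial Omega i phi ('D_(delta_mx ord0 i) phi).
Proof.
move=> tphi psi tpsi.
have cphi := test_compactly_supported tphi.
have cdphi := test_partial_compactly_supported i tphi.
have cpsi := test_compactly_supported tpsi.
have cdpsi := test_partial_compactly_supported i tpsi.
have p2 := test_L2 tphi; have dp2 := test_partial_L2 i tphi.
have q2 := test_L2 tpsi; have dq2 := test_partial_L2 i tpsi.
have := @integral_test_partial0 _ _ Omega (phi \* psi)
  (fun x => phi x * 'D_(delta_mx ord0 i) psi x + psi x * 'D_(delta_mx ord0 i) phi x) i.
move=> H; apply/eqP; rewrite -addr_eq0 -RintegralD//.
- apply/eqP; rewrite -[RHS]H.
  + by apply: eq_Rintegral => x _; congr (_ + _); rewrite mulrC.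
  + exact: (compactly_supportedM cphi.1 cpsi).
  + have h1 := compactly_supportedM cphi.1 cdpsi.
    have h2 := compactly_supportedM cpsi.1 cdphi.
    exact: compactly_supportedD h1 h2.
  + move=> x; have h1 := is_derive_test i x tphi; have h2 := is_derive_test i x tpsi.
    exact: is_deriveM.
- exact: (in_L2_mul_integrable mO p2 dq2).
- exact: (in_L2_mul_integrable mO dp2 q2).
Qed.

Lemma test_H1 phi : test_function Omega phi -> in_H1 Omega phi.
Proof.
move=> tphi; split; first exact: test_L2.
move=> i; exists ('D_(delta_mx ord0 i) phi); first exact: test_partial_L2.
exact: test_weak_partial.
Qed.

Lemma test_wderiv i phi : test_function Omega phi ->
  L2norm Omega (wderiv Omega i phi) = L2norm Omega ('D_(delta_mx ord0 i) phi).
Proof.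
move=> tphi; have h := test_H1 tphi; apply: L2norm_ae.
- exact: wderiv_L2.
- exact: test_partial_L2.
- by apply: wderiv_unique => //; [exact: test_partial_L2|exact: test_weak_partial].
Qed.

Section poincare.
Variables (A : R) (i : 'I_n).
Hypothesis A0 : 0 <= A.
Hypothesis OA : Omega `<=` cube n A.

(* Integrate the [i]-th partial derivative [phi^2 + 2 x_i phi d_i phi] of [x_i phi^2]. *)
Lemma test_poincare phi : test_function Omega phi ->
  L2norm Omega phi <= 2 * A * L2norm Omega ('D_(delta_mx ord0 i) phi).
Proof.
move=> tphi; set d := 'D_(delta_mx ord0 i) phi.
have cphi := test_compactly_supported tphi.
have cd := test_partial_compactly_supported i tphi.
have p2 := test_L2 tphi; have d2 := test_partial_L2 i tphi.
pose y (x : V) := x ord0 i.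
have cy : continuous y by exact: coord_continuous.
have c1 := compactly_supportedM cphi.1 cphi.
have c2 := compactly_supportedM cy c1.
have c3 := compactly_supportedM cphi.1 cd.
have c4 := compactly_supportedM cy c3.
have e2 := compactly_supported_L2 (compactly_supportedM cy cphi).
have := @integral_test_partial0 _ _ Omega (fun x => y x * (phi x * phi x))
  (fun x => 1 * (phi x * phi x) + 2 * ((y x * phi x) * d x)) i c2.
have i1 : mu.-integrable Omega (EFin \o (fun x => phi x * phi x)) := in_L2_mul_integrable mO p2 p2.
have i2 : mu.-integrable Omega (EFin \o (fun x => (y x * phi x) * d x)) := in_L2_mul_integrable mO e2 d2.
have H : L2norm Omega (fun x => y x * phi x) <= A * L2norm Omega phi.
  rewrite -[X in X * _](ger0_norm A0) -L2normZ//.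
  have Ap := in_L2Z A p2.
  have [] // := @L2_dominated _ _ _ mu ((fun x => y x * phi x) \_ Omega) ((A *: phi) \_ Omega) (L2_measurable e2) Ap.
  apply: nearW => x; rewrite !patchE; case: ifPn => //; rewrite inE => Ox.
  rewrite /= !normrM ler_wpM2r// (le_trans (OA Ox i))//.
  by rewrite ger0_norm.
move=> /(_ _ _)h.
have : L2norm Omega phi ^+ 2 = - (2 * \int[mu]_(x in Omega) ((y x * phi x) * d x)).
  apply/eqP; rewrite -addr_eq0 L2norm_sqr// -RintegralZl// -RintegralD//; last exact: (integrableZl mO 2 i2).
  apply/eqP; rewrite -[RHS]h; first by apply: eq_Rintegral => x _; rewrite mul1r.
  - apply: compactly_supportedD; first by apply: (compactly_supportedM (g := fun=> 1) _ c1); exact: cst_continuous.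
    apply: (compactly_supportedM (g := fun=> 2)); first exact: cst_continuous.
    exact: (compactly_supportedM (g := fun x => y x * phi x) (compactly_supportedM cy cphi).1 cd).
  - move=> x; have dp := is_derive_test i x tphi.
    have dy : is_derive x (delta_mx ord0 i) y 1.
      rewrite -[x]add0r -[0](scale0r (delta_mx ord0 i)); apply/is_derive_line.
      rewrite (_ : (fun h : R => y _) = (fun h : R => h + x ord0 i)); last first.
        by apply/funext => h'; rewrite /y !mxE !eqxx mulr1.
      by apply: is_derive_eq; rewrite addr0.
    apply: is_derive_eq.
    rewrite /GRing.scale/= -[derive phi x _]/(d x); ring.
move=> E; have cs := in_L2_cauchy_schwarz e2 d2.
have : L2norm Omega phi ^+ 2 <= 2 * (A * L2norm Omega phi * L2norm Omega d).
  rewrite E -mulrN ler_wpM2l//; apply: le_trans (ler_norm _) _; rewrite normrN.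
  by apply: le_trans cs _; rewrite ler_wpM2r// L2norm_ge0.
have [->|p0] := eqVneq (L2norm Omega phi) 0; first by rewrite !mulr_ge0// L2norm_ge0.
have p0' : 0 < L2norm Omega phi by rewrite lt_neqAle eq_sym p0 L2norm_ge0.
move=> h'; rewrite -(ler_pM2r p0') -expr2; apply: le_trans h' _.
by rewrite le_eqVlt; apply/orP; left; apply/eqP; ring.
Qed.

End poincare.
End weak_derivatives.

(** * The space H^1_0: Poincare inequality and completeness *)

Section H10.
Context {R : realType} {n : nat}.
Local Notation V := 'rV[R]_n.
Local Notation mu := (@leb R n).
Variable Omega : set V.
Hypothesis oO : open Omega.
Implicit Types (phi psi u v g h w : V -> R).

Let mO : measurable Omega. Proof. exact: open_measurable_rV. Qed.

Lemma in_H10P u : in_H10 Omega u <-> in_H1 Omega u /\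
  forall e : R, 0 < e -> exists2 phi, test_function Omega phi &
    L2norm Omega (u - phi) < e /\ gradnorm Omega (u - phi) < e.
Proof.
split=> [[uH [phi tphi /cvgrPdist_lt phiu]]|[uH uP]]; split => //.
  move=> e e0; have [k _ /(_ k (leqnn k))] := phiu e e0.
  rewrite /= sub0r normrN => h; exists (phi k) => //.
  split; apply: le_lt_trans h; apply: le_trans (ler_norm _).
    exact: L2norm_le_H1norm.
  exact: gradnorm_le_H1norm.
have /choice[phi phiP] : forall k : nat, exists phi, test_function Omega phi /\
    (L2norm Omega (u - phi) < k.+1%:R^-1 /\ gradnorm Omega (u - phi) < k.+1%:R^-1).
  by move=> k; have [|phi p1 p2] := uP k.+1%:R^-1; [rewrite invr_gt0|exists phi].
exists phi; first by move=> k; have [] := phiP k.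
apply: (@squeeze_cvgr _ _ _ _ (cst 0) (fun k : nat => k.+1%:R^-1 + k.+1%:R^-1)).
- apply: nearW => k; rewrite /= sqrtr_ge0/=.
  have [_ [h1 h2]] := phiP k.
  by apply: le_trans (H1norm_le _ _) _; apply: lerD; exact: ltW.
- exact: cvg_cst.
- by rewrite -[X in _ --> X]addr0; apply: cvgD; exact: cvg_harmonic.
Qed.

Lemma in_H10_H1 u : in_H10 Omega u -> in_H1 Omega u.
Proof. by case. Qed.

Lemma in_H10_L2 u : in_H10 Omega u -> in_L2 Omega u.
Proof. by case=> -[]. Qed.

Lemma in_H10_lin k u v : in_H10 Omega u -> in_H10 Omega v -> in_H10 Omega (k *: u + v).
Proof.
move=> /in_H10P[uH uP] /in_H10P[vH vP]; apply/in_H10P; split; first exact: in_H1_lin.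
move=> e e0; have k1 : 0 < `|k| + 1 by rewrite ltr_wpDl.
have e'0 : 0 < e / (`|k| + 1) by rewrite divr_gt0.
have [phi tphi [p1 p2]] := uP _ e'0; have [psi tpsi [q1 q2]] := vP _ e'0.
have pH := test_H1 oO tphi; have qH := test_H1 oO tpsi.
exists (k *: phi + psi); first exact: test_lin.
have -> : k *: u + v - (k *: phi + psi) = k *: (u - phi) + (v - psi).
  by rewrite opprD addrACA scalerBr.
have E : `|k| * (e / (`|k| + 1)) + e / (`|k| + 1) = e.
  by rewrite -[X in _ + X]mul1r -mulrDl mulrC divfK// gt_eqF.
have uphi := in_H1B oO uH pH; have vpsi := in_H1B oO vH qH.
split.
  apply: le_lt_trans (L2normD (in_L2Z k uphi.1) vpsi.1) _.
  rewrite (L2normZ k uphi.1) -[ltRHS]E; apply: ler_ltD; last exact: q1.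
  exact: (ler_wpM2l (normr_ge0 k) (ltW p1)).
apply: le_lt_trans (gradnorm_lin oO k uphi vpsi) _.
rewrite -[ltRHS]E; apply: ler_ltD; last exact: q2.
exact: (ler_wpM2l (normr_ge0 k) (ltW p2)).
Qed.

Lemma in_H10_0 : in_H10 Omega 0.
Proof.
apply/in_H10P; split; first exact: in_H1_0.
by move=> e e0; exists 0; [exact: test0|rewrite subr0 L2norm0 gradnorm0].
Qed.

Lemma in_H10B u v : in_H10 Omega u -> in_H10 Omega v -> in_H10 Omega (u - v).
Proof. by move=> uH vH; rewrite addrC -scaleN1r; exact: in_H10_lin. Qed.

Section poincare.
Variables (A : R) (i : 'I_n).
Hypothesis A0 : 0 <= A.
Hypothesis OA : Omega `<=` cube n A.

Lemma poincare u : in_H10 Omega u -> L2norm Omega u <= 2 * A * gradnorm Omega u.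
Proof.
move=> /in_H10P[uH uP]; apply/ler_addgt0Pr => e e0.
have c0 : 0 < 2 * A + 1 by rewrite ltr_wpDl// mulr_ge0.
(* The approximation error enters once through the L^2 norm and 2 A times through the gradient norm,
   which add up to [e]. *)
have [|phi tphi [p1 p2]] := uP (e / (2 * A + 1)); first by rewrite divr_gt0.
have pH := test_H1 oO tphi; have uphi := in_H1B oO uH pH; have phiu := in_H1B oO pH uH.
have h1 : L2norm Omega u <= L2norm Omega (u - phi) + L2norm Omega phi.
  by rewrite -{1}(subrK phi u); apply: L2normD; [exact: uphi.1|exact: pH.1].
have h2 : gradnorm Omega phi <= gradnorm Omega (u - phi) + gradnorm Omega u.
  by rewrite (gradnormC oO uH pH) -{1}(subrK u phi); exact: gradnormD.
have h3 := test_poincare oO i A0 OA tphi.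
have h4 := L2norm_wderiv_le Omega i phi; rewrite test_wderiv// in h4.
have h5 : 2 * A * L2norm Omega ('D_(delta_mx ord0 i) phi) <=
    2 * A * (e / (2 * A + 1) + gradnorm Omega u).
  by rewrite ler_wpM2l ?mulr_ge0//; apply: le_trans h4 (le_trans h2 _); rewrite lerD2r ltW.
have E : 2 * A * (e / (2 * A + 1)) + e / (2 * A + 1) = e.
  by rewrite -[X in _ + X]mul1r -mulrDl mulrC divfK// gt_eqF.
rewrite mulrDr in h5; apply: le_trans h1 _.
apply: le_trans (lerD (ltW p1) (le_trans h3 h5)) _.
by rewrite addrA [X in X + _]addrC E addrC.
Qed.

(** By Poincare the sequence is also Cauchy in L^2. The L^2 limits of its weak derivatives are weak
    derivatives of its limit, since both sides of the defining identity are L^2-continuous; test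
    functions close to [u k] for large [k] place the limit in H^1_0. *)
Lemma H10_complete (u : nat -> V -> R) : (forall k, in_H10 Omega (u k)) ->
  (forall e : R, 0 < e -> exists K, forall j k, (K <= j)%N -> (K <= k)%N ->
     gradnorm Omega (u j - u k) < e) ->
  exists2 l, in_H10 Omega l & forall e : R, 0 < e -> exists K, forall k, (K <= k)%N ->
     gradnorm Omega (u k - l) < e.
Proof.
move=> uH uC; have uH1 k := in_H10_H1 (uH k).
have [k|e e0|l l2 lP] := @in_L2_complete _ _ Omega mO u.
- exact: in_H10_L2.
- have c0 : 0 < 2 * A + 1 by rewrite ltr_wpDl// mulr_ge0.
  have [|K KP] := uC (e / (2 * A + 1)); first by rewrite divr_gt0.
  exists K => j k Kj Kk; apply: le_lt_trans (poincare (in_H10B (uH j) (uH k))) _.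
  have := KP _ _ Kj Kk; rewrite ltr_pdivlMr//; apply: le_lt_trans.
  by rewrite mulrC ler_wpM2l ?gradnorm_ge0// lerDl.
have /choice[g gP] : forall j : 'I_n, exists g, in_L2 Omega g /\
    forall e : R, 0 < e -> exists K, forall k, (K <= k)%N ->
      L2norm Omega (wderiv Omega j (u k) - g) < e.
  move=> j; have [k|e e0|g g2 gP] := @in_L2_complete _ _ Omega mO (fun k => wderiv Omega j (u k)).
  - exact: wderiv_L2.
  - have [K KP] := uC e e0; exists K => k k' Kk Kk'.
    rewrite -wderiv_normB//; apply: le_lt_trans (KP _ _ Kk Kk').
    exact: L2norm_wderiv_le.
  - by exists g.
have lg j : weak_partial Omega j l (g j).
  move=> phi tphi; have [g2 gc] := gP j.
  have p2 := test_L2 tphi; have d2 := test_partial_L2 j tphi.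
  set d := 'D_(delta_mx ord0 j) phi in d2 *.
  apply/eqP; rewrite -addr_eq0 -normr_le0; apply/ler_addgt0Pr => e e0; rewrite add0r.
  have c0 : 0 < L2norm Omega d + L2norm Omega phi + 1.
    by rewrite ltr_wpDl// addr_ge0 ?L2norm_ge0.
  have e'0 : 0 < e / (L2norm Omega d + L2norm Omega phi + 1) by rewrite divr_gt0.
  set e' := e / _ in e'0.
  have [K KP] := lP _ e'0; have [K' KP'] := gc _ e'0; pose k := maxn K K'.
  have [w2 wp] := wderivP j (uH1 k).
  have := wp _ tphi; rewrite -/d => /eqP; rewrite -addr_eq0 => /eqP Z.
  have u2 := in_H10_L2 (uH k).
  have e1 := Rintegral_lin_mul oO (-1) l2 u2 d2.
  have e2 := Rintegral_lin_mul oO (-1) g2 w2 p2.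
  rewrite mulN1r scaleN1r addrC in e1; rewrite mulN1r scaleN1r addrC in e2.
  (* The defect of the identity for [l] equals, up to sign, its defect for the differences, because
     the identity holds for [u k]. *)
  have -> : \int[mu]_(x in Omega) (l x * d x) + \int[mu]_(x in Omega) (g j x * phi x) =
    - (\int[mu]_(x in Omega) ((u k - l) x * d x) +
       \int[mu]_(x in Omega) ((wderiv Omega j (u k) - g j) x * phi x)).
    rewrite [X in - (X + _)]e1 [X in - (_ + X)]e2 addrACA.
    by rewrite Z addr0 -opprD opprK.
  rewrite normrN; apply: le_trans (ler_normD _ _) _.
  have f1 := in_L2_cauchy_schwarz (in_L2B u2 l2) d2.
  have f2 := in_L2_cauchy_schwarz (in_L2B w2 g2) p2.
  apply: le_trans (lerD f1 f2) _.
  have f3 := ltW (KP k (leq_maxl _ _)); have f4 := ltW (KP' k (leq_maxr _ _)).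
  apply: le_trans (lerD (ler_wpM2r (L2norm_ge0 _ _) f3) (ler_wpM2r (L2norm_ge0 _ _) f4)) _.
  rewrite -mulrDr /e' mulrAC ler_pdivrMr// ler_wpM2l ?(ltW e0)//.
  by rewrite lerDl.
have lH : in_H1 Omega l by split => // j; exists (g j); [exact: (gP j).1|exact: lg].
have ul (e : R) : 0 < e -> exists K, forall k, (K <= k)%N -> gradnorm Omega (u k - l) < e.
  move=> e0.
  (* Dividing by n + 1 makes the sum of the [n] errors strictly smaller than [e]. *)
  have n0 : (0 : R) < n.+1%:R by rewrite ltr0n.
  have /choice[K KP] : forall j : 'I_n, exists K, forall k, (K <= k)%N ->
      L2norm Omega (wderiv Omega j (u k) - g j) < e / n.+1%:R.
    by move=> j; have [_] := gP j; apply; rewrite divr_gt0.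
  exists (\max_j K j)%N => k Kk.
  apply: le_lt_trans (gradnorm_le _ _) _.
  apply: (@le_lt_trans _ _ (\sum_(j < n) e / n.+1%:R)).
    apply: ler_sum => j _; rewrite wderiv_normB//.
    have wg := wderiv_unique oO lH (gP j).1 (lg j).
    have := KP j k (leq_trans (leq_bigmax j) Kk); move=> /ltW; apply: le_trans.
    rewrite le_eqVlt; apply/orP; left; apply/eqP; apply: L2norm_ae.
    - by apply: in_L2B; exact: wderiv_L2.
    - by apply: in_L2B; [exact: wderiv_L2|exact: (gP j).1].
    - by apply: filterS wg => x h Ox; rewrite !fctE h.
  rewrite sumr_const card_ord -[_ *+ n]mulr_natr mulrAC ltr_pdivrMr// ltr_pM2l//.
  by rewrite ltr_nat.
exists l => //; apply/in_H10P; split => // e e0.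
have e2 : 0 < e / 2 by lra.
have [K KP] := lP _ e2; have [K' KP'] := ul _ e2; pose k := maxn K K'.
have [_ /(_ _ e2)[phi tphi [p1 p2]]] := (in_H10P (u k)).1 (uH k).
have pH := test_H1 oO tphi; exists phi => //.
have h1 := KP k (leq_maxl _ _); have h2 := KP' k (leq_maxr _ _).
have uphi := in_H1B oO (uH1 k) pH; have lu := in_H1B oO lH (uH1 k).
have ulH := in_H1B oO (uH1 k) lH.
rewrite -(subrKA (u k) l (- phi)) [e]splitr; split.
  apply: le_lt_trans (L2normD lu.1 uphi.1) _.
  by rewrite ltrD// L2normC//; exact: in_H10_L2.
apply: le_lt_trans (gradnormD oO lu uphi) _.
by apply: ltrD; [rewrite (gradnormC oO lH (uH1 k)); exact: h2|exact: p2].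
Qed.
End poincare.
End H10.

(** * The energy space *)

Section energy_space.
Context {R : realType} {n : nat}.
Local Notation V := 'rV[R]_n.
Local Notation mu := (@leb R n).
Local Notation H := (state R n).
Variable Omega : set V.
Hypothesis oO : open Omega.
Implicit Types U W : H.

(** Numbering the four slots presents the energy as a Euclidean norm of seminorms; only the indices
    0 to 3 are summed. *)
Definition energy_part U (i : nat) : R := match i with
  | 0 => gradnorm Omega U.1.1.1 | 1 => L2norm Omega U.1.1.2
  | 2 => gradnorm Omega U.1.2 | _ => L2norm Omega U.2 end.

Lemma energy_part_ge0 U i : 0 <= energy_part U i.
Proof.
by case: i => [|[|[|i]]]; rewrite /energy_part ?L2norm_ge0 ?gradnorm_ge0.
Qed.

Lemma normHE U : normH Omega U = Num.sqrt (\sum_(i <- iota 0 4) energy_part U i ^+ 2).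
Proof.
case: U => [[[u1 u2] y1] y2].
by rewrite /normH /= !big_cons big_nil addr0 !addrA.
Qed.

Lemma normH_sqr U : normH Omega U ^+ 2 =
  energy_part U 0 ^+ 2 + energy_part U 1 ^+ 2 + energy_part U 2 ^+ 2 + energy_part U 3 ^+ 2.
Proof.
rewrite normHE sqr_sqrtr; last by apply: sumr_ge0 => i _; exact: sqr_ge0.
by rewrite !big_cons big_nil addr0 !addrA.
Qed.

Lemma inHP U : inH Omega U <-> [/\ in_H10 Omega U.1.1.1, in_L2 Omega U.1.1.2,
  in_H10 Omega U.1.2 & in_L2 Omega U.2].
Proof. by case: U => [[[u1 u2] y1] y2]. Qed.

Lemma energy_part_le U i : (i < 4)%N -> energy_part U i <= normH Omega U.
Proof.
move=> i4; rewrite normHE -[iota 0 4]/(index_iota 0 4) (big_mkord xpredT (fun i => energy_part U i ^+ 2)).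
exact: (@le_sqrt_sum_sqr _ _ (fun i : 'I_4 => energy_part U i) (Ordinal i4) (energy_part_ge0 _ _)).
Qed.

Lemma normH_le U : normH Omega U <=
  energy_part U 0 + energy_part U 1 + energy_part U 2 + energy_part U 3.
Proof.
rewrite normHE -[iota 0 4]/(index_iota 0 4) (big_mkord xpredT (fun i => energy_part U i ^+ 2)).
apply: le_trans (sqrt_sum_sqr_le (x := fun i : 'I_4 => energy_part U i) _) _.
  by move=> i; exact: energy_part_ge0.
by rewrite !big_ord_recr big_ord0/= add0r.
Qed.

Section poincare.
Variables (A : R) (j : 'I_n).
Hypothesis A0 : 0 <= A.
Hypothesis OA : Omega `<=` cube n A.

Lemma energy_complete_seminorm : complete_seminorm (inH Omega) (normH Omega).
Proof.
split.
- by apply/inHP; split; [exact: in_H10_0|exact: in_L2_0|exact: in_H10_0|exact: in_L2_0].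
- move=> k U W /inHP[a1 a2 a3 a4] /inHP[b1 b2 b3 b4]; apply/inHP; split.
  + exact: (in_H10_lin oO k a1 b1).
  + exact: (in_L2D (in_L2Z k a2) b2).
  + exact: (in_H10_lin oO k a3 b3).
  + exact: (in_L2D (in_L2Z k a4) b4).
- move=> k U /inHP[a1 a2 a3 a4]; rewrite !normHE -sqrt_sum_sqrZ.
  congr Num.sqrt; apply: eq_bigr => -[|[|[|i]]] _; congr (_ ^+ 2).
  + exact: (gradnormZ oO k (in_H10_H1 a1)).
  + exact: (L2normZ k a2).
  + exact: (gradnormZ oO k (in_H10_H1 a3)).
  + exact: (L2normZ k a4).
- move=> U W /inHP[a1 a2 a3 a4] /inHP[b1 b2 b3 b4]; rewrite !normHE.
  apply: sqrt_sum_sqr_triangle; try exact: energy_part_ge0.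
  move=> [|[|[|i]]].
  + exact: (gradnormD oO (in_H10_H1 a1) (in_H10_H1 b1)).
  + exact: (L2normD a2 b2).
  + exact: (gradnormD oO (in_H10_H1 a3) (in_H10_H1 b3)).
  + exact: (L2normD a4 b4).
- move=> u uD uC.
  have mO := open_measurable_rV oO.
  have part i : (i < 4)%N -> forall e : R, 0 < e -> exists K, forall j k, (K <= j)%N -> (K <= k)%N ->
      energy_part (u j - u k) i < e.
    move=> i4 e e0; have [K KP] := uC e e0; exists K => p q Kp Kq.
    exact: le_lt_trans (energy_part_le _ i4) (KP _ _ Kp Kq).
  have d1 k : in_H10 Omega (u k).1.1.1.
    by have [h _ _ _] := (inHP (u k)).1 (uD k); exact: h.
  have d2 k : in_L2 Omega (u k).1.1.2.
    by have [_ h _ _] := (inHP (u k)).1 (uD k); exact: h.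
  have d3 k : in_H10 Omega (u k).1.2.
    by have [_ _ h _] := (inHP (u k)).1 (uD k); exact: h.
  have d4 k : in_L2 Omega (u k).2.
    by have [_ _ _ h] := (inHP (u k)).1 (uD k); exact: h.
  have [l1 l1H l1P] := H10_complete oO j A0 OA d1 (part 0%N isT).
  have [l2 l2H l2P] := in_L2_complete mO d2 (part 1%N isT).
  have [l3 l3H l3P] := H10_complete oO j A0 OA d3 (part 2%N isT).
  have [l4 l4H l4P] := in_L2_complete mO d4 (part 3%N isT).
  exists (l1, l2, l3, l4); first exact: (And4 l1H l2H l3H l4H).
  move=> e e0; have e4 : 0 < e / 4 by lra.
  have [K1 K1P] := l1P _ e4; have [K2 K2P] := l2P _ e4.
  have [K3 K3P] := l3P _ e4; have [K4 K4P] := l4P _ e4.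
  exists (maxn (maxn K1 K2) (maxn K3 K4)) => k; rewrite !geq_max => /andP[/andP[k1 k2] /andP[k3 k4]].
  apply: le_lt_trans (normH_le _) _.
  have h1 : energy_part (u k - (l1, l2, l3, l4)) 0 < e / 4 := K1P _ k1.
  have h2 : energy_part (u k - (l1, l2, l3, l4)) 1 < e / 4 := K2P _ k2.
  have h3 : energy_part (u k - (l1, l2, l3, l4)) 2 < e / 4 := K3P _ k3.
  have h4 : energy_part (u k - (l1, l2, l3, l4)) 3 < e / 4 := K4P _ k4.
  have E : e / 4 + e / 4 + e / 4 + e / 4 = e by field.
  by rewrite -E; exact: (ltrD (ltrD (ltrD h1 h2) h3) h4).
Qed.

Lemma ae_eq_sub (f g : V -> R) : ae_eq mu Omega (f - g) 0 <-> ae_eq mu Omega f g.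
Proof.
split; apply: filterS => x h Ox; last by rewrite !fctE h// subrr.
by apply/eqP; rewrite -subr_eq0; apply/eqP; exact: h.
Qed.

(** In the H^1_0 slots, Poincare turns a null gradient norm into a null L^2 norm; conversely the
    gradient norm depends only on the almost everywhere class. *)
Lemma normH_eq0 U W : inH Omega U -> inH Omega W ->
  normH Omega (U - W) = 0 <-> eqH Omega U W.
Proof.
case: U W => [[[u1 u2] y1] y2] [[[v1 v2] z1] z2] [a1 a2 a3 a4] [b1 b2 b3 b4].
set UW := _ - _; split.
  move=> N0; have part i : (i < 4)%N -> energy_part UW i = 0.
    move=> i4; apply/eqP; rewrite eq_le energy_part_ge0 andbT -N0.
    exact: energy_part_le.
  have H10 u v : in_H10 Omega u -> in_H10 Omega v -> gradnorm Omega (u - v) = 0 ->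
      ae_eq mu Omega u v.
    move=> uH vH g0; apply/ae_eq_sub/L2norm_eq0; first exact/in_H10_L2/in_H10B.
    apply/eqP; rewrite eq_le L2norm_ge0 andbT.
    by have := poincare oO j A0 OA (in_H10B oO uH vH); rewrite g0 mulr0.
  have L2 u v : in_L2 Omega u -> in_L2 Omega v -> L2norm Omega (u - v) = 0 ->
      ae_eq mu Omega u v.
    by move=> uH vH g0; apply/ae_eq_sub/L2norm_eq0 => //; exact: in_L2B.
  split.
  - exact: H10 a1 b1 (part 0%N isT).
  - exact: L2 a2 b2 (part 1%N isT).
  - exact: H10 a3 b3 (part 2%N isT).
  - exact: L2 a4 b4 (part 3%N isT).
move=> [e1 e2 e3 e4].
have H10 u v : in_H10 Omega u -> in_H10 Omega v -> ae_eq mu Omega u v ->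
    gradnorm Omega (u - v) = 0.
  move=> uH vH uv; rewrite -(gradnorm0 oO); apply: gradnorm_ae => //.
  - exact/in_H10_H1/in_H10B.
  - exact: in_H1_0.
  - exact/ae_eq_sub.
have L2 u v : in_L2 Omega u -> in_L2 Omega v -> ae_eq mu Omega u v ->
    L2norm Omega (u - v) = 0.
  by move=> uH vH uv; apply: L2norm_ae0; [exact: in_L2B|exact/ae_eq_sub].
apply/eqP; rewrite -sqrf_eq0 normH_sqr.
have -> : energy_part UW 0 = 0 := H10 _ _ a1 b1 e1.
have -> : energy_part UW 1 = 0 := L2 _ _ a2 b2 e2.
have -> : energy_part UW 2 = 0 := H10 _ _ a3 b3 e3.
have -> : energy_part UW 3 = 0 := L2 _ _ a4 b4 e4.
by rewrite expr0n/= !addr0.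
Qed.

Lemma stable_semigroup_of_contraction (S : R -> H -> H) (M alpha : R) :
  contraction_semigroup Omega S -> exp_bound Omega S M alpha -> 0 < M ->
  stable_semigroup (inH Omega) (normH Omega) S M alpha.
Proof.
move=> SP Sexp M0; have DN := energy_complete_seminorm.
have eq0 U W : inH Omega U -> inH Omega W -> eqH Omega U W -> normH Omega (U - W) = 0.
  by move=> DU DW /(normH_eq0 DU DW).
have Slin t k U W : 0 <= t -> inH Omega U -> inH Omega W ->
    normH Omega (S t (k *: U + W) - (k *: S t U + S t W)) = 0.
  move=> t0 DU DW; apply: eq0; last exact: (semigroup_linear SP).
    by apply: (semigroup_in SP) => //; exact: (csn_lin DN).
  by apply: (csn_lin DN); exact: (semigroup_in SP).
have same U W : inH Omega U -> inH Omega W -> normH Omega (U - W) = 0 ->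
    normH Omega U <= normH Omega W.
  by move=> DU DW UW; apply: le_trans (sn_leD DN DU DW) _; rewrite UW addr0.
have bound t c : 0 <= t -> 0 <= c -> (opnormH Omega (S t) <= c%:E)%E ->
    forall U, inH Omega U -> normH Omega (S t U) <= c * normH Omega U.
  move=> t0 c0 Sc U DU; have SU := semigroup_in SP t0 DU.
  have ball W : inH Omega W -> normH Omega W <= 1 -> normH Omega (S t W) <= c.
    move=> DW W1; rewrite -lee_fin; apply: le_trans Sc.
    by apply: ereal_sup_ubound; exists W.
  have N0 := sn_ge0 DN DU.
  have D0 := csn0 DN; have S0 := semigroup_in SP t0 D0.
  (* Linearity at 0 says that S t 0 - (S t 0 + S t 0) is null; [S t 0] need not be the zero
     function. *)
  have NS0 : normH Omega (S t 0) = 0.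
    have := Slin t 1 0 0 t0 D0 D0; rewrite !scale1r addr0 opprD addrA subrr sub0r.
    by rewrite (snN DN S0).
  apply/ler_addgt0Pr => e e0.
  have c1 : 0 < c + 1 by rewrite ltr_wpDl.
  (* The operator norm only sees the unit ball and [U] may have norm zero, so it is scaled by a
     slightly larger positive number; [c + 1] keeps the loss [c * (e / (c + 1))] below [e]. *)
  pose r := normH Omega U + e / (c + 1).
  have r0 : 0 < r by rewrite ltr_wpDl// divr_gt0.
  have DrU := sn_memZ DN r^-1 DU.
  have := ball _ DrU; rewrite (csnZ DN)// ger0_norm ?invr_ge0 ?(ltW r0)//.
  rewrite mulrC ler_pdivrMr// mul1r lerDl divr_ge0 ?(ltW e0) ?(ltW c1)// => /(_ isT) h.
  have SrU := semigroup_in SP t0 DrU.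
  have := Slin t r^-1 U 0 t0 DU D0; rewrite addr0 => l.
  have DD := sn_memD DN (sn_memZ DN r^-1 SU) S0.
  have l' : normH Omega (r^-1 *: S t U + S t 0) <= c.
    by apply: le_trans h; apply: same => //; rewrite (snC DN).
  have l'' : normH Omega (r^-1 *: S t U) <= c.
    have := snB DN DD S0; rewrite addrK NS0 addr0 => /le_trans; exact.
  move: l''; rewrite (csnZ DN)// ger0_norm ?invr_ge0 ?(ltW r0)//.
  rewrite mulrC ler_pdivrMr// => /le_trans; apply; rewrite /r mulrDr lerD2l.
  by rewrite mulrCA ger_pMr// ler_pdivrMr// mul1r lerDl.
split.
- by move=> t U t0 DU; exact: (semigroup_in SP).
- exact: Slin.
- move=> U DU; apply: eq0 => //; first exact: (semigroup_in SP).
  exact: (semigroup0 SP).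
- move=> s t U s0 t0 DU; apply: eq0; last exact: (semigroupD SP).
    by apply: (semigroup_in SP) => //; rewrite addr_ge0.
  by do !apply: (semigroup_in SP) => //.
- move=> U DU e e0; have /cvgrPdist_lt/(_ _ e0) := semigroup_continuous SP DU.
  move=> [d /= d0 dP]; exists d => // t /andP[t0 td].
  have := dP t; rewrite /= sub0r normrN gtr0_norm// => /(_ td t0).
  by rewrite sub0r normrN; apply: le_lt_trans; exact: ler_norm.
- move=> t U t0 DU; rewrite -[leRHS]mul1r; apply: bound => //.
  exact: (semigroup_contraction SP).
- move=> t U t0 DU; apply: bound => //; last exact: Sexp.
  by rewrite mulr_ge0 ?expR_ge0// ltW.
Qed.

Lemma continuousHP (g : R -> H) : (forall t : R, 0 <= t -> inH Omega (g t)) ->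
  continuousH Omega g <-> cont0 (normH Omega) g.
Proof.
move=> Dg; have DN := energy_complete_seminorm; split=> cg t t0.
  move=> e e0; have /cvgrPdist_lt/(_ _ e0)[d /= d0 dP] := cg t t0.
  exists d => // s s0 st; have := dP s; rewrite /= distrC => /(_ st).
  rewrite in_itv/= s0 => /(_ isT); rewrite sub0r normrN.
  by apply: le_lt_trans; exact: ler_norm.
apply/cvgrPdist_lt => e e0; have [d d0 dP] := cg t t0 e e0.
exists d => //= s st; rewrite in_itv/= andbT => s0.
rewrite sub0r normrN ger0_norm; last by exact: (sn_ge0 DN (sn_memB DN (Dg _ s0) (Dg _ t0))).
by apply: dP => //; rewrite distrC.
Qed.

End poincare.
End energy_space.

(** * The damping and source operators *)

Section operators.
Context {R : realType} {n : nat}.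
Local Notation V := 'rV[R]_n.
Local Notation mu := (@leb R n).
Local Notation H := (state R n).
Variable Omega : set V.
Hypothesis oO : open Omega.

Let mO : measurable Omega. Proof. exact: open_measurable_rV. Qed.

Lemma Linftynorm_ge0 (f : V -> R) : 0 <= Linftynorm Omega f.
Proof. by rewrite fine_ge0// Lnorm_ge0. Qed.

Lemma funrneg_restrict (a : V -> R) : (a^\-) \_ Omega = (a \_ Omega)^\-.
Proof.
apply/funext => x; rewrite /funrneg !patchE; case: ifP => //.
by rewrite oppr0 maxxx.
Qed.

Lemma Linfty_measurable (a : V -> R) : in_Linfty Omega a -> measurable_fun setT (a \_ Omega).
Proof. by rewrite /in_Linfty inE => /andP[]; rewrite inE. Qed.

Lemma ae_le_Linftynorm_neg (a : V -> R) : in_Linfty Omega a ->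
  \forall x \ae mu, Omega x -> a^\- x <= Linftynorm Omega a^\-.
Proof.
move=> aL; have : finite_norm mu +oo%E (a \_ Omega).
  by move: aL; rewrite /in_Linfty inE => /andP[_]; rewrite inE.
rewrite /finite_norm /Linftynorm unlock /Lnorm.
(* On a space of measure zero the norm is 0 by convention, and every property holds almost
   everywhere. *)
case: ifPn => [mu0 afin|]; last first.
  rewrite -leNgt measure_le0 => /eqP mu0 _.
  by exists setT; split.
set f := EFin \o _ in afin; set g := EFin \o a^\- \_ Omega.
(* The essential supremum of the negative part is finite by comparison with |a|; only then does
   [fine] preserve the bound. *)
have gf : (ess_sup mu (abse \o g) <= ess_sup mu (abse \o f))%E.
  apply: le_ess_sup; apply: nearW => x; rewrite /f /g /= funrneg_restrict lee_fin.
  rewrite /funrneg ger0_norm; last by rewrite le_max lexx orbT.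
  by rewrite ge_max normr_ge0 andbT -normrN ler_norm.
have g0 : (0 <= ess_sup mu (abse \o g))%E.
  by apply: ess_sup_gee => //; apply: nearW => x; exact: abse_ge0.
have gE : ess_sup mu (abse \o g) \is a fin_num.
  by rewrite ge0_fin_numE//; exact: le_lt_trans gf afin.
have := ess_sup_ge mu (abse \o g); apply: filterS => x h Ox.
rewrite -lee_fin fineK//; apply: le_trans h.
by rewrite /g /= patchE mem_set// lee_fin ler_norm.
Qed.

Lemma L2norm_mul_neg (a y : V -> R) : in_Linfty Omega a -> in_L2 Omega y ->
  in_L2 Omega (a^\- * y) /\
  L2norm Omega (a^\- * y) <= Linftynorm Omega a^\- * L2norm Omega y.
Proof.
move=> aL y2; set k := Linftynorm Omega _.
have k0 : 0 <= k by exact: Linftynorm_ge0.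
rewrite (_ : k * L2norm Omega y = L2norm Omega (k *: y)); last by rewrite L2normZ// ger0_norm.
apply: (@L2_dominated _ _ _ mu ((a^\- * y) \_ Omega) ((k *: y) \_ Omega)).
- rewrite (_ : _ \_ _ = (a \_ Omega)^\- \* (y \_ Omega)).
    apply: measurable_funM; last exact: L2_measurable y2.
    by apply: measurable_funrneg; exact: Linfty_measurable.
  rewrite -funrneg_restrict; apply/funext => x; rewrite /= !patchE.
  by case: ifP => //; rewrite mul0r.
- exact: in_L2Z.
- apply: filterS (ae_le_Linftynorm_neg aL) => x h.
  rewrite !patchE; case: ifPn => //; rewrite inE => /h ak.
  rewrite !fctE normrM [X in _ <= X]normrM ler_wpM2r// !ger0_norm//.
Qed.

Lemma in_L2_eL2norm (f : V -> R) : measurable_fun setT (f \_ Omega) ->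
  (eL2norm Omega f < +oo)%E -> in_L2 Omega f.
Proof.
by move=> mf ff; rewrite /in_L2 inE; apply/andP; split; rewrite inE.
Qed.

Section nonlinearity.
Variables (f L : R -> R).
Hypotheses (cf : continuous f) (f0 : f 0 = 0).
Hypothesis L_gt0 : forall r : R, 0 < r -> 0 < L r.
Hypothesis fL : forall (r : R) (u v : V -> R), 0 < r -> in_H10 Omega u -> in_H10 Omega v ->
  gradnorm Omega u <= r -> gradnorm Omega v <= r ->
  (eL2norm Omega ((f \o u) - (f \o v))%R <= (L r * gradnorm Omega (u - v)%R)%:E)%E.

(** Because f 0 = 0, composition commutes with extension by zero. *)
Lemma comp_measurable (u : V -> R) : in_L2 Omega u -> measurable_fun setT ((f \o u) \_ Omega).
Proof.
move=> u2; rewrite (_ : _ \_ _ = f \o (u \_ Omega)).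
  apply: measurableT_comp; last exact: L2_measurable u2.
  exact: continuous_measurable_fun.
by apply/funext => x; rewrite /= !patchE; case: ifP.
Qed.

Lemma comp_L2 (u : V -> R) : in_H10 Omega u -> in_L2 Omega (f \o u).
Proof.
move=> uH; apply: in_L2_eL2norm; first by apply: comp_measurable; exact: in_H10_L2 uH.
(* The [+ 1] makes the radius positive; the comparison with v = 0 then bounds the extended norm of
   [f \o u]. *)
have r0 : 0 < gradnorm Omega u + 1 by rewrite ltr_wpDl// gradnorm_ge0.
have := fL r0 uH (in_H10_0 oO) _ _; rewrite (gradnorm0 oO) lerDl ler01 ltW// => /(_ isT isT).
rewrite (_ : (f \o u) - (f \o 0) = f \o u).
  by move/le_lt_trans; apply; exact: ltry.
by apply/funext => x; rewrite !fctE f0 subr0.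
Qed.

Lemma comp_lip (r : R) (u v : V -> R) : 0 < r -> in_H10 Omega u -> in_H10 Omega v ->
  gradnorm Omega u <= r -> gradnorm Omega v <= r ->
  L2norm Omega ((f \o u) - (f \o v)) <= L r * gradnorm Omega (u - v).
Proof.
move=> r0 uH vH ur vr; rewrite -lee_fin; apply: le_trans (fL r0 uH vH ur vr).
by rewrite [X in (X <= _)%E](nrm2_fin (in_L2B (comp_L2 uH) (comp_L2 vH))).
Qed.
End nonlinearity.

Lemma normH_le_parts (U W : H) (c : R) : 0 <= c ->
  energy_part Omega U 0 ^+ 2 + energy_part Omega U 1 ^+ 2 +
  energy_part Omega U 2 ^+ 2 + energy_part Omega U 3 ^+ 2 <=
  c ^+ 2 * (energy_part Omega W 0 ^+ 2 + energy_part Omega W 1 ^+ 2 +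
  energy_part Omega W 2 ^+ 2 + energy_part Omega W 3 ^+ 2) ->
  normH Omega U <= c * normH Omega W.
Proof.
move=> c0 h; have N0 W' : 0 <= normH Omega W' by rewrite normHE sqrtr_ge0.
rewrite -(@ler_pXn2r _ 2) ?nnegrE ?mulr_ge0//.
by rewrite exprMn !normH_sqr.
Qed.

Lemma a2P_in (a2 : V -> R) U : in_Linfty Omega a2 -> inH Omega U -> inH Omega (op_a2P a2 U).
Proof.
case: U => [[[u1 u2] y1] y2] aL [b1 b2 b3 b4].
exact: (And4 (in_H10_0 oO) (in_L2_0 Omega) (in_H10_0 oO) (L2norm_mul_neg aL b4).1).
Qed.

Lemma a2P_lip (a2 : V -> R) U W : in_Linfty Omega a2 -> inH Omega U -> inH Omega W ->
  normH Omega (op_a2P a2 U - op_a2P a2 W) <= Linftynorm Omega a2^\- * normH Omega (U - W).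
Proof.
case: U W => [[[u1 u2] y1] y2] [[[v1 v2] z1] z2] aL [b1 b2 b3 b4] [d1 d2 d3 d4].
apply: normH_le_parts; first exact: Linftynorm_ge0.
set X := op_a2P _ _ - _; set Y := (_, _) - _; set k := Linftynorm _ _.
have k0 : 0 <= k by exact: Linftynorm_ge0.
have e0 : energy_part Omega X 0 = 0.
  by rewrite /energy_part /X /op_a2P /= subrr (gradnorm0 oO).
have e1 : energy_part Omega X 1 = 0.
  by rewrite /energy_part /X /op_a2P /= subrr L2norm0.
have e2 : energy_part Omega X 2 = 0.
  by rewrite /energy_part /X /op_a2P /= subrr (gradnorm0 oO).
have e3 : energy_part Omega X 3 <= k * energy_part Omega Y 3.
  rewrite /energy_part /X /Y /op_a2P /= -mulrBr.
  exact: (L2norm_mul_neg aL (in_L2B b4 d4)).2.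
have e30 := energy_part_ge0 Omega X 3.
rewrite e0 e1 e2 expr0n/= !add0r mulrDr -exprMn.
apply: le_trans (_ : (k * energy_part Omega Y 3) ^+ 2 <= _); last first.
  by rewrite lerDr mulr_ge0 ?sqr_ge0// !addr_ge0 ?sqr_ge0.
by rewrite lerXn2r ?nnegrE// mulr_ge0// energy_part_ge0.
Qed.

Section nonlinear_operator.
Variables (f1 f2 L : R -> R).
Hypotheses (cf1 : continuous f1) (cf2 : continuous f2) (f10 : f1 0 = 0) (f20 : f2 0 = 0).
Hypothesis L_gt0 : forall r : R, 0 < r -> 0 < L r.
Hypothesis fL : forall (f : R -> R), f = f1 \/ f = f2 ->
  forall (r : R) (u v : V -> R), 0 < r -> in_H10 Omega u -> in_H10 Omega v ->
  gradnorm Omega u <= r -> gradnorm Omega v <= r ->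
  (eL2norm Omega ((f \o u) - (f \o v))%R <= (L r * gradnorm Omega (u - v)%R)%:E)%E.

Let f1L := fL (or_introl erefl).
Let f2L := fL (or_intror erefl).

Lemma F_in U : inH Omega U -> inH Omega (op_F f1 f2 U).
Proof.
case: U => [[[u1 u2] y1] y2] [b1 b2 b3 b4].
exact: (And4 (in_H10_0 oO) (comp_L2 cf1 f10 f1L b1) (in_H10_0 oO) (comp_L2 cf2 f20 f2L b3)).
Qed.

(** The source sends displacement slots to velocity slots: slot 1 of the image is controlled by slot
    0 and slot 3 by slot 2. These being disjoint, the squares add up with the single constant
    [L r]. *)
Lemma F_lip (r : R) U W : 0 < r -> inH Omega U -> inH Omega W ->
  normH Omega U <= r -> normH Omega W <= r ->
  normH Omega (op_F f1 f2 U - op_F f1 f2 W) <= L r * normH Omega (U - W).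
Proof.
move=> r0 DU DW Ur Wr; have L0 := ltW (L_gt0 r0).
have u0 := le_trans (energy_part_le Omega U (isT : (0 < 4)%N)) Ur.
have w0 := le_trans (energy_part_le Omega W (isT : (0 < 4)%N)) Wr.
have u2 := le_trans (energy_part_le Omega U (isT : (2 < 4)%N)) Ur.
have w2 := le_trans (energy_part_le Omega W (isT : (2 < 4)%N)) Wr.
apply: normH_le_parts => //; move: DU DW u0 w0 u2 w2 {Ur Wr}.
case: U W => [[[u1 u2] y1] y2] [[[v1 v2] z1] z2] [b1 b2 b3 b4] [d1 d2 d3 d4].
move=> g1 g2 g3 g4.
set X := op_F _ _ _ - _; set Y := (_, _) - _.
have e0 : energy_part Omega X 0 = 0.
  by rewrite /energy_part /X /op_F /= subrr (gradnorm0 oO).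
have e2 : energy_part Omega X 2 = 0.
  by rewrite /energy_part /X /op_F /= subrr (gradnorm0 oO).
have e1 : energy_part Omega X 1 <= L r * energy_part Omega Y 0 := comp_lip cf1 f10 f1L r0 b1 d1 g1 g2.
have e3 : energy_part Omega X 3 <= L r * energy_part Omega Y 2 := comp_lip cf2 f20 f2L r0 b3 d3 g3 g4.
have sq a b : 0 <= a -> 0 <= b -> a <= L r * b -> a ^+ 2 <= L r ^+ 2 * b ^+ 2.
  by move=> a0 b0 ab; rewrite -exprMn lerXn2r ?nnegrE// mulr_ge0.
have := sq _ _ (energy_part_ge0 Omega X 1) (energy_part_ge0 Omega Y 0) e1.
have := sq _ _ (energy_part_ge0 Omega X 3) (energy_part_ge0 Omega Y 2) e3.
rewrite e0 e2 expr0n/= add0r addr0 !mulrDr.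
have := mulr_ge0 (sqr_ge0 (L r)) (sqr_ge0 (energy_part Omega Y 1)).
have := mulr_ge0 (sqr_ge0 (L r)) (sqr_ge0 (energy_part Omega Y 3)).
move=> p3 p1 q3 q1; apply: le_trans (lerD q1 q3) _.
by rewrite -[leRHS]addrA; apply: lerD; rewrite lerDl.
Qed.
End nonlinear_operator.
End operators.



Theorem theorem3p4 (R : realType) (n : nat)
    (Omega omega omegab : set 'rV[R]_n) (a1 a2 b : 'rV[R]_n -> R)
    (f1 f2 L : R -> R) (S : R -> state R n -> state R n) (M alpha : R)
    (n_gt0 : (0 < n)%N)
    (OmegaP : [/\ open Omega, connected Omega, Omega !=set0 & bounded_set Omega])
    (OmegaC2 : C2_boundary Omega)
    (omegaP : open omega /\ omega `<=` Omega)
    (omegabP : open omegab /\ omegab !=set0)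
    (a1P : damping Omega omega a1)
    (a2P : in_Linfty Omega a2)
    (bP : coupling Omega omegab b)
    (geom : G1 Omega omega omegab \/ G2 Omega omega omegab b)
    (fP : hypothesis_N Omega f1 f2 L)
    (SP : generates Omega (dom_A Omega) (op_A Omega a1 b a2) S)
    (M_gt0 : 0 < M) (alpha_gt0 : 0 < alpha)
    (Sdecay : exp_bound Omega S M alpha)
    (a2_small : Linftynorm Omega a2^\- < alpha / M) :
  exists2 rho0 : R, 0 < rho0 &
  forall rho : R, 0 < rho < rho0 ->
  exists C : R, [/\ 0 < C,
    L C < (alpha - M * Linftynorm Omega a2^\-) / M &
    forall U0, inH Omega U0 -> normH Omega U0 < rho ->
    exists U : R -> state R n,
      [/\ mild_solution Omega S a2 f1 f2 U0 U,
          forall W, mild_solution Omega S a2 f1 f2 U0 W ->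
            forall t : R, 0 <= t -> eqH Omega (W t) (U t) &
          forall t : R, 0 <= t ->
            normH Omega (U t) <= M * normH Omega U0 *
              expR (- (alpha - M * Linftynorm Omega a2^\- - M * L C) * t)]].
Proof.
have [oO _ _ bO] := OmegaP.
have [A A0 OA] := bounded_sub_cube bO.
have [contS _] := SP.
have [[cf1 cf2] [f10 f20] fLip L0 _] := fP.
(* The Poincare inequality is proved along one coordinate direction; any will do. *)
pose j : 'I_n := Ordinal n_gt0.
have DN := energy_complete_seminorm oO j A0 OA.
have SG := stable_semigroup_of_contraction oO j A0 OA contS Sdecay M_gt0.
have N0E U W := normH_eq0 oO j A0 OA (U := U) (W := W).
have contE g := continuousHP oO j A0 OA (g := g).
have L_gt0 r : 0 < r -> 0 < L r by move=> /fLip[].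
have fL f : f = f1 \/ f = f2 -> forall (r : R) u v, 0 < r -> in_H10 Omega u ->
    in_H10 Omega v -> gradnorm Omega u <= r -> gradnorm Omega v <= r ->
    (eL2norm Omega ((f \o u) - (f \o v))%R <= (L r * gradnorm Omega (u - v)%R)%:E)%E.
  by move=> ff r u v r0; have [_] := fLip r r0; apply.
set k := Linftynorm Omega a2^\- in a2_small *.
have k0 : 0 <= k by exact: Linftynorm_ge0.
have Pin U := @a2P_in _ _ _ oO a2 U a2P.
have Plip U W := @a2P_lip _ _ _ oO a2 U W a2P.
have Fin U := @F_in _ _ _ oO f1 f2 L cf1 cf2 f10 f20 fL U.
have Flip r U W := @F_lip _ _ _ oO f1 f2 L cf1 cf2 f10 f20 L_gt0 fL r U W.
have P0 : normH Omega (op_a2P a2 (0 : state R n)) = 0.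
  rewrite (_ : op_a2P a2 (0 : state R n) = 0) ?(sn0 DN)//.
  by rewrite /op_a2P /= mulr0.
have F0 : normH Omega (op_F f1 f2 (0 : state R n)) = 0.
  rewrite (_ : op_F f1 f2 (0 : state R n) = 0) ?(sn0 DN)//.
  rewrite /op_F /= (_ : f1 \o 0 = 0); last by apply/funext => x /=; exact: f10.
  by rewrite (_ : f2 \o 0 = 0)//; apply/funext => x /=; exact: f20.
have gap : 0 < (alpha - M * k) / M.
  by rewrite divr_gt0// subr_gt0 mulrC -ltr_pdivlMr.
(* [C] comes from [L] tending to 0 at 0, before [rho] is given: one value serves all small [rho]. *)
have [C [C0 LC]] : exists C : R, 0 < C /\ L C < (alpha - M * k) / M.
  have /cvgrPdist_lt/(_ _ gap)[d /= d0 dP] := L0.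
  exists (d / 2); split; first by rewrite divr_gt0.
  have := dP (d / 2); rewrite /= sub0r normrN gtr0_norm ?divr_gt0//.
  rewrite ltr_pdivrMr// ltr_pMr// ltr1n => /(_ isT isT).
  by rewrite sub0r normrN; apply: le_lt_trans; exact: ler_norm.
exists (C / M); first by rewrite divr_gt0.
move=> rho /andP[rho0 rhoC]; exists C; split => // U0 DU0 U0rho.
have U0C : M * normH Omega U0 <= C.
  by rewrite mulrC -ler_pdivlMr// ltW// (lt_trans U0rho).
(* The integrals agree by conversion; what is translated is continuity and, through [normH_eq0],
   almost everywhere equality into zero distance. *)
have mildE U : mild_solution Omega S a2 f1 f2 U0 U <->
    mild (inH Omega) (normH Omega) S (op_a2P a2) (op_F f1 f2) U0 U.
  split=> -[DU cU dU]; split => //; try exact/contE; move=> t t0;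
    have [I1 [I2 [c1 c2 E]]] := dU t t0; exists I1, I2; split => //.
    apply/N0E => //; first exact: DU.
    apply: (sn_memD DN); last by case: c2.
    by apply: (sn_memD DN); [exact: (sg_in SG)|case: c1].
  apply/N0E => //; first exact: DU.
  apply: (sn_memD DN); last by case: c2.
  by apply: (sn_memD DN); [exact: (sg_in SG)|case: c1].
have [U [mU decU]] := mild_exists DN SG M_gt0 alpha_gt0 k0 Pin Fin Plip L_gt0 Flip P0 F0 C0 LC DU0 U0C.
exists U; split; first exact/mildE.
  move=> W /mildE mW t t0.
  have WU := mild_unique DN SG k0 Pin Fin Plip L_gt0 Flip DU0 mU mW t0.
  have [DU _ _] := mU; have [DW _ _] := mW.
  by apply/N0E; [exact: DW|exact: DU|exact: WU].
exact: decU.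
Qed.
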